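(* Let $k$ be a number field. The set $\{K\in\mathcal{E}_{\mathrm{ram}}(k)\mid X(K)\text{ is a finitely generated }\mathbb{Z}_p\text{-module of rank }s(k)\}$ is an open subset of $\mathcal{E}(k)$.
   Context: $p$ is a fixed prime. For an algebraic extension $F/\mathbb{Q}$, $X(F)$ is the Galois group of the maximal unramified abelian pro-$p$ extension of $F$. $\mathcal{E}(k)$ is the set of all $\mathbb{Z}_p$-extensions of $k$, topologized so that a fundamental system of neighbourhoods of $K_0$ is $\{K\in\mathcal{E}(k):[K\cap K_0:k]\ge p^n\}$, $n\ge0$. $\mathcal{E}_{\mathrm{ram}}(k)$ is the set of $K\in\mathcal{E}(k)$ in which every prime of $k$ above $p$ ramifies. For $K\in\mathcal{E}(k)$, $s(K/k)=\mathrm{rank}_{\mathbb{Z}_p}X(K)_{\mathrm{Gal}(K/k)}$, and $s(k)=\min\{s(K/k):K\in\mathcal{E}_{\mathrm{ram}}(k)\}$. *)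

(* Defs.v *)
From HB Require Import structures.
From mathcomp Require Import all_boot all_order all_algebra all_field.
From mathcomp Require Import boolp classical_sets functions filter.
From mathcomp Require Import topology_structure.
Set Implicit Arguments.
Unset Strict Implicit.
Unset Printing Implicit Defensive.
Import GRing.Theory.
Local Open Scope ring_scope.

(* The inverse limit of the rings Z/p^n, whose elements are represented by
   the integers that are reduced modulo p^n. *)
Definition padic_compat (p : nat) (x : nat -> int) :=
  forall n, x n = (x n.+1 %% (p ^ n)%N)%Z.

Record Zp (p : nat) := MkZp { zp_seq : nat -> int; zp_compat : padic_compat p zp_seq }.

HB.instance Definition _ p := gen_eqMixin (Zp p).
HB.instance Definition _ p := gen_choiceMixin (Zp p).

Section ZpRing.
Variable p : nat.
Implicit Types x y z : Zp p.

Lemma zp_eq x y : zp_seq x =1 zp_seq y -> x = y.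
Proof.
case: x y => [x hx] [y hy] /= /funext exy.
by subst y; congr MkZp; exact: Prop_irrelevance.
Qed.

Lemma modz_expS (a : int) n : ((a %% (p ^ n.+1)%N)%Z %% (p ^ n)%N)%Z = (a %% (p ^ n)%N)%Z.
Proof.
rewrite {2}(divz_eq a (p ^ n.+1)%N) expnS PoszM mulrA modzMDl //.
Qed.

Lemma zp_mod x n : (zp_seq x n %% (p ^ n)%N)%Z = zp_seq x n.
Proof. by rewrite (zp_compat x) modz_mod. Qed.

Lemma zp_of_subproof (f : nat -> int) :
  (forall n, f n.+1 = f n %[mod (p ^ n)%N])%Z ->
  padic_compat p (fun n => f n %% (p ^ n)%N)%Z.
Proof. by move=> hf n; rewrite modz_expS hf. Qed.

Definition zp_of f hf := MkZp (@zp_of_subproof f hf).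

Lemma zp_succ x n : (zp_seq x n.+1 = zp_seq x n %[mod (p ^ n)%N])%Z.
Proof. by rewrite (zp_compat x n) modz_mod. Qed.

Definition zp_int (a : int) := @zp_of (fun _ => a) (fun _ => erefl).

Fact zp_add_subproof x y n :
  (zp_seq x n.+1 + zp_seq y n.+1 = zp_seq x n + zp_seq y n %[mod (p ^ n)%N])%Z.
Proof. by rewrite -modzDm !zp_succ modzDm. Qed.
Definition zp_add x y := zp_of (zp_add_subproof x y).

Fact zp_opp_subproof x n : (- zp_seq x n.+1 = - zp_seq x n %[mod (p ^ n)%N])%Z.
Proof. by rewrite -modzNm zp_succ modzNm. Qed.
Definition zp_opp x := zp_of (zp_opp_subproof x).

Fact zp_mul_subproof x y n :
  (zp_seq x n.+1 * zp_seq y n.+1 = zp_seq x n * zp_seq y n %[mod (p ^ n)%N])%Z.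
Proof. by rewrite -modzMm !zp_succ modzMm. Qed.
Definition zp_mul x y := zp_of (zp_mul_subproof x y).

Fact zp_addA : associative zp_add.
Proof. by move=> x y z; apply: zp_eq => n /=; rewrite modzDml modzDmr addrA. Qed.
Fact zp_addC : commutative zp_add.
Proof. by move=> x y; apply: zp_eq => n /=; rewrite addrC. Qed.
Fact zp_add0 : left_id (zp_int 0) zp_add.
Proof. by move=> x; apply: zp_eq => n /=; rewrite mod0z add0r zp_mod. Qed.
Fact zp_addN : left_inverse (zp_int 0) zp_opp zp_add.
Proof. by move=> x; apply: zp_eq => n /=; rewrite modzDml addNr. Qed.
HB.instance Definition _ :=
  GRing.isZmodule.Build (Zp p) zp_addA zp_addC zp_add0 zp_addN.

Fact zp_mulA : associative zp_mul.
Proof. by move=> x y z; apply: zp_eq => n /=; rewrite modzMml modzMmr mulrA. Qed.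
Fact zp_mulC : commutative zp_mul.
Proof. by move=> x y; apply: zp_eq => n /=; rewrite mulrC. Qed.
Fact zp_mul1 : left_id (zp_int 1) zp_mul.
Proof. by move=> x; apply: zp_eq => n /=; rewrite modzMml mul1r zp_mod. Qed.
Fact zp_mulD : left_distributive zp_mul zp_add.
Proof.
by move=> x y z; apply: zp_eq => n /=; rewrite modzMml modzDm mulrDl.
Qed.
HB.instance Definition _ :=
  GRing.Zmodule_isComPzRing.Build (Zp p) zp_mulA zp_mulC zp_mul1 zp_mulD.

Definition zp_open : set_system (Zp p) :=
  fun U => forall x, U x -> exists n, forall y, zp_seq y n = zp_seq x n -> U y.

Lemma zp_seq_le x y m n :
  (m <= n)%N -> zp_seq x n = zp_seq y n -> zp_seq x m = zp_seq y m.
Proof.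
move=> /subnK <-; elim: (n - m)%N => // k IH e.
by apply: IH; rewrite (zp_compat x (k + m)) (zp_compat y (k + m)) -addSn e.
Qed.

Fact zp_openT : zp_open setT. Proof. by move=> x _; exists 0. Qed.
Fact zp_openI : setI_closed zp_open.
Proof.
move=> U V hU hV x [/hU [m hm] /hV [n hn]]; exists (maxn m n) => y e; split.
  by apply: hm; apply: zp_seq_le e; exact: leq_maxl.
by apply: hn; apply: zp_seq_le e; exact: leq_maxr.
Qed.
Fact zp_open_bigU (I : Type) (f : I -> set (Zp p)) :
  (forall i, zp_open (f i)) -> zp_open (\bigcup_i f i)%classic.
Proof.
by move=> hf x [i _ /hf [n hn]]; exists n => y /hn fy; exists i.
Qed.
HB.instance Definition _ :=
  isOpenTopological.Build (Zp p) zp_openT zp_openI zp_open_bigU.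

End ZpRing.

Section Modules.
Variables (R : pzRingType) (M : lmodType R).

Definition fin_gen : Prop :=
  exists n (v : 'I_n -> M), forall m, exists a : 'I_n -> R, m = \sum_i a i *: v i.

Definition lin_indep n (v : 'I_n -> M) : Prop :=
  forall a : 'I_n -> R, \sum_i a i *: v i = 0 -> forall i, a i = 0.

(* rank M = r, as the maximal number of linearly independent elements
   (over a domain, the dimension of M after extension to the fraction field). *)
Definition has_rank (r : nat) : Prop :=
  (exists v : 'I_r -> M, lin_indep v) /\
  (forall n (v : 'I_n -> M), lin_indep v -> (n <= r)%N).

Definition submod_span (S : set M) : {pred M} := fun m =>
  `[< forall N : {pred M}, GRing.submod_closed N ->
        (forall s, S s -> s \in N) -> m \in N >].

Lemma submod_span_closed S : GRing.submod_closed (submod_span S).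
Proof.
split=> [|a u v /asboolP hu /asboolP hv]; apply/asboolP => N hN hS.
  by case: hN.
by case: (hN) => _; apply; [exact: hu | exact: hv].
Qed.

End Modules.

(* Algebraic extensions of Q are realized as subfields of its algebraic closure
   algC. *)
Record subfield := MkSubfield {
  sf_fun : algC -> bool;
  sf_closed : GRing.divring_closed (sf_fun : {pred algC}) }.
Definition sf_pred (E : subfield) : {pred algC} := sf_fun E.
Coercion sf_pred : subfield >-> pred_sort.

HB.instance Definition _ (E : subfield) :=
  GRing.isDivringClosed.Build algC (sf_pred E) (sf_closed E).

Section FieldType.
Variable E : subfield.
Record fsub := MkFsub { fval : algC; fvalP : fval \in sf_pred E }.
HB.instance Definition _ := [isSub for fval].
HB.instance Definition _ := [Choice of fsub by <:].
HB.instance Definition _ := [SubChoice_isSubIntegralDomain of fsub by <:].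
HB.instance Definition _ := [SubIntegralDomain_isSubField of fsub by <:].
Fact fval_zmod : GRing.zmod_morphism fval. Proof. by []. Qed.
Fact fval_monoid : GRing.monoid_morphism fval. Proof. by []. Qed.
HB.instance Definition _ := GRing.isZmodMorphism.Build fsub algC fval fval_zmod.
HB.instance Definition _ := GRing.isMonoidMorphism.Build fsub algC fval fval_monoid.
End FieldType.

Definition sub_incl (E L : subfield) (sEL : {subset E <= L}) (x : fsub E) : fsub L :=
  MkFsub (sEL _ (fvalP x)).

(* Gal F E is Aut(E/F): the Galois group of E/F when is_galois F E. *)
Record Gal (F E : subfield) := MkGal {
  gal_fun :> fsub E -> fsub E;
  gal_prop : [/\ zmod_morphism gal_fun, monoid_morphism gal_fun, bijective gal_fun
               & forall x, fval x \in F -> gal_fun x = x] }.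
HB.instance Definition _ F E := gen_eqMixin (Gal F E).
HB.instance Definition _ F E := gen_choiceMixin (Gal F E).
Section GalTheory.
Variables F E : subfield.
Implicit Types (s t u : Gal F E) (x y : fsub E).

Lemma gal_eq s t : s =1 t -> s = t.
Proof.
case: s t => [s hs] [t ht] /= /funext est.
by subst t; congr MkGal; exact: Prop_irrelevance.
Qed.

Fact gal_zmod s : zmod_morphism s. Proof. by case: (gal_prop s). Qed.
Fact gal_monoid s : monoid_morphism s. Proof. by case: (gal_prop s). Qed.
Lemma gal_bij s : bijective s. Proof. by case: (gal_prop s). Qed.
Lemma gal_fix s x : fval x \in F -> s x = x. Proof. by case: (gal_prop s) => _ _ _; apply. Qed.
HB.instance Definition _ s := GRing.isZmodMorphism.Build _ _ (gal_fun s) (gal_zmod s).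
HB.instance Definition _ s := GRing.isMonoidMorphism.Build _ _ (gal_fun s) (gal_monoid s).

Fact gal_one_subproof :
  [/\ zmod_morphism (@id (fsub E)), monoid_morphism (@id (fsub E)),
      bijective (@id (fsub E)) & forall x, fval x \in F -> id x = x].
Proof. by split=> //; exists id. Qed.
Definition gal_one := MkGal gal_one_subproof.

Fact gal_mul_subproof s t :
  [/\ zmod_morphism (s \o t), monoid_morphism (s \o t), bijective (s \o t)
    & forall x, fval x \in F -> (s \o t) x = x].
Proof.
split=> [x y|||x xF] /=; first by rewrite !rmorphB.
- by split=> [|x y]; rewrite /= ?rmorph1 // !rmorphM.
- by apply: bij_comp; exact: gal_bij.
- by rewrite !gal_fix.
Qed.
Definition gal_mul s t := MkGal (gal_mul_subproof s t).

Fact gal_inv_ex s : exists t : Gal F E, cancel s t /\ cancel t s.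
Proof.
have [t st ts] := gal_bij s.
suff ht : [/\ zmod_morphism t, monoid_morphism t, bijective t
  & forall x, fval x \in F -> t x = x] by exists (MkGal ht).
have inj := can_inj st.
split=> [x y|||x xF].
- by apply: inj; rewrite rmorphB /= !ts.
- by split=> [|x y]; apply: inj; rewrite ?rmorphM ?rmorph1 /= ?ts.
- by exists s.
- by apply: inj; rewrite ts gal_fix.
Qed.
Definition gal_inv s := projT1 (cid (gal_inv_ex s)).
Lemma galK s : cancel s (gal_inv s).
Proof. by rewrite /gal_inv; case: cid => t []. Qed.
Lemma galVK s : cancel (gal_inv s) s.
Proof. by rewrite /gal_inv; case: cid => t []. Qed.

Fact gal_mulA : associative gal_mul. Proof. by move=> s t u; exact: gal_eq. Qed.
Fact gal_mul1g : left_id gal_one gal_mul. Proof. by move=> s; exact: gal_eq. Qed.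
Fact gal_mulg1 : right_id gal_one gal_mul. Proof. by move=> s; exact: gal_eq. Qed.
Fact gal_mulVg : left_inverse gal_one gal_inv gal_mul.
Proof. by move=> s; apply: gal_eq => x /=; exact: galK. Qed.
Fact gal_mulgV : right_inverse gal_one gal_inv gal_mul.
Proof. by move=> s; apply: gal_eq => x /=; exact: galVK. Qed.
HB.instance Definition _ :=
  isGroup.Build (Gal F E) gal_mulA gal_mul1g gal_mulg1 gal_mulVg gal_mulgV.

Lemma gal_mulE s t x : (s * t)%g x = s (t x). Proof. by []. Qed.
Lemma gal_1E x : (1%g : Gal F E) x = x. Proof. by []. Qed.

(* The Krull topology: the automorphisms that agree with s on a finite set
   form a basic neighbourhood of s. *)
Definition krull_open : set_system (Gal F E) :=
  fun U => forall s, U s ->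
    exists l : seq (fsub E), forall t, {in l, t =1 s} -> U t.

Fact krull_openT : krull_open setT. Proof. by move=> s _; exists [::]. Qed.
Fact krull_openI : setI_closed krull_open.
Proof.
move=> U V hU hV s [/hU [l hl] /hV [m hm]]; exists (l ++ m) => t e; split.
  by apply: hl => x xl; apply: e; rewrite mem_cat xl.
by apply: hm => x xm; apply: e; rewrite mem_cat xm orbT.
Qed.
Fact krull_open_bigU (I : Type) (f : I -> set (Gal F E)) :
  (forall i, krull_open (f i)) -> krull_open (\bigcup_i f i)%classic.
Proof. by move=> hf s [i _ /hf [l hl]]; exists l => t /hl ft; exists i. Qed.
HB.instance Definition _ :=
  isOpenTopological.Build (Gal F E) krull_openT krull_openI krull_open_bigU.

(* E/F is algebraic because E lies in algC. *)
Definition is_galois : Prop :=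
  {subset F <= E} /\
  forall x, (forall s : Gal F E, s x = x) -> fval x \in F.

Definition is_abelian : Prop := forall s t : Gal F E, (s * t = t * s)%g.

End GalTheory.

Definition is_subgroup (G : groupType) (N : set G) : Prop :=
  N 1%g /\ forall s t, N s -> N t -> N (s * t^-1)%g.

Definition is_normal (G : groupType) (N : set G) : Prop :=
  is_subgroup N /\ forall s t, N s -> N (t * s * t^-1)%g.

(* A subgroup N has index m when its left cosets are the fibres of a
   surjection onto a set with m elements. *)
Definition has_index (G : groupType) (N : set G) (m : nat) : Prop :=
  exists c : G -> 'I_m, (forall i, exists s, c s = i) /\
    (forall s t, c s = c t <-> N (s^-1 * t)%g).

(* The profinite group Gal F E is pro-p: its open normal subgroups have index
   a power of p. *)
Definition is_pro (p : nat) (F E : subfield) : Prop :=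
  forall N : set (Gal F E), open N -> is_normal N -> exists n, has_index N (p ^ n).

Definition integers (E : subfield) : {pred algC} := fun x => (x \in E) && (x \in Aint).

Lemma mem_integers E x : (x \in integers E) = (x \in E) && (x \in Aint).
Proof. by []. Qed.

Fact integers_subring E : subring_closed (integers E).
Proof.
split=> [|x y|x y]; rewrite !mem_integers; first by rewrite rpred1 Aint1.
- by move=> /andP[? ?] /andP[? ?]; rewrite !rpredB.
- by move=> /andP[? ?] /andP[? ?]; rewrite !rpredM.
Qed.
HB.instance Definition _ E :=
  GRing.isSubringClosed.Build algC (integers E) (integers_subring E).

Section Integers.
Variable E : subfield.
Record ring_int := MkRingInt { ival : algC; ivalP : ival \in integers E }.
HB.instance Definition _ := [isSub for ival].
HB.instance Definition _ := [Choice of ring_int by <:].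
HB.instance Definition _ := [SubChoice_isSubComNzRing of ring_int by <:].

Fact ival_sub (x : ring_int) : ival x \in E.
Proof. by case: x => x /= /andP[]. Qed.
Definition int_incl (x : ring_int) : fsub E := MkFsub (ival_sub x).

(* The finite primes of E are the prime ideals P of its ring of integers such
   that nonzero_ideal P. *)
Definition nonzero_ideal (P : {pred ring_int}) : Prop := exists2 x, x \in P & x != 0.
End Integers.

Definition lies_over (k K : subfield) (P : {pred ring_int K}) (Q : {pred ring_int k}) :=
  forall (x : ring_int k) (y : ring_int K), ival x = ival y -> (x \in Q) = (y \in P).

Definition above (p : nat) (k : subfield) (Q : {pred ring_int k}) : Prop :=
  p%:R \in Q.

Section Ramification.
Variables F E : subfield.

Definition inertia (P : {pred ring_int E}) : set (Gal F E) := fun s =>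
  forall x : ring_int E, exists2 z, z \in P & ival z = fval (s (int_incl x)) - ival x.

(* E/F is Galois in the uses of ramifies below, so that the primes of E over Q
   are conjugate and any one of them may be tested. *)
Definition ramifies (Q : {pred ring_int F}) : Prop :=
  exists P : prime_idealr (ring_int E),
    lies_over P Q /\ exists2 s, inertia P s & s <> 1%g.

Definition unramified_finite : Prop :=
  forall P : prime_idealr (ring_int E),
    nonzero_ideal P -> forall s, inertia P s -> s = 1%g.

(* The archimedean places of E are given by its embeddings i into the complex
   numbers, up to complex conjugation; s fixes such a place when i \o s is i
   or its conjugate, and i \o s = i forces s = 1. *)
Definition unramified_infinite : Prop :=
  forall (i : {rmorphism fsub E -> algC}) (s : Gal F E),
    (forall x, i (s x) = Num.conj (i x)) -> s = 1%g.

End Ramification.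

Definition unram_abelian_pro (p : nat) (F E : subfield) : Prop :=
  [/\ is_galois F E, is_abelian F E, is_pro p F E,
      unramified_finite F E & unramified_infinite F E].

Section Generated.
Variable S : set algC.
Definition gen_pred : {pred algC} := fun x =>
  `[< forall E : subfield, (forall y, S y -> y \in E) -> x \in E >].
Fact gen_closed : GRing.divring_closed gen_pred.
Proof.
split=> [|x y /asboolP hx /asboolP hy|x y /asboolP hx /asboolP hy];
  apply/asboolP => E hE; first exact: rpred1.
- by rewrite rpredB ?hx ?hy.
- by rewrite rpred_div ?hx ?hy.
Qed.
Definition gen_subfield := MkSubfield gen_closed.
End Generated.

(* The maximal such E, obtained as the compositum of all of them. *)
Definition max_unram (p : nat) (F : subfield) : subfield :=
  gen_subfield (fun x => exists2 E, unram_abelian_pro p F E & x \in sf_pred E).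

Lemma incl_inj (E L : subfield) (sEL : {subset E <= L}) : injective (sub_incl sEL).
Proof. by move=> x y /(congr1 (@fval L)) /= /val_inj. Qed.

Fact incl_zmod (E L : subfield) (sEL : {subset E <= L}) : zmod_morphism (sub_incl sEL).
Proof. by move=> x y; exact: val_inj. Qed.
Fact incl_monoid (E L : subfield) (sEL : {subset E <= L}) : monoid_morphism (sub_incl sEL).
Proof. by split=> [|x y]; exact: val_inj. Qed.
HB.instance Definition _ (E L : subfield) (sEL : {subset E <= L}) :=
  GRing.isZmodMorphism.Build _ _ (sub_incl sEL) (incl_zmod sEL).
HB.instance Definition _ (E L : subfield) (sEL : {subset E <= L}) :=
  GRing.isMonoidMorphism.Build _ _ (sub_incl sEL) (incl_monoid sEL).

Lemma gal_conjugates F E (x : fsub E) :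
  exists l : seq (fsub E), forall s : Gal F E, s x \in l.
Proof.
have [q [Dq mq] _] := minCpolyP (fval x).
have [pz [a a0 Dpz]] := rat_poly_scale q.
have pz0 : pz != 0.
  by apply: contraL mq => /eqP pz0; rewrite Dpz pz0 rmorph0 scaler0 monicE lead_coef0 eq_sym oner_eq0.
pose f (A : nzRingType) := map_poly (intr : int -> A) pz.
have f0 : f algC != 0.
  rewrite map_poly_eq0_id0 // intr_eq0 lead_coef_eq0 //.
have [rs Drs] := closed_field_poly_normal (f algC).
have rt (y : fsub E) : root (f (fsub E)) y -> fval y \in rs.
  move=> ry; have : root (f algC) (fval y).
    have -> : f algC = map_poly (@fval E) (f (fsub E)).
      by rewrite /f -map_poly_comp; apply: eq_map_poly => z /=; rewrite rmorph_int.
    exact: rmorph_root.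
  by rewrite Drs rootZ ?root_prod_XsubC // lead_coef_eq0.
have rx : root (f (fsub E)) x.
  rewrite -(fmorph_root (@fval E)).
  have -> : map_poly (@fval E) (f (fsub E)) = f algC.
    by rewrite /f -map_poly_comp; apply: eq_map_poly => z /=; rewrite rmorph_int.
  have : root (minCpoly (fval x)) (fval x) by exact: root_minCpoly.
  rewrite Dq Dpz linearZ /= rootZ ?fmorph_eq0 ?invr_eq0 ?intr_eq0 //.
  rewrite -map_poly_comp; congr (root _ _).
  by apply: eq_map_poly => z /=; rewrite rmorph_int.
exists (pmap insub rs) => s; rewrite mem_pmap_sub; apply: rt.
have -> : f (fsub E) = map_poly s (f (fsub E)).
  by rewrite /f -map_poly_comp; apply: eq_map_poly => z /=; rewrite rmorph_int.
exact: rmorph_root.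
Qed.

Lemma galois_stable F (E L : subfield) (sEL : {subset E <= L}) (s : Gal F L) (x : fsub E) :
  is_galois F E -> exists y, s (sub_incl sEL x) = sub_incl sEL y.
Proof.
move=> [sFE fixE]; have [l hl] := gal_conjugates F x.
pose o := undup [seq y <- l | `[< exists t : Gal F E, t x = y >]].
have mo y : reflect (exists t : Gal F E, t x = y) (y \in o).
  rewrite mem_undup mem_filter; apply: (iffP andP) => [[/asboolP]|[t <-]] //.
  by split; [apply/asboolP; exists t | exact: hl].
pose Q : {poly fsub E} := \prod_(y <- o) ('X - y%:P).
have fixQ (t : Gal F E) : map_poly t Q = Q.
  rewrite rmorph_prod /=.
  under eq_bigr do rewrite rmorphB /= map_polyX map_polyC /=.
  rewrite -(big_map t predT (fun y => 'X - y%:P)).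
  apply: perm_big; have injt : injective t := bij_inj (gal_bij t).
  have uto : uniq (map t o) by rewrite map_inj_uniq ?undup_uniq.
  have sub : {subset map t o <= o}.
    by move=> _ /mapP[y /mo [u <-] ->]; apply/mo; exists (t * u)%g.
  apply: uniq_perm; rewrite ?undup_uniq //.
  by have [] := uniq_min_size uto sub _; rewrite ?size_map.
have coefQ i : fval Q`_i \in F.
  by apply: fixE => t; rewrite -[in RHS](fixQ t) coef_map.
have fixQL : map_poly s (map_poly (sub_incl sEL) Q) = map_poly (sub_incl sEL) Q.
  by apply/polyP => i; rewrite !coef_map; apply: gal_fix; exact: coefQ.
have rQ : root (map_poly (sub_incl sEL) Q) (sub_incl sEL x).
  rewrite fmorph_root root_prod_XsubC; apply/mo.
  by exists 1%g.
have : root (map_poly (sub_incl sEL) Q) (s (sub_incl sEL x)).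
  by rewrite -fixQL fmorph_root.
rewrite rmorph_prod /=.
under eq_bigr do rewrite rmorphB /= map_polyX map_polyC /=.
rewrite -(big_map (sub_incl sEL) predT (fun y => 'X - y%:P)) root_prod_XsubC.
by case/mapP => y _ ->; exists y.
Qed.

Section Restriction.
Variables (F E L : subfield) (sEL : {subset E <= L}) (gE : is_galois F E).

Definition gal_res_fun (s : Gal F L) (x : fsub E) : fsub E :=
  projT1 (cid (galois_stable sEL s x gE)).
Lemma gal_res_funE s x : sub_incl sEL (gal_res_fun s x) = s (sub_incl sEL x).
Proof. by rewrite /gal_res_fun; case: cid. Qed.

Fact gal_res_subproof s :
  [/\ zmod_morphism (gal_res_fun s), monoid_morphism (gal_res_fun s),
      bijective (gal_res_fun s) &
      forall x, fval x \in F -> gal_res_fun s x = x].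
Proof.
have inj := @incl_inj _ _ sEL.
split=> [x y|||x xF].
- by apply: inj; rewrite gal_res_funE !rmorphB /= !gal_res_funE.
- split=> [|x y]; apply: inj; rewrite gal_res_funE ?rmorph1 //.
  by rewrite !rmorphM /= !gal_res_funE.
- exists (gal_res_fun s^-1%g) => x; apply: inj; rewrite !gal_res_funE.
    by rewrite galK.
  by rewrite galVK.
- by apply: inj; rewrite gal_res_funE gal_fix.
Qed.
Definition gal_res s : Gal F E := MkGal (gal_res_subproof s).
Lemma gal_resE s x : sub_incl sEL (gal_res s x) = s (sub_incl sEL x).
Proof. exact: gal_res_funE. Qed.
Lemma gal_resX s n x : sub_incl sEL ((gal_res s ^+ n)%g x) = (s ^+ n)%g (sub_incl sEL x).
Proof.
elim: n x => [|n IH] x //.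
by rewrite !expgS !gal_mulE gal_resE IH.
Qed.
End Restriction.

Lemma gal_pro_torsion p F E : is_abelian F E -> is_pro p F E ->
  forall (s : Gal F E) x, exists n, (s ^+ (p ^ n))%g x = x.
Proof.
move=> abE proE s x.
pose N : set (Gal F E) := fun t => t x = x.
have Nsub : is_subgroup N.
  split=> // t u Nt Nu; rewrite /N gal_mulE.
  suff -> : (u^-1)%g x = x by exact: Nt.
  by rewrite -[in LHS](Nu : u x = x) galK.
have [||n [c [csurj cE]]] := proE N.
- by move=> t Nt; exists [:: x] => u e; rewrite /N e ?inE.
- by split=> // t u Nt; rewrite abE mulgA mulVg mul1g.
exists n.
pose r i := projT1 (cid (csurj i)).
have cr i : c (r i) = i by rewrite /r; case: cid.
pose f i := c (s * r i)%g.
have fc t : f (c t) = c (s * t)%g.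
  apply/cE; rewrite invgM mulgA -(mulgA _ _ s) mulVg mulg1.
  by apply/cE; rewrite cr.
have iterf k t : iter k f (c t) = c (s ^+ k * t)%g.
  elim: k => [|k IH]; first by rewrite mul1g.
  by rewrite iterS IH fc mulgA -expgS.
have injf : injective f.
  move=> i j; rewrite -(cr i) -(cr j) !fc => /cE.
  rewrite invgM mulgA -(mulgA _ _ s) mulVg mulg1 => h.
  by apply/cE.
have fixed k t : iter k f (c t) = c t <-> (s ^+ k)%g x = x.
  rewrite iterf; split=> [/esym/cE|h]; last apply/esym/cE.
    by rewrite (abE _ t) mulgA mulVg mul1g.
  by rewrite (abE _ t) mulgA mulVg mul1g.
pose d := order f (c 1%g).
have ordE i : order f i = d.
  have le t u : (order f (c t) <= order f (c u))%N.
    rewrite leqNgt; apply/negP => lt.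
    have hu : iter (order f (c u)) f (c u) = c u by exact: iter_order.
    have /fixed ht : iter (order f (c u)) f (c t) = c t.
      by apply/fixed; apply/(fixed _ u).
    have := findex_iter lt; rewrite iterf.
    have := (fixed (order f (c u)) t).2 ht; rewrite iterf => ->.
    by rewrite findex0 => e; have := order_gt0 f (c u); rewrite -e.
  by apply/eqP; rewrite -(cr i) eqn_leq !le.
have dvd : (d %| p ^ n)%N.
  have /(_ (mem predT)) h := @fcard_order_set _ f injf d.
  rewrite -[X in (_ %| X)%N](card_ord (p ^ n)) -h ?dvdn_mull //.
  by apply/fintype.subsetP => i _; rewrite inE ordE.
case/dvdnP: dvd => k ->.
apply/(fixed _ 1%g); rewrite mulnC.
elim: k => [|k IH]; first by rewrite muln0.
by rewrite mulnS iterD IH iter_order.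
Qed.

Section XGroup.
Variables (p : nat) (F : subfield).
Local Notation L := (max_unram p F).

Lemma max_unram_sub E : unram_abelian_pro p F E -> {subset E <= L}.
Proof. by move=> hE x xE; apply/asboolP => K; apply; exists E. Qed.

Lemma max_unram_ind (P : fsub L -> Prop) :
  P 1 -> (forall x y, P x -> P y -> P (x - y)) ->
  (forall x y, P x -> P y -> P (x / y)) ->
  (forall E (hE : unram_abelian_pro p F E) (x : fsub E),
     P (sub_incl (max_unram_sub hE) x)) ->
  forall x, P x.
Proof.
move=> P1 PB PD PE x.
pose K : {pred algC} := fun a => `[< exists2 y, P y & fval y = a >].
have Kc : GRing.divring_closed K.
  split=> [|_ _ /asboolP[a Pa <-] /asboolP[b Pb <-]
           |_ _ /asboolP[a Pa <-] /asboolP[b Pb <-]]; apply/asboolP.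
  - by exists 1.
  - by exists (a - b); [exact: PB|].
  - by exists (a / b); [exact: PD|rewrite fmorph_div].
have /asboolP/(_ (MkSubfield Kc)) h := fvalP x.
suff /h/asboolP[y Py /val_inj <- //] :
  forall a, (exists2 E, unram_abelian_pro p F E & a \in sf_pred E) -> a \in MkSubfield Kc.
move=> a [E hE aE]; apply/asboolP.
by exists (sub_incl (max_unram_sub hE) (MkFsub aE)) => //; exact: PE.
Qed.

Lemma max_unram_abelian : is_abelian F L.
Proof.
move=> s t; apply: gal_eq => z; move: z; apply: max_unram_ind => [|x y|x y|E hE x].
- by rewrite !rmorph1.
- by move=> hx hy; rewrite !rmorphB; congr (_ - _).
- by move=> hx hy; rewrite !fmorph_div; congr (_ / _).
- have gE : is_galois F E by case: hE.
  have abE : is_abelian F E by case: hE.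
  have := congr1 (fun u : Gal F E => u x)
    (abE (gal_res (max_unram_sub hE) gE s) (gal_res (max_unram_sub hE) gE t)).
  by move/(congr1 (sub_incl (max_unram_sub hE))); rewrite !gal_mulE !gal_resE.
Qed.

Lemma gal_fixX E (s : Gal F E) (x : fsub E) n : s x = x -> (s ^+ n)%g x = x.
Proof. by move=> h; elim: n => // n IH; rewrite expgS gal_mulE IH. Qed.

Lemma max_unram_torsion (s : Gal F L) x : exists n, (s ^+ (p ^ n))%g x = x.
Proof.
have leP m n y : (m <= n)%N -> (s ^+ (p ^ m))%g y = y -> (s ^+ (p ^ n))%g y = y.
  by move=> /subnK <- h; rewrite expnD mulnC expgnA; exact: gal_fixX.
have pair (P : nat -> Prop) (y z : fsub L) : (exists n, (s ^+ (p ^ n))%g y = y) -> (exists n, (s ^+ (p ^ n))%g z = z) ->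
    (forall n, (s ^+ (p ^ n))%g y = y -> (s ^+ (p ^ n))%g z = z -> P n) -> exists n, P n.
  move=> [m hm] [n hn] h; exists (maxn m n).
  by apply: h; [apply: leP hm; exact: leq_maxl | apply: leP hn; exact: leq_maxr].
move: x; apply: max_unram_ind => [|x y hx hy|x y hx hy|E hE x].
- by exists 0; rewrite rmorph1.
- by apply: (pair _ x y) => // n ex ey; rewrite rmorphB; congr (_ - _).
- by apply: (pair _ x y) => // n ex ey; rewrite fmorph_div; congr (_ / _).
- have [gE abE proE _ _] := hE.
  have [n hn] := gal_pro_torsion abE proE (gal_res (max_unram_sub hE) gE s) x.
  by exists n; rewrite -gal_resX hn.
Qed.

(* X(F), written additively. *)
Definition X : Type := Gal F L.
HB.instance Definition _ := Choice.on X.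

Fact X_addN : left_inverse (gal_one F L) (@gal_inv F L) (@gal_mul F L).
Proof. exact: gal_mulVg. Qed.
HB.instance Definition _ := GRing.isZmodule.Build X
  (@gal_mulA F L) max_unram_abelian (@gal_mul1g F L) X_addN.

Definition Xgal (s : X) : Gal F L := s.

Lemma X_addE (s t : X) x : Xgal (s + t) x = Xgal s (Xgal t x).
Proof. by []. Qed.

Lemma X_mulrnE (s : X) n : Xgal (s *+ n) = (Xgal s ^+ n)%g.
Proof.
elim: n => // n IH; rewrite mulrS expgS -IH; exact: gal_eq.
Qed.

Lemma X_fix_mulz (s : X) x (a : int) : Xgal s x = x -> Xgal (s *~ a) x = x.
Proof.
move=> h; case: a => n; rewrite ?NegzE -?pmulrn ?X_mulrnE; first exact: gal_fixX.
rewrite mulrNz -pmulrn; set t := s *+ n.+1.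
have ht : Xgal t x = x by rewrite X_mulrnE; exact: gal_fixX.
by rewrite -[in LHS]ht -X_addE addNr.
Qed.

Definition X_level (s : X) (x : fsub L) : nat := projT1 (cid (max_unram_torsion s x)).
Lemma X_levelP s x : Xgal (s *+ (p ^ X_level s x)) x = x.
Proof. by rewrite X_mulrnE /X_level; case: cid. Qed.

Lemma X_mulz_eq (s : X) x n (a b : int) :
  Xgal (s *+ (p ^ n)) x = x -> (a = b %[mod (p ^ n)%N])%Z ->
  Xgal (s *~ a) x = Xgal (s *~ b) x.
Proof.
move=> h /eqP; rewrite eqz_mod_dvd => /dvdzP[c ec].
have -> : a = b + Posz (p ^ n)%N * c by rewrite mulrC -ec addrC subrK.
by rewrite mulrzDr X_addE mulrzA (@X_fix_mulz (s *~ (p ^ n)%N)).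
Qed.

Lemma zp_seq_mod (a : Zp p) m n : (m <= n)%N ->
  (zp_seq a n = zp_seq a m %[mod (p ^ m)%N])%Z.
Proof.
move=> /subnK <-; elim: (n - m)%N => // k <-.
rewrite [in RHS](zp_compat a) addSn.
by rewrite {1}(divz_eq (zp_seq a (k + m).+1) (p ^ (k + m))%N) expnD PoszM mulrA modzMDl.
Qed.

(* a *: s is the limit of the s ^ (a mod p^n): at each x this sequence is
   eventually constant. *)
Definition X_scale_fun (a : Zp p) (s : X) (x : fsub L) : fsub L :=
  Xgal (s *~ zp_seq a (X_level s x)) x.

Lemma X_scale_lim a s x n : Xgal (s *+ (p ^ n)) x = x ->
  Xgal (s *~ zp_seq a n) x = X_scale_fun a s x.
Proof.
move=> h; rewrite /X_scale_fun; set m := X_level s x.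
have hm : Xgal (s *+ (p ^ m)) x = x := X_levelP s x.
case/orP: (leq_total m n) => le.
  by apply: X_mulz_eq hm _; exact: zp_seq_mod.
by apply/esym; apply: X_mulz_eq h _; exact: zp_seq_mod.
Qed.

Lemma X_level_le (s : X) x m n : (m <= n)%N ->
  Xgal (s *+ (p ^ m)) x = x -> Xgal (s *+ (p ^ n)) x = x.
Proof.
by move=> /subnK <- h; rewrite expnD mulnC mulrnA X_mulrnE; exact: gal_fixX.
Qed.

Lemma X_scale_eventually s (l : seq (fsub L)) :
  exists N, forall n, (N <= n)%N -> forall x, x \in l ->
    Xgal (s *+ (p ^ n)) x = x /\
    forall a, X_scale_fun a s x = Xgal (s *~ zp_seq a n) x.
Proof.
exists (\max_(x <- l) X_level s x) => n le x xl.
have h : Xgal (s *+ (p ^ n)) x = x.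
  by apply: X_level_le (X_levelP s x); apply: leq_trans le; exact: leq_bigmax_seq.
by split=> // a; rewrite (X_scale_lim _ h).
Qed.

Lemma X_scale_at s (l : seq (fsub L)) :
  exists n, forall x, x \in l -> Xgal (s *+ (p ^ n)) x = x /\
    forall a, X_scale_fun a s x = Xgal (s *~ zp_seq a n) x.
Proof. by have [n hn] := X_scale_eventually s l; exists n; exact: hn. Qed.

Lemma X_scale_funD a b s x :
  X_scale_fun (a + b) s x = X_scale_fun a s (X_scale_fun b s x).
Proof.
set y := X_scale_fun b s x.
have [n hn] := X_scale_at s [:: x; y].
have [hx ex] := hn x (mem_head _ _).
have [_ ey] : _ /\ _ := hn y ltac:(by rewrite !inE eqxx orbT).
rewrite ex ey /y ex -X_addE -mulrzDr.
by apply: X_mulz_eq hx _; rewrite /= modz_mod.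
Qed.

Lemma X_scale_fun0 s x : X_scale_fun 0 s x = x.
Proof.
by rewrite /X_scale_fun (_ : zp_seq 0 _ = 0) ?mulr0z //= mod0z.
Qed.

Fact X_scale_subproof a s :
  [/\ zmod_morphism (X_scale_fun a s), monoid_morphism (X_scale_fun a s),
      bijective (X_scale_fun a s) &
      forall x, fval x \in F -> X_scale_fun a s x = x].
Proof.
split=> [x y|||x xF].
- have [n hn] := X_scale_at s [:: x; y; x - y].
  have [_ ->] := hn (x - y) ltac:(by rewrite !inE eqxx !orbT).
  have [_ ->] := hn x ltac:(by rewrite !inE eqxx).
  have [_ ->] := hn y ltac:(by rewrite !inE eqxx !orbT).
  by rewrite rmorphB.
- split=> [|x y].
    by have [n /(_ 1 (mem_head _ _))[_ ->]] := X_scale_at s [:: 1]; rewrite rmorph1.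
  have [n hn] := X_scale_at s [:: x; y; x * y].
  have [_ ->] := hn (x * y) ltac:(by rewrite !inE eqxx !orbT).
  have [_ ->] := hn x ltac:(by rewrite !inE eqxx).
  have [_ ->] := hn y ltac:(by rewrite !inE eqxx !orbT).
  by rewrite rmorphM.
- by exists (X_scale_fun (- a) s) => x; rewrite -X_scale_funD ?subrr ?addNr X_scale_fun0.
- by have [n /(_ x (mem_head _ _))[_ ->]] := X_scale_at s [:: x]; rewrite gal_fix.
Qed.
Definition X_scale (a : Zp p) (s : X) : X := MkGal (X_scale_subproof a s).

Lemma X_eq (s t : X) : (forall x, Xgal s x = Xgal t x) -> s = t.
Proof. by move=> h; apply: (@gal_eq F L). Qed.

Fact X_scale1 : left_id 1 X_scale.
Proof.
move=> s; apply: X_eq => x.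
have [n /(_ x (mem_head _ _))[hx ex]] := X_scale_at s [:: x].
rewrite [LHS]ex -[s in RHS]mulr1z; apply: X_mulz_eq hx _.
by rewrite /= modz_mod.
Qed.

Fact X_scaleDl s : {morph X_scale^~ s : a b / a + b}.
Proof. by move=> a b; apply: X_eq => x; exact: X_scale_funD. Qed.

Fact X_scaleDr : right_distributive X_scale +%R.
Proof.
move=> a s t; apply: X_eq => x; rewrite X_addE.
set y := Xgal (X_scale a t) x.
have [n1 h1] := X_scale_eventually s [:: y].
have [n2 h2] := X_scale_eventually t [:: x].
have [n3 h3] := X_scale_eventually (s + t) [:: x].
pose n := maxn n1 (maxn n2 n3).
have [_ e1] := h1 n (leq_maxl _ _) y (mem_head _ _).
have l2 : (n2 <= n)%N by rewrite /n !leq_max leqnn orbT.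
have l3 : (n3 <= n)%N by rewrite /n !leq_max leqnn !orbT.
have [_ e2] := h2 n l2 x (mem_head _ _).
have [_ e3] := h3 n l3 x (mem_head _ _).
by rewrite [LHS]e3 [RHS]e1 /y [X in _ = Xgal _ X]e2 mulrzDl X_addE.
Qed.

Lemma X_scale_mulz b s (k : int) : (X_scale b s) *~ k = X_scale (b *~ k) s.
Proof.
have sc0 : X_scale 0 s = 0 by apply: X_eq => x; exact: X_scale_fun0.
have hn c (m : nat) : (X_scale c s) *+ m = X_scale (c *+ m) s.
  by elim: m => [|m IH]; rewrite ?mulr0n // !mulrS X_scaleDl IH.
have scN c : - X_scale c s = X_scale (- c) s.
  by apply/eqP; rewrite eq_sym -addr_eq0 -X_scaleDl addNr sc0.
by case: k => m; rewrite ?NegzE ?mulrNz -!pmulrn hn ?scN.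
Qed.

Lemma zp_seq_mulz (b : Zp p) k n : (zp_seq (b *~ k) n = zp_seq b n * k %[mod (p ^ n)%N])%Z.
Proof.
have hn (m : nat) : (zp_seq (b *+ m) n = zp_seq b n * Posz m %[mod (p ^ n)%N])%Z.
  elim: m => [|m IH]; first by rewrite mulr0n mulr0 /= modz_mod.
  by rewrite mulrS /= modz_mod -modzDmr IH modzDmr -addn1 PoszD mulrDr mulr1 addrC.
case: k => m; rewrite ?NegzE ?mulrNz -?pmulrn; first exact: hn.
by rewrite /= modz_mod mulrN -modzNm hn modzNm.
Qed.

Fact X_scaleA a b s : X_scale a (X_scale b s) = X_scale (a * b) s.
Proof.
apply: X_eq => x.
have [n1 h1] := X_scale_eventually s [:: x].
have [n2 h2] := X_scale_eventually (X_scale b s) [:: x].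
pose n := maxn n1 n2.
have [hx e1] := h1 n (leq_maxl _ _) x (mem_head _ _).
have [_ e2] := h2 n (leq_maxr _ _) x (mem_head _ _).
rewrite [LHS]e2 X_scale_mulz [LHS]e1 [RHS]e1; apply: X_mulz_eq hx _.
by rewrite zp_seq_mulz mulrC /= modz_mod.
Qed.

HB.instance Definition _ := GRing.Zmodule_isLmodule.Build (Zp p) X
  X_scaleA X_scale1 X_scaleDr X_scaleDl.
End XGroup.

Definition number_field (k : subfield) : Prop :=
  exists n (b : 'I_n -> algC), forall x, x \in k ->
    exists c : 'I_n -> rat, x = \sum_i ratr (c i) * b i.

(* [E : k] >= n, where k is contained in E *)
Definition degree_ge (k E : subfield) (n : nat) : Prop :=
  exists v : 'I_n -> algC, (forall i, v i \in E) /\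
    forall c : 'I_n -> algC, (forall i, c i \in k) ->
      \sum_i c i * v i = 0 -> forall i, c i = 0.

Fact inter_closed (E K : subfield) : GRing.divring_closed [predI E & K].
Proof.
split=> [|x y|x y]; rewrite !inE; first by rewrite !rpred1.
- by move=> /andP[? ?] /andP[? ?]; rewrite !rpredB.
- by move=> /andP[? ?] /andP[? ?]; rewrite !rpred_div.
Qed.
Definition inter_subfield (E K : subfield) := MkSubfield (@inter_closed E K).

(* K/k is Galois and Gal(K/k) is isomorphic to Z_p as a topological group. *)
Definition is_Zp_ext (p : nat) (k K : subfield) : Prop :=
  is_galois k K /\
  exists (f : Gal k K -> Zp p) (g : Zp p -> Gal k K),
    [/\ {morph f : s t / (s * t)%g >-> s + t}, cancel f g, cancel g f,
        continuous f & continuous g].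

(* The set E(k). *)
Record Zp_ext (p : nat) (k : subfield) := MkZpExt {
  zext :> subfield;
  zextP : is_Zp_ext p k zext }.

HB.instance Definition _ p k := gen_eqMixin (Zp_ext p k).
HB.instance Definition _ p k := gen_choiceMixin (Zp_ext p k).

Section ZpExt.
Variables (p : nat) (k : subfield).

(* the neighbourhood {K | [K \cap K0 : k] >= p^n} of K0 *)
Definition zext_nbhd (K0 : Zp_ext p k) (n : nat) : set (Zp_ext p k) :=
  fun K => degree_ge k (inter_subfield K K0) (p ^ n).

Definition zext_open : set_system (Zp_ext p k) :=
  fun U => forall K0, U K0 -> exists n, (zext_nbhd K0 n `<=` U)%classic.

Lemma degree_ge_le E m n : (m <= n)%N -> degree_ge k E n -> degree_ge k E m.
Proof.
move=> le [v [vE vfree]]; exists (v \o widen_ord le); split=> [i|c ck e i].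
  exact: vE.
pose c' (j : 'I_n) : algC := if insub (val j) is Some i then c i else 0.
have ck' j : c' j \in k by rewrite /c'; case: insub => [a|]; rewrite ?ck ?rpred0.
have c'E j : c' (widen_ord le j) = c j by rewrite /c' /= valK.
rewrite -c'E; apply: vfree => //.
rewrite -[RHS]e (bigID (fun j : 'I_n => (j < m)%N)) /= [X in _ + X]big1 ?addr0.
  by rewrite (big_ord_narrow le); apply: eq_bigr => j _; rewrite c'E.
by move=> j jm; rewrite /c' insubF ?mul0r //; exact/negbTE.
Qed.

Fact zext_openT : zext_open setT.
Proof. by move=> K _; exists 0. Qed.
Fact zext_openI : setI_closed zext_open.
Proof.
move=> U V hU hV K [/hU [m hm] /hV [n hn]].
case/orP: (leq_total (p ^ m) (p ^ n)) => le.
  exists n => K1 h1; split; last exact: hn.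
  by apply: hm; exact: degree_ge_le h1.
exists m => K1 h1; split; first exact: hm.
by apply: hn; exact: degree_ge_le h1.
Qed.
Fact zext_open_bigU (I : Type) (f : I -> set (Zp_ext p k)) :
  (forall i, zext_open (f i)) -> zext_open (\bigcup_i f i)%classic.
Proof. by move=> hf K [i _ /hf [n hn]]; exists n => K1 /hn fK; exists i. Qed.
HB.instance Definition _ :=
  isOpenTopological.Build (Zp_ext p k) zext_openT zext_openI zext_open_bigU.

Definition E_ram : set (Zp_ext p k) := fun K =>
  forall Q : prime_idealr (ring_int k), above p Q -> ramifies K Q.

End ZpExt.

Section Coinvariants.
Variables (p : nat) (k K : subfield).
Local Notation L := (max_unram p K).

Definition extends (g : Gal k K) (h : Gal k L) : Prop :=
  forall (x : fsub K) (y : fsub L), fval x = fval y -> fval (g x) = fval (h y).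

(* gal_act g s t: t is the image of s under the action of g in Gal(K/k) on X(K),
   that is, t = h s h^-1 for some extension h of g to L. *)
Definition gal_act (g : Gal k K) (s t : X p K) : Prop :=
  exists2 h : Gal k L, extends g h & forall x, Xgal t (h x) = h (Xgal s x).

(* the submodule generated by the elements g . s - s *)
Definition augmentation : {pred X p K} :=
  submod_span (fun d => exists g s t, gal_act g s t /\ d = t - s).

HB.instance Definition _ := GRing.isZmodClosed.Build (X p K) augmentation
  (GRing.submod_closedB (submod_span_closed _)).

Lemma augmentation_scale (a : Zp p) (s : X p K) :
  s \in augmentation -> a *: s \in augmentation.
Proof.
have [h0 h] := submod_span_closed
  (fun d : X p K => exists g s t, gal_act g s t /\ d = t - s).
by move=> hs; rewrite -[_ *: _]addr0; exact: h.
Qed.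

Definition coinvariants : Type :=
  Quotient.quot (augmentation : zmodClosed (X p K)).
HB.instance Definition _ := GRing.Zmodule.on coinvariants.
Local Notation quo := (Quotient.quot (augmentation : zmodClosed (X p K))).

Definition coinv_pi (s : X p K) : coinvariants := (\pi_quo s)%qT.
Definition coinv_scale (a : Zp p) (c : coinvariants) : coinvariants :=
  coinv_pi (a *: repr (c : quo)).

Lemma coinv_piD s t : coinv_pi (s + t) = coinv_pi s + coinv_pi t.
Proof. exact: (raddfD (\pi_quo)%qT). Qed.

Lemma coinv_scale_pi a s : coinv_scale a (coinv_pi s) = coinv_pi (a *: s).
Proof.
apply/eqP; rewrite /coinv_scale /coinv_pi -Quotient.idealrBE -scalerBr.
by apply: augmentation_scale; rewrite Quotient.idealrBE reprK.
Qed.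

Lemma coinv_pi_surj (c : coinvariants) : exists s, c = coinv_pi s.
Proof. by exists (repr (c : quo)); rewrite /coinv_pi reprK. Qed.

Fact coinv_scaleA a b c : coinv_scale a (coinv_scale b c) = coinv_scale (a * b) c.
Proof. by have [s ->] := coinv_pi_surj c; rewrite !coinv_scale_pi scalerA. Qed.
Fact coinv_scale1 : left_id 1 coinv_scale.
Proof. by move=> c; have [s ->] := coinv_pi_surj c; rewrite coinv_scale_pi scale1r. Qed.
Fact coinv_scaleDr : right_distributive coinv_scale +%R.
Proof.
move=> a c d; have [s ->] := coinv_pi_surj c; have [t ->] := coinv_pi_surj d.
by rewrite -coinv_piD !coinv_scale_pi scalerDr coinv_piD.
Qed.
Fact coinv_scaleDl c : {morph coinv_scale^~ c : a b / a + b}.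
Proof.
move=> a b; have [s ->] := coinv_pi_surj c.
by rewrite !coinv_scale_pi scalerDl coinv_piD.
Qed.
HB.instance Definition _ := GRing.Zmodule_isLmodule.Build (Zp p) coinvariants
  coinv_scaleA coinv_scale1 coinv_scaleDr coinv_scaleDl.
End Coinvariants.

(* s(K/k) = r *)
Definition s_ext (p : nat) (k K : subfield) (r : nat) : Prop :=
  has_rank (coinvariants p k K) r.

(* s(k) is the least of the s(K/k); the default value 0 is only used if no
   K in E_ram(k) has finite s(K/k), which does not happen for number fields. *)
Definition s_min (p : nat) (k : subfield) : nat :=
  xget 0%N (fun r => (exists2 K : Zp_ext p k, E_ram K & s_ext p k K r) /\
    forall (K : Zp_ext p k) r', E_ram K -> s_ext p k K r' -> (r <= r')%N).

(* Main.v *)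
(* All Galois groups are seen as quotients of subgroups of Aut(algC), and all primes
   as restrictions of primes of the ring of algebraic integers. Let K_n be the n-th
   layer of K in E_ram(k). For n large, K is totally ramified over K_n at all primes
   above p, and X(K_(n+1)) / p^m -> X(K_n) / p^m is injective, since the kernels of
   X(K) / p^m -> X(K_j) / p^m stabilise. If K' is close to K, it has the same layers
   up to n + 1, hence it is in E_ram(k) and totally ramified over K'_n = K_n.

   The key point, after Fukuda, is that X(K') / p^m -> X(K'_n) / p^m is injective
   as soon as X(K'_(n+1)) / p^m -> X(K'_n) / p^m is: by total ramification the
   kernel of X(K') -> X(K'_j) is generated by quotients of inertial elements, so
   the kernel at level n is contained in the one at level n + 1, which is smaller
   by Nakayama's argument unless it is zero. Hence X(K') / p^m is a subquotient of
   X(K) / p^m, whose order is at most p^(m r + c) when r is the rank of X(K). With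
   m > c this makes X(K') finitely generated of rank at most r.

   Finally r = s(k) is at most the rank of the coinvariants of X(K'), which is at
   most the rank of X(K'), so that the latter is s(k). *)
Require Import Defs.
From HB Require Import structures.
From mathcomp Require Import all_boot all_order all_algebra all_fingroup all_solvable all_field.
From mathcomp Require Import boolp classical_sets functions filter.
From mathcomp Require Import topology_structure ring.
Set Implicit Arguments.
Unset Strict Implicit.
Unset Printing Implicit Defensive.
Import GRing.Theory.
Import Defs.
Local Open Scope ring_scope.

(** * Automorphisms of the algebraic numbers *)

(** Infinite Galois groups enter throughout, so automorphisms are produced on finite sets of
    algebraic numbers by an orbit argument and glued by [aut_compact]. Fukuda's argument is treated
    alike. Nothing is known about the size of X(K') when it is needed, so Nakayama's lemma is not
    applied to X(K') as a module: Gal(L/K'_n), with L the maximal unramified extension of K', acts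
    through a finite p-group on each finite stable subset of L, and nilpotency of that p-group takes
    the place of the lemma. The descent also needs that all ramification of L/K'_n comes from primes
    above p. Hence the study of tame inertia and complex conjugation, which shows that
    Z_p-extensions are unramified elsewhere. The constant c depends on K alone: it measures how far
    X(K) is from a free module of rank r. So one exponent m, and then one layer n, serve a whole
    neighbourhood. Counting X(K')/p^m does double duty: finiteness of X(K')/p gives finite
    generation, and the condition c < m leaves no room for a further free generator. *)

Lemma poly_prod_eq0 (R : comNzRingType) (I : eqType) (r : seq I) (F : I -> {poly R}) :
  (forall x y : R, x * y = 0 -> (x == 0) || (y == 0)) ->
  \prod_(i <- r) F i = 0 -> exists2 i, i \in r & F i = 0.
Proof.
move=> dom; elim: r => [|i r IH].
  by rewrite big_nil => /eqP; rewrite oner_eq0.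
rewrite big_cons; set q := \prod_(_ <- _) _ => e.
have [Fi0|Fi0] := eqVneq (F i) 0; first by exists i; rewrite ?mem_head.
have [q0|q0] := eqVneq q 0.
  by have [k kr Fk] := IH q0; exists k; rewrite // inE kr orbT.
have lc : lead_coef (F i) * lead_coef q != 0.
  by apply/negP => /eqP/dom; rewrite !lead_coef_eq0 (negPf Fi0) (negPf q0).
by have := lc; rewrite -(lead_coef_proper_mul lc) e lead_coef0 eqxx.
Qed.

Lemma map_polyPoly (A B : nzRingType) (f : {rmorphism A -> B}) s :
  map_poly f (Poly s) = Poly (map f s).
Proof.
apply/polyP => i; rewrite coef_map !coef_Poly.
have [lt|ge] := ltnP i (size s); first by rewrite (nth_map 0).
by rewrite (nth_default _ ge) nth_default ?size_map //; exact: rmorph0.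
Qed.

(** * Homomorphisms that agree on the invariants of a group *)

Section OrbitHom.
Variables (R0 R : comNzRingType) (Om : comNzRingType) (j : {rmorphism R0 -> R}).
Variables (phi : {rmorphism R -> Om}) (psi : {rmorphism R0 -> Om}).
Variables (I : Type) (act : I -> {rmorphism R -> R}).
Hypothesis Om_dom : forall x y : Om, x * y = 0 -> (x == 0) || (y == 0).
Hypothesis jinj : injective j.
Hypothesis act_orbit : forall x, exists l : seq R, forall g, act g x \in l.
Hypothesis act_one : exists e, act e =1 id.
Hypothesis act_comp : forall g h, exists f, act f =1 act g \o act h.
Hypothesis act_inj : forall g, injective (act g).
Hypothesis agree : forall x, (forall g, act g x = x) -> exists a, j a = x /\ phi x = psi a.

Lemma act_orbit_seq (s : seq R) : exists L : seq (seq R), forall g, map (act g) s \in L.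
Proof.
elim: s => [|x s [L hL]]; first by exists [:: [::]] => g; rewrite inE.
have [l hl] := act_orbit x.
by exists [seq a :: t | a <- l, t <- L] => g /=; apply/allpairsP; exists (act g x, map (act g) s); split=> /=; [exact: hl | exact: hL | ].
Qed.

(** An injective map that sends a finite set into itself permutes it, so products over the orbit
    have invariant coefficients without any finite Galois group being formed. *)
Lemma poly_orbit (B : {poly R}) : exists o : seq {poly R},
  [/\ uniq o, forall P, P \in o <-> exists g, map_poly (act g) B = P
    & forall g, perm_eq (map (map_poly (act g)) o) o].
Proof.
have [L hL] := act_orbit_seq B.
pose o := undup [seq P <- map (@Poly R) L | `[< exists g, map_poly (act g) B = P >]].
have mo P : P \in o <-> exists g, map_poly (act g) B = P.
  rewrite mem_undup mem_filter; split=> [/andP[/asboolP]|[g <-]] //.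
  apply/andP; split; first by apply/asboolP; exists g.
  by rewrite -{1}[B]polyseqK map_polyPoly; apply: map_f; exact: hL.
exists o; split=> [|//|g]; first exact: undup_uniq.
have injg : injective (map_poly (act g)).
  move=> P1 P2 /polyP e; apply/polyP => i.
  by have := e i; rewrite !coef_map => /act_inj.
have uo : uniq (map (map_poly (act g)) o) by rewrite map_inj_uniq ?undup_uniq.
have sub : {subset map (map_poly (act g)) o <= o}.
  move=> _ /mapP[P /mo [h <-] ->]; apply/mo; have [f hf] := act_comp g h.
  by exists f; rewrite -[RHS]map_poly_comp; exact: eq_map_poly.
apply: uniq_perm; rewrite ?undup_uniq //.
by have [] := uniq_min_size uo sub _; rewrite ?size_map.
Qed.

(* Let B0 be the polynomial with coefficients b. The product of the Y - gB, for gB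
   in the orbit of B = j(B0), has invariant coefficients, so its images by phi and
   psi agree, and psi(B0), being a root, is one of the phi(gB). *)
Lemma orbit_hom (b : seq R0) : exists g, forall x, x \in b -> psi x = phi (act g (j x)).
Proof.
pose B0 := Poly b; pose B := map_poly j B0.
have [o [uo mo permo]] := poly_orbit B.
pose Q : {poly {poly R}} := \prod_(P <- o) ('X - P%:P).
have fixQ g : map_poly (map_poly (act g)) Q = Q.
  rewrite rmorph_prod /=.
  under eq_bigr do rewrite rmorphB /= map_polyX map_polyC /=.
  by rewrite -(big_map (map_poly (act g)) predT (fun P => 'X - P%:P)); exact: perm_big.
have coefQ i k g : act g Q`_i`_k = Q`_i`_k.
  by rewrite -[in RHS](fixQ g) !coef_map.
(* Preimages under [j] are chosen on invariants only, with value 0 elsewhere; [lift0] is what allows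
   [lift] to be applied to coefficients. *)
pose lift x := if pselect (forall g, act g x = x) is left h then projT1 (cid (agree h)) else 0.
have liftP x : (forall g, act g x = x) -> j (lift x) = x /\ phi x = psi (lift x).
  by move=> h; rewrite /lift; case: pselect => // h'; case: cid.
have lift0 : lift 0 = 0.
  by apply: jinj; rewrite rmorph0; apply: (liftP 0 _).1 => g; rewrite rmorph0.
pose F1 : {poly {poly R0}} := map_poly (map_poly lift) Q.
have cF1 i k : F1`_i`_k = lift Q`_i`_k.
  rewrite coef_map_id0 ?coef_map_id0 //.
  by apply/polyP => m; rewrite coef_map_id0 // !coef0.
have jF1 : map_poly (map_poly j) F1 = Q.
  apply/polyP => i; apply/polyP => k; rewrite coef_map coef_map cF1.
  by case: (liftP Q`_i`_k) => // g; exact: coefQ.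
have pF1 : map_poly (map_poly psi) F1 = map_poly (map_poly phi) Q.
  apply/polyP => i; apply/polyP => k; rewrite !coef_map cF1 /=.
  by case: (liftP Q`_i`_k) => // g; exact: coefQ.
have F10 : F1.[B0] = 0.
  suff e : map_poly j F1.[B0] = map_poly j 0.
    by apply/polyP => i; apply: jinj; move/polyP: e => /(_ i); rewrite !coef_map.
  have Bo : B \in o.
    by apply/mo; have [e he] := act_one; exists e; rewrite (eq_map_poly he) map_poly_id.
  by rewrite -horner_map jF1 rmorph0 horner_prod (big_rem B) //= hornerXsubC subrr mul0r.
have : map_poly psi F1.[B0] = 0 by rewrite F10 rmorph0.
rewrite -horner_map pF1 rmorph_prod horner_prod => /(poly_prod_eq0 Om_dom).
case=> P /mo [g <-] /eqP; rewrite rmorphB /= map_polyX map_polyC /= hornerXsubC.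
rewrite subr_eq0 => /eqP/polyP e; exists g => x xb.
have := e (index x b); rewrite !coef_map !coef_Poly /=.
by rewrite nth_index.
Qed.
End OrbitHom.

(** * Automorphisms of [algC] and compactness *)

Record aut := MkAut {
  aut_fun :> algC -> algC;
  aut_prop : zmod_morphism aut_fun /\ monoid_morphism aut_fun }.
HB.instance Definition _ := gen_eqMixin aut.
HB.instance Definition _ := gen_choiceMixin aut.

Fact aut_zmod (s : aut) : zmod_morphism s. Proof. by case: (aut_prop s). Qed.
Fact aut_monoid (s : aut) : monoid_morphism s. Proof. by case: (aut_prop s). Qed.
HB.instance Definition _ s := GRing.isZmodMorphism.Build _ _ (aut_fun s) (aut_zmod s).
HB.instance Definition _ s := GRing.isMonoidMorphism.Build _ _ (aut_fun s) (aut_monoid s).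

Lemma aut_eq (s t : aut) : s =1 t -> s = t.
Proof.
case: s t => [s hs] [t ht] /= /funext est.
by subst t; congr MkAut; exact: Prop_irrelevance.
Qed.

Definition aut_of (f : {rmorphism algC -> algC}) : aut :=
  MkAut (conj (rmorphB f) (rmorph1 f, rmorphM f)).

Definition aut_one : aut := aut_of idfun.
Definition aut_mul (s t : aut) : aut := aut_of (s \o t).
(** Ring endomorphisms of [algC] are bijective, since they permute the finite sets of conjugates;
    hence [aut] carries no inverse. *)
Definition aut_inv (s : aut) : aut := aut_of (algC_invaut s).

Fact aut_mulA : associative aut_mul. Proof. by move=> s t u; exact: aut_eq. Qed.
Fact aut_mul1g : left_id aut_one aut_mul. Proof. by move=> s; exact: aut_eq. Qed.
Fact aut_mulg1 : right_id aut_one aut_mul. Proof. by move=> s; exact: aut_eq. Qed.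
Fact aut_mulVg : left_inverse aut_one aut_inv aut_mul.
Proof. by move=> s; apply: aut_eq => x /=; exact: algC_autK. Qed.
Fact aut_mulgV : right_inverse aut_one aut_inv aut_mul.
Proof. by move=> s; apply: aut_eq => x /=; exact: algC_invautK. Qed.
HB.instance Definition _ := isGroup.Build aut aut_mulA aut_mul1g aut_mulg1 aut_mulVg aut_mulgV.

Lemma autM (s t : aut) x : (s * t)%g x = s (t x). Proof. by []. Qed.
Lemma aut1 x : (1%g : aut) x = x. Proof. by []. Qed.
Lemma autK (s : aut) : cancel s s^-1%g. Proof. exact: algC_autK. Qed.
Lemma autVK (s : aut) : cancel s^-1%g s. Proof. exact: algC_invautK. Qed.
Lemma aut_inj (s : aut) : injective s. Proof. exact: can_inj (autK s). Qed.

Lemma autX (s : aut) n x : (s ^+ n)%g x = iter n s x.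
Proof. by elim: n => // n IH; rewrite expgS autM IH. Qed.

Lemma aut_fixX (s : aut) x n : s x = x -> (s ^+ n)%g x = x.
Proof. by move=> h; elim: n => // n IH; rewrite expgS autM IH. Qed.

Lemma aut_fixV (s : aut) x : s x = x -> s^-1%g x = x.
Proof. by move=> h; rewrite -{1}h autK. Qed.

Lemma aut_conjugates (x : algC) : exists l : seq algC, forall s : aut, s x \in l.
Proof.
have [rs Drs] := closed_field_poly_normal (minCpoly x).
exists rs => s; have : root (minCpoly (s x)) (s x) by exact: root_minCpoly.
rewrite minCpoly_aut Drs rootZ ?root_prod_XsubC //.
by rewrite lead_coef_eq0 minCpoly_eq0.
Qed.

(** An ultrafilter on the indices selects one of the finitely many conjugates of each x as the limit
    of [u n x]. On a finite set the limits are attained at a common index, so they respect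
    differences and products. *)
Lemma aut_cluster (u : nat -> aut) :
  exists s : aut, forall (S : seq algC) N, exists2 n, (N <= n)%N & {in S, u n =1 s}.
Proof.
have [G [GU ooG]] := @ultraFilterLemma _ _ eventually_filter.
have GP : ProperFilter G by exact: ultra_proper.
have exv x : exists v, G (fun n => u n x = v).
  have [l hl] := aut_conjugates x.
  have : G (fun n => u n x \in l) by apply: filterS (filterT : G _) => n _; exact: hl.
  elim: l {hl} => [|v l IH] h.
    by have [n] := filter_ex h; rewrite in_nil.
  have [hv|hv] := in_ultra_setVsetC (fun n => u n x = v) GU; first by exists v.
  apply: IH; apply: filterS2 h hv => n; rewrite inE => /orP[/eqP e []|//].
  exact: e.
pose s x := projT1 (cid (exv x)).
have sP x : G (fun n => u n x = s x) by rewrite /s; case: cid.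
have ev (S : seq algC) : G (fun n => {in S, u n =1 s}).
  elim: S => [|x S IH]; first by apply: filterS (filterT : G _) => n _ y; rewrite in_nil.
  apply: filterS2 (sP x) IH => n e h y; rewrite inE => /orP[/eqP ->|/h] //.
have sB : zmod_morphism s.
  move=> x y; have [n h] := filter_ex (ev [:: x; y; x - y]).
  by rewrite -!h ?inE ?eqxx ?orbT // rmorphB.
have sM : monoid_morphism s.
  split=> [|x y].
    by have [n h] := filter_ex (ev [:: 1]); rewrite -h ?inE // rmorph1.
  have [n h] := filter_ex (ev [:: x; y; x * y]).
  by rewrite -!h ?inE ?eqxx ?orbT // rmorphM.
exists (MkAut (conj sB sM)) => S N.
have hN : G (fun n => (N <= n)%N) by apply: ooG; exists N.
have [n [le h]] := filter_ex (filterI hN (ev S)).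
by exists n.
Qed.

Definition algC_enum (n : nat) : seq algC := pmap unpickle (iota 0 n).

Lemma algC_enumP (S : seq algC) : exists N, forall n, (N <= n)%N -> {subset S <= algC_enum n}.
Proof.
exists (\max_(x <- S) (pickle x).+1) => n le x xS.
rewrite /algC_enum mem_pmap; apply/mapP; exists (pickle x); last by rewrite pickleK.
rewrite mem_iota /= add0n; apply: leq_trans le.
by apply: (leq_bigmax_seq (F := fun y : algC => (pickle y).+1)).
Qed.

(** As [algC] is countable, witnesses for the finite sets [algC_enum n] form a sequence, to which
    [aut_cluster] applies; monotonicity passes from [algC_enum n] to any S inside it. *)
Lemma aut_compact (P : seq algC -> aut -> Prop) :
  (forall S T s, {subset S <= T} -> P T s -> P S s) ->
  (forall S, exists s, P S s) ->
  exists s : aut, forall S, exists2 t, P S t & {in S, t =1 s}.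
Proof.
move=> mono ex.
have [u hu] : exists u : nat -> aut, forall n, P (algC_enum n) (u n).
  by exists (fun n => projT1 (cid (ex (algC_enum n)))) => n; case: cid.
have [s hs] := aut_cluster u; exists s => S.
have [N hN] := algC_enumP S.
have [n le h] := hs S N.
by exists (u n) => //; apply: mono (hN n le) (hu n).
Qed.

Definition fixes (F : subfield) (s : aut) : Prop := forall x, x \in F -> s x = x.

Lemma fixesM F s t : fixes F s -> fixes F t -> fixes F (s * t)%g.
Proof. by move=> hs ht x xF; rewrite autM ht ?hs. Qed.
Lemma fixesV F s : fixes F s -> fixes F (s^-1)%g.
Proof. by move=> hs x xF; exact/aut_fixV/hs. Qed.
Lemma fixes1 F : fixes F 1%g. Proof. by []. Qed.
Lemma fixesX F s n : fixes F s -> fixes F (s ^+ n)%g.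
Proof. by move=> hs x xF; exact/aut_fixX/hs. Qed.

(** The conjugates of x generate a normal number field, where finite Galois theory supplies an
    automorphism moving x; it then extends to [algC]. *)
Lemma aut_moves x : x \notin Crat -> exists s : aut, s x <> x.
Proof.
move=> xQ; have [rs Drs] := closed_field_poly_normal (minCpoly x).
have [q [Dq mq] _] := minCpolyP x.
rewrite (monicP (minCpoly_monic x)) scale1r in Drs.
have xrs : x \in rs by rewrite -root_prod_XsubC -Drs root_minCpoly.
have [Qn [QnC [s1 Ds1 gen]]] := num_field_exists rs.
pose p : {poly Qn} := map_poly (in_alg Qn) q.
have Dp : p = \prod_(z <- s1) ('X - z%:P).
  apply: (map_poly_inj QnC); rewrite rmorph_prod /=.
  under eq_bigr do rewrite rmorphB /= map_polyX map_polyC /=.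
  rewrite -(big_map QnC predT (fun y => 'X - y%:P)) Ds1 -Drs Dq -map_poly_comp.
  by apply: eq_map_poly => a /=; rewrite alg_num_field fmorph_rat.
have p1 : p \is a polyOver 1%VS by apply/polyOverP => i; rewrite coef_map /= rpredZ ?mem1v.
have splitP : splitting_field_axiom Qn by exists p => //; exists s1; rewrite ?Dp ?eqpxx.
pose Sm := FieldExt_isSplittingField.Build rat Qn splitP.
pose L : splittingFieldType rat := HB.pack (FieldExt.sort Qn) Sm.
have galL : galois 1 {:L}.
  apply/and3P; split; first exact: sub1v.
    by apply/separableP => y _; apply: pcharf0_separable; by move=> r; rewrite pchar_lalg Num.Theory.pchar_num.
  apply/splitting_normalField; first exact: sub1v.
  by exists p => //; exists s1; rewrite ?Dp ?eqpxx.
have /galois_fixedField fixL := galL.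
have [x1 Dx1 x1s] : exists2 x1, QnC x1 = x & x1 \in s1.
  by move: xrs; rewrite -Ds1 => /mapP[x1 ? ->]; exists x1.
have : (x1 : L) \notin fixedField (galoisG {:L}%AS 1%AS).
  rewrite fixL; apply: contra xQ => /vlineP[a Da].
  by rewrite -Dx1 Da rmorphZ_num rmorph1 mulr1; apply/CratP; exists a.
move=> /fixedFieldP nfix.
have [g hg] : exists g : gal_of {:L}, g x1 <> x1.
  apply: contrapT => h; apply: nfix; first exact: memvf.
  by move=> g _; apply: contrapT => hg; apply: h; exists g.
have [nu Dnu] := @extend_algC_subfield_aut Qn QnC (g : {rmorphism L -> L}).
exists (aut_of nu) => /= e; apply: hg; apply: (fmorph_inj QnC).
by rewrite Dnu Dx1.
Qed.

Lemma aut_orbit_seq (s : seq algC) : exists L : seq (seq algC), forall g : aut, map g s \in L.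
Proof.
elim: s => [|x s [L hL]]; first by exists [:: [::]] => g; rewrite inE.
have [l hl] := aut_conjugates x.
exists [seq a :: t | a <- l, t <- L] => g /=; apply/allpairsP; exists (g x, map g s).
by split=> /=; [exact: hl | exact: hL | ].
Qed.

(* With B the polynomial with coefficients S, Lagrange interpolation over the
   orbit of (B, x) gives f, g over Q[Y] with x * g'(B) = f(B) and g'(B) <> 0. *)
Lemma fixed_by_stabilizer (F : subfield) (S : seq algC) x :
  {subset S <= F} -> (forall s : aut, {in S, s =1 id} -> s x = x) -> x \in F.
Proof.
move=> SF fixx; have ratF (z : algC) : (forall s : aut, s z = z) -> z \in F.
  move=> h; have [/CratP[a ->]|/aut_moves[s]] := boolP (z \in Crat); first exact: rpred_rat.
  by rewrite h.
have [L hL] := aut_orbit_seq (x :: S).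
pose o := undup [seq t <- L | `[< exists s : aut, map s (x :: S) = t >]].
have mo t : reflect (exists s : aut, map s (x :: S) = t) (t \in o).
  rewrite mem_undup mem_filter; apply: (iffP andP) => [[/asboolP]|[g <-]] //.
  by split; [apply/asboolP; exists g | exact: hL].
pose b (t : seq algC) : {poly algC} := Poly (behead t).
pose v (t : seq algC) : algC := head 0 t.
have bmap (s : aut) t : map_poly s (b t) = b (map s t).
  by rewrite /b map_polyPoly behead_map.
have vmap (s : aut) t : s (v t) = v (map s t).
  by case: t => [|a t]; rewrite //= rmorph0.
(* Two automorphisms that agree on S differ by one that fixes S, hence x; so the polynomial
   determines the whole tuple. *)
have binj : {in o &, injective b}.
  move=> _ _ /mo[s <-] /mo[s' <-] /polyP e /=.
  have eS : {in S, s =1 s'}.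
    move=> y yS; have := e (index y S); rewrite !coef_Poly /=.
    by rewrite !(nth_map 0) ?index_mem // nth_index.
  have ex : s x = s' x.
    have : (s'^-1 * s)%g x = x by apply: fixx => y yS; rewrite autM eS // autK.
    by move/(congr1 s'); rewrite autM autVK.
  by rewrite ex; congr (_ :: _); apply/eq_in_map.
pose f : {poly {poly algC}} :=
  \sum_(t <- o) (v t)%:P%:P * \prod_(t' <- o | t' != t) ('X - (b t')%:P).
pose g : {poly {poly algC}} := \prod_(t <- o) ('X - (b t)%:P).
have permo (s : aut) : perm_eq (map (map s) o) o.
  have inj : injective (map s) by apply: inj_map; exact: aut_inj.
  have uo : uniq (map (map s) o) by rewrite map_inj_uniq ?undup_uniq.
  have sub : {subset map (map s) o <= o}.
    move=> _ /mapP[t /mo [h <-] ->]; apply/mo; exists (s * h)%g.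
    by rewrite -map_comp.
  apply: uniq_perm; rewrite ?undup_uniq //.
  by have [] := uniq_min_size uo sub _; rewrite ?size_map.
have XmB (s : aut) t : map_poly (map_poly s) ('X - (b t)%:P) = 'X - (b (map s t))%:P.
  by rewrite rmorphB /= map_polyX map_polyC /= bmap.
have fixf (s : aut) : map_poly (map_poly s) f = f.
  rewrite /f rmorph_sum /= -[RHS](perm_big _ (permo s)) big_map; apply: eq_bigr => t _.
  rewrite rmorphM /= map_polyC /= map_polyC /= vmap; congr (_ * _).
  rewrite rmorph_prod /= -[RHS](perm_big _ (permo s)) big_map.
  apply: eq_big => [t'|t' _]; last exact: XmB.
  by rewrite (inj_eq (inj_map (@aut_inj s))).
have fixg (s : aut) : map_poly (map_poly s) g = g.
  rewrite /g rmorph_prod /= -[RHS](perm_big _ (permo s)) big_map.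
  by apply: eq_bigr => t _; exact: XmB.
have over (h : {poly {poly algC}}) : (forall s : aut, map_poly (map_poly s) h = h) ->
    h \is a polyOver (polyOver F).
  move=> fixh; apply/polyOverP => i; apply/polyOverP => k; apply: ratF => s.
  by rewrite -[in RHS](fixh s) !coef_map.
pose t0 := x :: S.
have t0o : t0 \in o.
  by apply/mo; exists 1%g; rewrite map_id_in.
pose h : {poly {poly algC}} := \prod_(t <- o | t != t0) ('X - (b t)%:P).
have gE : g = ('X - (b t0)%:P) * h.
  by rewrite /g /h (bigD1_seq t0) ?undup_uniq.
have Bov : b t0 \is a polyOver F.
  apply/polyOverP => i; rewrite coef_Poly /=.
  have [lt|ge] := ltnP i (size S); first by rewrite SF ?mem_nth.
  by rewrite nth_default ?rpred0.
have c0 : h.[b t0] != 0.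
  rewrite horner_prod prodf_seq_neq0; apply/allP => t to; apply/implyP => nt.
  by rewrite hornerXsubC subr_eq0; apply: contra nt => /eqP/binj -> //.
have fB : f.[b t0] = x%:P * h.[b t0].
  rewrite horner_sum (bigD1_seq t0) ?undup_uniq //= hornerM hornerC [X in _ + X]big1 ?addr0 //.
  move=> t nt; rewrite hornerM [X in _ * X]horner_prod (big_rem t0) //= eq_sym nt.
  by rewrite hornerXsubC subrr mul0r mulr0.
have hB : g^`().[b t0] = h.[b t0].
  rewrite gE derivM derivXsubC mul1r hornerD hornerM hornerXsubC subrr.
  by rewrite mul0r addr0.
have fF : f.[b t0] \is a polyOver F by rewrite rpred_horner ?over.
have hF : h.[b t0] \is a polyOver F.
  by rewrite -hB rpred_horner // polyOver_deriv // over.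
(* The identity between f(B) and x * g'(B) is one of polynomials in Y; a leading coefficient brings
   it down to F. *)
pose c := lead_coef h.[b t0].
have xc : x * c \in F.
  have := polyOverP fF (size h.[b t0]).-1.
  by rewrite fB coefCM.
have cF : c \in F by exact: (polyOverP hF).
have cn0 : c != 0 by rewrite lead_coef_eq0.
by rewrite -(mulfK cn0 x) rpred_div.
Qed.

(** Otherwise [fixed_by_stabilizer] gives, for each finite S, an automorphism that fixes the part of
    S in F and moves x; by compactness one of them fixes all of F and still moves x. *)
Lemma fixed_mem (F : subfield) x : (forall s, fixes F s -> s x = x) -> x \in F.
Proof.
move=> hx; apply: contrapT => /negP xF.
have [|S|s hs] := @aut_compact (fun T s => (forall y, y \in T -> y \in F -> s y = y) /\ s x <> x).
- by move=> S T s ST [h1 h2]; split=> // y yS; apply: h1; exact: ST.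
- apply: contrapT => nex; move/negP: xF; apply.
  apply: (@fixed_by_stabilizer F [seq y <- S | y \in F]) => [y|s hs].
    by rewrite mem_filter => /andP[].
  apply: contrapT => hsx; apply: nex; exists s; split=> // y yS yF.
  by apply: hs; rewrite mem_filter yF.
have [t [_ nx] ts] := hs [:: x].
apply: nx; rewrite ts ?mem_head //; apply: hx => y yF.
by have [u [hu _] us] := hs [:: y]; rewrite -us ?mem_head // hu ?mem_head.
Qed.

Lemma idomain_dom (R : idomainType) (x y : R) : x * y = 0 -> (x == 0) || (y == 0).
Proof. by move/eqP; rewrite mulf_eq0. Qed.

Section Extension.
Variables (F D : subfield) (i : {rmorphism fsub D -> algC}).
Hypothesis sFD : {subset F <= D}.
Hypothesis iF : forall x, fval x \in F -> i x = fval x.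

(** On finite sets [orbit_hom] compares the inclusion of D with [i]: the invariants of the
    automorphisms over F are F itself by [fixed_mem]. Compactness does the rest. *)
Lemma aut_extend : exists s : aut, fixes F s /\ forall x, s (fval x) = i x.
Proof.
have [|S|s hs] := @aut_compact (fun T s => fixes F s /\ forall x, fval x \in T -> s (fval x) = i x).
- by move=> S T s ST [h1 h2]; split=> // x xS; apply: h2; exact: ST.
- pose act (g : {s : aut | fixes F s}) : {rmorphism algC -> algC} := projT1 g.
  have [x|||g|x fx|[g hg] h] :=
    @orbit_hom (fsub D) algC algC (@fval D) idfun i _ act (@idomain_dom _) val_inj _ _ _ _ _ (pmap insub S).
  + by have [l hl] := aut_conjugates x; exists l => g; exact: hl.
  + by exists (exist _ 1%g (@fixes1 F)).
  + by move=> [g hg] [h hh]; exists (exist _ (g * h)%g (fixesM hg hh)).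
  + exact: aut_inj.
  + have xF : x \in F by apply: fixed_mem => s hs; exact: (fx (exist _ s hs)).
    by exists (MkFsub (sFD xF)); rewrite /= iF.
  + exists g; split=> // x xS.
    by rewrite h // mem_pmap; apply/mapP; exists (fval x) => //; rewrite valK.
exists s; split=> [x xF|x].
  by have [t [ht _] ts] := hs [:: x]; rewrite -ts ?mem_head // ht.
by have [t [_ ht] ts] := hs [:: fval x]; rewrite -ts ?mem_head // ht ?mem_head.
Qed.
End Extension.

(** Krull density: this is [orbit_hom] for the action of H with t as second homomorphism, the
    hypothesis on t being the agreement on invariants. *)
Lemma aut_density (H : set aut) (t : aut) (S : seq algC) : is_subgroup H ->
  (forall x, (forall s, H s -> s x = x) -> t x = x) ->
  exists2 h, H h & {in S, t =1 h}.
Proof.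
move=> [H1 HM] ht.
pose act (g : {s : aut | H s}) : {rmorphism algC -> algC} := projT1 g.
have HV s : H s -> H (s^-1)%g by move=> Hs; rewrite -[(s^-1)%g]mul1g; exact: HM.
have HM' s u : H s -> H u -> H (s * u)%g.
  by move=> Hs Hu; rewrite -[u]invgK; apply: HM => //; exact: HV.
have [|x|||g|x fx|[g hg] h] := @orbit_hom algC algC algC idfun idfun t _ act (@idomain_dom _) _ _ _ _ _ _ S.
- by [].
- by have [l hl] := aut_conjugates x; exists l => g; exact: hl.
- by exists (exist _ 1%g H1).
- by move=> [g hg] [h hh]; exists (exist _ (g * h)%g (HM' _ _ hg hh)).
- exact: aut_inj.
- exists x; split=> //=; rewrite ht // => s Hs; exact: (fx (exist _ s Hs)).
by exists g.
Qed.

(** * Primes of the ring of algebraic integers *)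

Fact full_closed : GRing.divring_closed (predT : {pred algC}).
Proof. by []. Qed.
Definition full := MkSubfield full_closed.

Local Notation O := (ring_int full).

Lemma ival_int (z : O) : ival z \in Aint.
Proof. by case: z => z /= /andP[]. Qed.

Lemma int_of_proof x : x \in Aint -> x \in integers full.
Proof. by rewrite mem_integers. Qed.
Definition int_of x (h : x \in Aint) : O := MkRingInt (int_of_proof h).

Fact oact_proof (s : aut) (z : O) : s (ival z) \in Aint.
Proof. by rewrite Aint_aut ival_int. Qed.
Definition oact (s : aut) (z : O) : O := int_of (oact_proof s z).
Fact oact_zmod s : zmod_morphism (oact s).
Proof. by move=> x y; apply: val_inj; rewrite /= rmorphB. Qed.
Fact oact_monoid s : monoid_morphism (oact s).
Proof. by split=> [|x y]; apply: val_inj; rewrite /= ?rmorph1 // rmorphM. Qed.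
HB.instance Definition _ s := GRing.isZmodMorphism.Build _ _ (oact s) (oact_zmod s).
HB.instance Definition _ s := GRing.isMonoidMorphism.Build _ _ (oact s) (oact_monoid s).

Lemma ivalB (E : subfield) (x y : ring_int E) : ival (x - y) = ival x - ival y.
Proof. by []. Qed.
Lemma ivalM (E : subfield) (x y : ring_int E) : ival (x * y) = ival x * ival y.
Proof. by []. Qed.

Lemma oactM s t z : oact (s * t)%g z = oact s (oact t z).
Proof. exact: val_inj. Qed.
Lemma oact1 z : oact 1%g z = z.
Proof. exact: val_inj. Qed.
Lemma oactK s : cancel (oact s) (oact s^-1%g).
Proof. by move=> z; apply: val_inj => /=; exact: autK. Qed.
Lemma oactVK s : cancel (oact s^-1%g) (oact s).
Proof. by move=> z; apply: val_inj => /=; exact: autVK. Qed.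

Lemma oact_orbit z : exists l : seq O, forall s : aut, oact s z \in l.
Proof.
have [l hl] := aut_conjugates (ival z); exists (pmap insub l) => s.
by rewrite mem_pmap; apply/mapP; exists (s (ival z)) => //; rewrite (valK (oact s z)).
Qed.

Section Prime.
Variable P : prime_idealr O.
Local Notation pi := (\pi_({ideal_quot P}))%qT.

Definition inertial (s : aut) : Prop := forall z : O, oact s z - z \in P.

Lemma inertialM s t : inertial s -> inertial t -> inertial (s * t)%g.
Proof. by move=> hs ht z; rewrite oactM -(subrKA (oact t z)) rpredD. Qed.

Lemma inertialV s : inertial s -> inertial (s^-1)%g.
Proof. by move=> hs z; have := hs (oact s^-1%g z); rewrite oactVK -rpredN opprB. Qed.

Lemma inertial1 : inertial 1%g.
Proof. by move=> z; rewrite oact1 subrr rpred0. Qed.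

Lemma inertialX s n : inertial s -> inertial (s ^+ n)%g.
Proof.
move=> hs; elim: n => [|n IH]; first exact: inertial1.
by rewrite expgS; exact: inertialM.
Qed.

Lemma inertial_mem s z : inertial s -> (oact s z \in P) = (z \in P).
Proof. by move=> hs; rewrite -[in LHS](subrK z (oact s z)) rpredDl. Qed.

(** This plays the part of the surjection from the decomposition group to the residual
    automorphisms. The invariants needed by [orbit_hom] are the integers of E. *)
Lemma hom_mod_prime (E : subfield) (psi : {rmorphism O -> {ideal_quot P}}) :
  (forall z : O, ival z \in E -> psi z = pi z) ->
  exists2 u, fixes E u & forall z, psi z = pi (oact u z).
Proof.
move=> hpsi.
have [|S|s hs] := @aut_compact
  (fun T s => fixes E s /\ forall z : O, ival z \in T -> psi z = pi (oact s z)).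
- by move=> S T s ST [h1 h2]; split=> // x xS; apply: h2; exact: ST.
- pose act (g : {s : aut | fixes E s}) : {rmorphism O -> O} := oact (projT1 g).
  have [|x|||g|x fx|[g hg] h] :=
    @orbit_hom O O {ideal_quot P} idfun pi psi _ act (@Quotient.rquot_IdomainAxiom _ P) _ _ _ _ _ _ (pmap insub S).
  + by [].
  + by have [l hl] := oact_orbit x; exists l => g; exact: hl.
  + by exists (exist _ 1%g (@fixes1 E)) => z; exact: oact1.
  + move=> [g hg] [h hh]; exists (exist _ (g * h)%g (fixesM hg hh)) => z.
    exact: oactM.
  + exact: can_inj (oactK _).
  + exists x; split=> //=; rewrite hpsi //; apply: fixed_mem => s hs.
    exact: (congr1 (@ival _) (fx (exist _ s hs))).
  + exists g; split=> // x xS.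
    by rewrite h // mem_pmap; apply/mapP; exists (ival x) => //; rewrite valK.
exists s => [x xE|x].
  by have [t [ht _] ts] := hs [:: x]; rewrite -ts ?mem_head // ht.
have [t [_ ht] ts] := hs [:: ival x]; rewrite ht ?mem_head //.
by congr pi; apply: val_inj; rewrite /= ts ?mem_head.
Qed.

Lemma pi_eq (x y : O) : pi x = pi y <-> x - y \in P.
Proof.
rewrite (Quotient.idealrBE P); split=> [->|/eqP] //; exact: eqxx.
Qed.

(** Inertia surjects onto the inertia of a subextension: if u over E induces the same map as t
    modulo P, then t u^-1 is inertial and agrees with t on E. *)
Lemma inertial_lift (E : subfield) t :
  (forall z : O, ival z \in E -> oact t z - z \in P) ->
  exists2 s, inertial s & forall x, x \in E -> s x = t x.
Proof.
move=> ht; have [z zE|u uE hu] := @hom_mod_prime E (pi \o oact t).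
  by apply/pi_eq; exact: ht.
exists (t * u^-1)%g => [z|x xE]; last by rewrite autM (fixesV uE).
have /pi_eq := hu (oact u^-1%g z).
by rewrite oactVK oactM.
Qed.
End Prime.

Lemma ival_inj E : injective (@ival E). Proof. exact: val_inj. Qed.
Fact ival_zmod E : zmod_morphism (@ival E). Proof. by []. Qed.
Fact ival_monoid E : monoid_morphism (@ival E). Proof. by []. Qed.
HB.instance Definition _ E := GRing.isZmodMorphism.Build _ algC (@ival E) (@ival_zmod E).
HB.instance Definition _ E := GRing.isMonoidMorphism.Build _ algC (@ival E) (@ival_monoid E).

Fact up_proof (E : subfield) (x : ring_int E) : ival x \in Aint.
Proof. by case: x => x /= /andP[]. Qed.
Definition up (E : subfield) (x : ring_int E) : O := int_of (up_proof x).
Fact up_zmod E : zmod_morphism (@up E).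
Proof. by move=> x y; exact: val_inj. Qed.
Fact up_monoid E : monoid_morphism (@up E).
Proof. by split=> [|x y]; exact: val_inj. Qed.
HB.instance Definition _ E := GRing.isZmodMorphism.Build _ _ (@up E) (@up_zmod E).
HB.instance Definition _ E := GRing.isMonoidMorphism.Build _ _ (@up E) (@up_monoid E).

Lemma down_proof (E : subfield) (z : O) : ival z \in E -> ival z \in integers E.
Proof. by rewrite mem_integers ival_int andbT. Qed.
Definition down (E : subfield) (z : O) (h : ival z \in E) : ring_int E :=
  MkRingInt (down_proof h).
Lemma downK (E : subfield) z (h : ival z \in E) : up (down h) = z.
Proof. exact: val_inj. Qed.

Lemma oact_orbit_perm (E : subfield) (y : O) : exists2 ys : seq O, y \in ys &
  forall h, fixes E h -> perm_eq (map (oact h) ys) ys.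
Proof.
have [l hl] := oact_orbit y.
pose ys := undup [seq z <- l | `[< exists2 h, fixes E h & oact h y = z >]].
have mys z : reflect (exists2 h, fixes E h & oact h y = z) (z \in ys).
  rewrite mem_undup mem_filter; apply: (iffP andP) => [[/asboolP]|[h hE <-]] //.
  by split; [apply/asboolP; exists h | exact: hl].
exists ys; first by apply/mys; exists 1%g; rewrite ?oact1 //; exact: fixes1.
move=> h hE.
have uo : uniq (map (oact h) ys).
  by rewrite map_inj_uniq ?undup_uniq //; exact: can_inj (oactK h).
have sub : {subset map (oact h) ys <= ys}.
  move=> _ /mapP[z /mys [g gE <-] ->]; apply/mys; exists (h * g)%g; last exact: oactM.
  exact: fixesM.
apply: uniq_perm; rewrite ?undup_uniq //.
by have [] := uniq_min_size uo sub _; rewrite ?size_map.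
Qed.

Section LyingOver.
Variables (E : subfield) (Q : prime_idealr (ring_int E)).

Definition mem_down (z : O) : Prop := exists2 x, x \in Q & up x = z.

Definition disjoint_ideal : set (set O) := fun J =>
  (forall a u v, J u -> J v -> J (a * u + v)) /\
  (forall z, J z -> ival z \in E -> mem_down z).

Lemma mem_downP (x : ring_int E) : mem_down (up x) <-> x \in Q.
Proof.
split=> [[y yQ e]|xQ]; last by exists x.
by have -> : x = y by apply: val_inj; move/(congr1 (@ival _)): e.
Qed.

Lemma prod_expand (R : comNzRingType) (s x : R) (ys : seq R) :
  exists c, \prod_(y <- ys) (s - x * y) = s ^+ size ys + x * c.
Proof.
elim: ys => [|y ys [c IH]]; first by exists 0; rewrite big_nil mulr0 addr0.
exists (s * c - y * (s ^+ size ys + x * c)); rewrite big_cons IH.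
rewrite /= exprS; set t := s ^+ _.
by rewrite mulrBl [X in X - _ = _]mulrDr -!addrA mulrBr mulrCA [x * (y * _)]mulrA.
Qed.

(* Zorn's lemma gives an ideal J maximal among those that meet E inside Q. If x in
   Q were outside J, then some s = j + x y with j in J would lie in E outside Q;
   the product of the s - x y', for y' conjugate to y over E, lies in J and in E
   and is congruent to a power of s modulo x, a contradiction. *)
Lemma lying_over : exists P : prime_idealr O, forall x : ring_int E, (up x \in P) = (x \in Q).
Proof.
have [F sF totF|J [[Jid JE] Jmax]] := @Zorn_bigcup O disjoint_ideal.
  split=> [a u v [A FA Au] [B FB Bv]|z [A FA Az]]; last by case: (sF _ FA) => _; apply.
  have [AB|BA] := totF _ _ FA FB.
    by exists B => //; case: (sF _ FB) => h _; apply: h => //; exact: AB.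
  by exists A => //; case: (sF _ FA) => h _; apply: h => //; exact: BA.
(* The family contains the empty set, so J is not yet known to contain 0; [J0] adjoins it until
   maximality shows [J00]. *)
pose J0 z := J z \/ z = 0.
have J0id a u v : J0 u -> J0 v -> J0 (a * u + v).
  have J0' u' : J u' -> J 0 by move=> h; rewrite -(addNr u') -mulN1r; exact: Jid.
  move=> [hu|->] [hv|->]; rewrite ?mulr0 ?add0r ?addr0; try by [left | right | left; exact: Jid].
  by left; rewrite -[_ * _]addr0; apply: Jid => //; exact: J0' hu.
have J0E z : J0 z -> ival z \in E -> mem_down z.
  by move=> [/JE //|-> _]; exists 0; rewrite ?rpred0 ?rmorph0.
(* Maximality: the larger ideal J + (x) must violate the condition on E. *)
have ext x : ~ J x -> exists j y, [/\ J0 j, ival (j + x * y) \in E & ~ mem_down (j + x * y)].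
  move=> nJx; apply: contrapT => h.
  apply: (Jmax (fun z => exists j y, J0 j /\ z = j + x * y)).
    split.
      by move=> z Jz; exists z, 0; split; [left | rewrite mulr0 addr0].
    by move=> /(_ x) sub; apply: nJx; apply: sub; exists 0, 1; split; [right | rewrite add0r mulr1].
  split=> [a u v [j [y [hj ->]]] [j' [y' [hj' ->]]]|z [j [y [hj ->]]] jE].
    exists (a * j + j'), (a * y + y'); split; first exact: J0id.
    by rewrite !mulrDr addrACA; congr (_ + (_ + _)); rewrite mulrCA.
  by apply: contrapT => nm; apply: h; exists j, y.
have J00 : J 0.
  apply: contrapT => n0; have [j [y [[Jj|->] jE nm]]] := ext 0 n0.
    by apply: n0; rewrite -(addNr j) -mulN1r; exact: Jid.
  by rewrite mul0r addr0 in jE nm; apply: nm; apply: J0E => //; right.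
have JJ0 j : J0 j -> J j by case=> [|->].
have Jm a u : J u -> J (a * u) by move=> Ju; rewrite -[_ * _]addr0; exact: Jid.
have Jd u v : J u -> J v -> J (u + v) by move=> Ju Jv; rewrite -[u]mul1r; exact: Jid.
have J1 : ~ J 1.
  move=> h; have [|x xQ e] := JE _ h; first by rewrite /= rpred1.
  have : x = 1 by apply: val_inj; move/(congr1 (@ival _)): e.
  by move=> x1; move: xQ; rewrite x1 idealr1.
have Jp a b : J (a * b) -> J a \/ J b.
  move=> hab; have [|na] := pselect (J a); first by left.
  have [|nb] := pselect (J b); first by right.
  have [j1 [y1 [/JJ0 h1 e1 n1]]] := ext a na; have [j2 [y2 [/JJ0 h2 e2 n2]]] := ext b nb.
  have Jprod : J ((j1 + a * y1) * (j2 + b * y2)).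
    rewrite mulrDl mulrC; apply: (Jd _ _ (Jm _ _ h1)); rewrite mulrDr.
    by apply: Jd; [exact: Jm | rewrite mulrACA mulrC; exact: Jm].
  have [|x xQ ex] := JE _ Jprod; first by rewrite ivalM rpredM.
  have : down e1 * down e2 \in Q.
    rewrite (_ : _ * _ = x) //; apply: val_inj.
    by move/(congr1 (@ival _)): ex.
  rewrite prime_idealrM => /orP[] h.
    by case: n1; exists (down e1); rewrite ?downK.
  by case: n2; exists (down e2); rewrite ?downK.
have QJ x : x \in Q -> J (up x).
  move=> xQ; apply: contrapT => nx; have [j [y [/JJ0 hj jE nm]]] := ext _ nx.
  set s := j + _ in jE nm.
  have [ys yys permys] := oact_orbit_perm E y.
  have [c ec] := prod_expand s (up x) ys; set m := \prod_(_ <- _) _ in ec.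
  have mJ : J m.
    rewrite /m (big_rem y) //=.
    by rewrite mulrC; apply: Jm; rewrite /s addrK.
  have mE : ival m \in E.
    apply: fixed_mem => h hE; suff : oact h m = m by move/(congr1 (@ival _)).
    rewrite /m rmorph_prod /=.
    under eq_bigr do rewrite rmorphB rmorphM /=.
    have -> : oact h s = s by apply: val_inj; rewrite /= hE.
    have -> : oact h (up x) = up x.
      by apply: val_inj; rewrite /= hE //; case: (x) => ? /= /andP[].
    rewrite -(big_map (oact h) predT (fun z => s - up x * z)).
    exact/perm_big/permys.
  have x0 : ival x != 0.
    by apply/eqP => x0; apply: nx; rewrite (_ : up x = 0) //; exact: val_inj.
  have xE : ival x \in E by case: (x) => ? /= /andP[].
  have cE : ival c \in E.
    have -> : ival c = (ival m - ival s ^+ size ys) / ival x.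
      by rewrite ec rmorphD rmorphXn rmorphM addrC addKr mulrC mulKf.
    by rewrite rpred_div ?rpredB ?rpredX.
  have [m' m'Q em'] := JE _ mJ mE.
  have : down jE ^+ size ys \in Q.
    have -> : down jE ^+ size ys = m' - x * down cE.
      apply: (can_inj (g := fun z : O => insubd 0 (ival z)) (f := @up E)).
        by move=> z; rewrite /insubd valK.
      by rewrite rmorphB rmorphM rmorphXn /= !downK em' ec addrK.
    by rewrite rpredB // mulrC idealMr.
  elim: (size ys) => [|n IH]; first by rewrite expr0 idealr1.
  rewrite exprS prime_idealrM => /orP[h|//].
  by apply: nm; exists (down jE); rewrite ?downK.
pose P : pred O := fun z => `[< J z >].
have P1 : idealr_closed (P : {pred O}).
  split; [exact/asboolP | exact/asboolPn | move=> a u v /asboolP hu /asboolP hv].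
  exact/asboolP/Jid.
have P2 : prime_idealr_closed (P : {pred O}).
  by move=> u v /asboolP/Jp[] h; apply/orP; [left | right]; exact/asboolP.
pose m1 := isIdealr.Build O P P1.
pose m2 := isPrimeIdealrClosed.Build O P P2.
exists (HB.pack_for (prime_idealr O) P m1 m2 : prime_idealr O) => x.
apply/asboolP/idP => [h|]; last exact: QJ.
apply/mem_downP; apply: JE => //.
by case: (x) => ? /= /andP[].
Qed.
End LyingOver.

(** * Integrality and residue characteristics *)

Local Notation ZtoC := (intr : int -> algC).

(** The relation is stored as a polynomial so that [primitive_scale] can make it integral and
    primitive; applied to the powers of one element it bounds the degree of that element. *)
Lemma nf_dependent (k : subfield) : number_field k ->
  exists d, forall e : 'I_d.+1 -> algC, (forall i, e i \in k) ->
    exists q : {poly rat}, [/\ q != 0, (size q <= d.+1)%N & \sum_(i < d.+1) ratr q`_i * e i = 0].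
Proof.
move=> [n [b hb]]; exists n => e ek.
pose c i := projT1 (cid (hb _ (ek i))).
have ec i : e i = \sum_j ratr (c i j) * b j by rewrite /c; case: cid.
pose C : 'M[rat]_(n.+1, n) := \matrix_(i, j) c i j.
have : kermx C != 0.
  by rewrite kermx_eq0 /row_free; apply: contraTneq (rank_leq_col C) => ->; rewrite ltnn.
case/rowV0Pn => v /sub_kermxP vC v0.
pose q := \poly_(i < n.+1) v 0 (inord i).
have qi (i : 'I_n.+1) : q`_i = v 0 i by rewrite coef_poly ltn_ord inord_val.
exists q; split.
- apply: contra v0 => /eqP q0; apply/eqP/rowP => i.
  by rewrite -qi q0 coef0 mxE.
- exact: size_poly.
under eq_bigr => i _ do rewrite qi ec mulr_sumr.
rewrite exchange_big /= big1 // => j _.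
under eq_bigr => i _ do rewrite mulrA -rmorphM.
rewrite -mulr_suml -rmorph_sum /= (_ : \sum_i _ = 0) ?rmorph0 ?mul0r //.
have := congr1 (fun M : 'rV_n => M 0 j) vC; rewrite !mxE => vCj.
by rewrite -[RHS]vCj; apply: eq_bigr => i _; rewrite mxE.
Qed.

Lemma primitive_scale (q : {poly rat}) : q != 0 -> exists (f : {poly int}) (a : rat),
  [/\ a != 0, q = a *: map_poly intr f
    & forall l : nat, prime l -> exists i, ~~ (l %| f`_i)%Z].
Proof.
move=> q0; have [pz [a a0 Dq]] := rat_poly_scale q.
have pz0 : pz != 0 by apply: contra q0 => /eqP pz0; rewrite Dq pz0 rmorph0 scaler0.
exists (zprimitive pz), (a%:~R^-1 * (zcontents pz)%:~R); split.
- by rewrite mulf_neq0 ?invr_eq0 ?intr_eq0 ?zcontents_eq0.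
- by rewrite Dq {1}[pz]zpolyEprim map_polyZ scalerA.
move=> l pl; apply: contrapT => h.
have : zprimitive pz \is a polyOver (dvdz l).
  by apply/polyOverP => i; apply: contrapT => /negP hi; apply: h; exists i.
rewrite -dvdz_contents zcontents_primitive pz0 /= => /dvdzP[c].
move/(congr1 absz); rewrite abszM /= => /esym/eqP; rewrite muln_eq1 => /andP[_ /eqP l1].
by rewrite l1 in pl.
Qed.

(** Determinant trick: Y is an eigenvector with eigenvalue y of an integer matrix, nonzero because
    of its entry [i0]. *)
Lemma Aint_span n (Y : n.-tuple algC) y (i0 : 'I_n) :
  Y`_i0 != 0 -> (forall i : 'I_n, y * Y`_i \in Cint_span Y) -> y \in Aint.
Proof.
move=> v0 h.
have hA (i : 'I_n) : inIntSpan Y (y * Y`_i) by apply/Cint_spanP; exact: h.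
pose A i := sval (sig_eqW (hA i)).
have hA' (i : 'I_n) : y * Y`_i = \sum_(j < n) Y`_j *~ A i j by rewrite /A; case: sig_eqW.
pose M : 'M[int]_n := \matrix_(j, i) A i j.
have Mc : char_poly (map_mx ZtoC M) = map_poly ZtoC (char_poly M) by rewrite map_char_poly.
apply: (root_monic_Aint (p := char_poly (map_mx ZtoC M))).
- rewrite -eigenvalue_root_char; apply/eigenvalueP; exists (\row_i Y`_i).
    by apply/rowP => i; rewrite !mxE hA'; apply: eq_bigr => j _; rewrite !mxE mulrzr.
  by apply: contra v0 => /eqP/rowP/(_ i0); rewrite !mxE => ->.
- exact: char_poly_monic.
- by rewrite Mc; apply/polyOverP => i; rewrite coef_map /= Num.Theory.intr_int.
Qed.

(** The span of the powers x^s with s <= size f is stable under y. For s <= m this is a count of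
    degrees; for s > m the relation f(x) = 0 turns y x^m into minus the value of the lower part of
    f. *)
Lemma Aint_drop_poly (f : {poly int}) (x : algC) m :
  root (map_poly ZtoC f) x -> (map_poly ZtoC (drop_poly m f)).[x] \in Aint.
Proof.
move=> fx; set y := _.[x]; pose n := size f.
have yxm : y * x ^+ m = - (map_poly ZtoC (take_poly m f)).[x].
  apply/eqP; rewrite -addr_eq0 addrC; apply/eqP; rewrite -[RHS](rootP fx).
  rewrite -[in RHS](poly_take_drop m f) rmorphD rmorphM /= map_polyXn.
  by rewrite hornerD hornerM hornerXn.
pose Y : n.+1.-tuple algC := [tuple x ^+ i | i < n.+1].
have Yi i : (i <= n)%N -> x ^+ i \in Cint_span Y.
  move=> le; apply: mem_Cint_span; apply/mapP; exists (inord i); rewrite ?mem_enum ?inordK //.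
have Yp (g : {poly int}) t : (size g + t <= n.+1)%N -> (map_poly ZtoC g).[x] * x ^+ t \in Cint_span Y.
  have sz : size (map_poly ZtoC g) = size g.
    by rewrite size_map_inj_poly ?rmorph0 //; exact: intr_inj.
  move=> le; rewrite horner_coef sz mulr_suml rpred_sum // => i _.
  rewrite coef_map -mulrA -exprD mulrzl rpredMz // Yi // -ltnS.
  by apply: leq_trans le; rewrite ltn_add2r.
apply: (@Aint_span n.+1 Y y ord0); first by rewrite nth_mktuple expr0 oner_eq0.
move=> s; rewrite nth_mktuple; case: (leqP s m) => [sm|ms].
  apply: Yp; rewrite size_drop_poly; have := ltn_ord s; rewrite -/n.
  case: (leqP n m) => [nm|mn]; last first.
    by move=> _; apply: leq_trans (leq_add (leqnn _) sm) _; rewrite subnK ?(ltnW mn) //.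
  by rewrite (eqP nm) add0n => /ltnW.
rewrite -(subnKC (ltnW ms)) exprD mulrA yxm mulNr rpredN Yp //.
apply: leq_trans (leq_add (size_take_poly _ _) (leqnn _)) _.
by rewrite subnKC ?(ltnW ms) // ltnW.
Qed.

Lemma prime_restrict (E : subfield) (P : prime_idealr O) :
  exists Q : prime_idealr (ring_int E), forall x, (x \in Q) = (up x \in P).
Proof.
pose Q : pred (ring_int E) := fun x => up x \in P.
have Q1 : idealr_closed (Q : {pred ring_int E}).
  have mQ x : (x \in (Q : {pred ring_int E})) = (up x \in P) by [].
  split=> [||a u v]; rewrite !mQ ?rmorph0 ?rpred0 ?rmorph1 ?idealr1 // => hu hv.
  by rewrite rmorphD rmorphM rpredD // idealMr.
have Q2 : prime_idealr_closed (Q : {pred ring_int E}).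
  move=> u v; have mQ x : (x \in (Q : {pred ring_int E})) = (up x \in P) by [].
  by rewrite !mQ rmorphM prime_idealrM.
pose m1 := isIdealr.Build (ring_int E) Q Q1.
pose m2 := isPrimeIdealrClosed.Build (ring_int E) Q Q2.
by exists (HB.pack_for (prime_idealr (ring_int E)) Q m1 m2 : prime_idealr (ring_int E)).
Qed.

(* The product of the conjugates over E of a polynomial with coefficients in P1 has
   its coefficients in E and P1, hence in P; so one of the conjugates is zero
   modulo P. *)
Lemma prime_conj (E : subfield) (P1 P : prime_idealr O) :
  (forall z, ival z \in E -> z \in P1 -> z \in P) ->
  exists2 u, fixes E u & forall z, z \in P1 -> oact u z \in P.
Proof.
move=> sub.
have [|S|s hs] := @aut_compact
  (fun T s => fixes E s /\ forall z : O, ival z \in T -> z \in P1 -> oact s z \in P).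
- by move=> S T s ST [h1 h2]; split=> // x xS; apply: h2; exact: ST.
- pose act (g : {s : aut | fixes E s}) : {rmorphism O -> O} := oact (projT1 g).
  pose b := [seq z <- (pmap insub S : seq O) | z \in P1].
  have orb x : exists l : seq O, forall g, act g x \in l.
    by have [l hl] := oact_orbit x; exists l => g; exact: hl.
  have one : exists e, act e =1 id by exists (exist _ 1%g (@fixes1 E)) => z; exact: oact1.
  have comp g h : exists f, act f =1 act g \o act h.
    move: g h => [g hg] [h hh]; exists (exist _ (g * h)%g (fixesM hg hh)) => z; exact: oactM.
  have inj g : injective (act g) by exact: can_inj (oactK _).
  have [o [uo mo permo]] := poly_orbit orb comp inj (Poly b).
  pose N := \prod_(B <- o) B.
  have Bo : Poly b \in o by apply/mo; have [e he] := one; exists e; rewrite map_poly_id.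
  have NP1 i : N`_i \in P1.
    rewrite /N (big_rem _ Bo) /= coefM rpred_sum // => j _; rewrite mulrC idealMr //.
    rewrite coef_Poly; have [lt|ge] := ltnP j (size b); last by rewrite nth_default ?rpred0.
    by have := mem_nth 0 lt; rewrite mem_filter => /andP[].
  have NE i : ival N`_i \in E.
    apply: fixed_mem => s hs; suff -> : s (ival N`_i) = ival (oact s N`_i) by
      congr ival; rewrite -[in RHS](_ : map_poly (act (exist _ s hs)) N = N) ?coef_map //;
      rewrite rmorph_prod /= -(big_map (map_poly (act (exist _ s hs))) predT id);
      exact: perm_big.
    by [].
  have : map_poly (\pi_({ideal_quot P}))%qT N = 0.
    apply/polyP => i; rewrite coef_map coef0; apply/eqP.
    rewrite -(rmorph0 (\pi_({ideal_quot P}))%qT) /=; apply/eqP/pi_eq; rewrite subr0.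
    by apply: sub.
  rewrite rmorph_prod => /(poly_prod_eq0 (@Quotient.rquot_IdomainAxiom _ P))[B /mo [[g hg] <-]].
  move=> /polyP e; exists g; split=> // z zS zP1.
  have zb : z \in b.
    rewrite mem_filter zP1 mem_pmap; apply/mapP; exists (ival z) => //.
    by rewrite valK.
  have := e (index z b); rewrite !coef_map coef_Poly nth_index // coef0 /=.
  by rewrite -(rmorph0 (\pi_({ideal_quot P}))%qT) => /pi_eq; rewrite subr0.
exists s => [x xE|x xP1].
  by have [t [ht _] ts] := hs [:: x]; rewrite -ts ?mem_head // ht.
have [t [_ ht] ts] := hs [:: ival x].
have := ht x (mem_head _ _) xP1; congr (_ \in P).
by apply: val_inj; rewrite /= ts ?mem_head.
Qed.

Definition rat_subfield := MkSubfield (Crat_divring_closed : GRing.divring_closed (Crat : {pred algC})).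

(** The product of the conjugates of z over the rationals is a nonzero integer in P, and one of its
    prime factors is then in P. *)
Lemma residue_char (P : prime_idealr O) z : z \in P -> z != 0 ->
  exists2 l : nat, prime l & l%:R \in P.
Proof.
move=> zP z0.
have [m m0 mP] : exists2 m : nat, (m > 0)%N & m%:R \in P.
  have [ys zys permys] := oact_orbit_perm rat_subfield z.
  pose N := \prod_(y <- ys | y != 0) y.
  have NP : N \in P by rewrite /N (big_rem z) //= z0 mulrC idealMr.
  have N0 : ival N != 0.
    rewrite rmorph_prod prodf_seq_neq0; apply/allP => y _; apply/implyP => y0.
    by apply: contra y0 => /eqP h; apply/eqP/val_inj.
  have : ival N \in Num.int.
    apply: Cint_rat_Aint; last exact: ival_int.
    apply: (@fixed_mem rat_subfield) => s sQ; suff {2}<- : oact s N = N by [].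
    rewrite rmorph_prod /= -[RHS](perm_big _ (permys s sQ)) big_map.
    by apply: eq_bigl => y; rewrite -(inj_eq (can_inj (oactK s))) rmorph0.
  case/Num.Theory.intrP => m Dm; exists `|m|%N.
    by rewrite absz_gt0; apply: contra N0 => /eqP m0; rewrite Dm m0.
  case: m Dm => m Dm.
    rewrite (_ : `|m|%:R = N) //; apply: ival_inj.
    by rewrite Dm; exact: rmorph_nat.
  rewrite (_ : `|Negz m|%:R = - N) ?rpredN //; apply: ival_inj.
  rewrite [RHS](_ : _ = - ival N) // Dm NegzE [RHS](_ : _ = m.+1%:R); first exact: rmorph_nat.
  by rewrite rmorphN opprK.
elim: m {-2}m (leqnn m) m0 mP => [|n IH] m mn m0 mP; first by rewrite leqNgt m0 in mn.
have [m1|m1] := leqP m 1.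
  have e : m = 1%N by apply/eqP; rewrite eqn_leq m1 m0.
  by rewrite e idealr1 in mP.
have [pp dv] := (pdiv_prime m1, pdiv_dvd m).
move: mP; rewrite -(divnK dv) natrM prime_idealrM => /orP[h|h]; last by exists (pdiv m).
apply: (IH (m %/ pdiv m)%N) => //.
  by rewrite -ltnS (leq_trans _ mn) // ltn_Pdiv ?prime_gt1.
by rewrite divn_gt0 ?prime_gt0 // dvdn_leq.
Qed.

Lemma int_mem_prime (P : prime_idealr O) (l : nat) (a : int) :
  prime l -> l%:R \in P -> (a%:~R \in P) = (l %| a)%Z.
Proof.
move=> pl lP; apply/idP/idP => [aP|/dvdzP[c ->]]; last first.
  by rewrite rmorphM /= idealMr.
apply: contraT => nd.
have cop : coprimez a l.
  by rewrite /coprimez /gcdz; rewrite dvdzE in nd; rewrite gcdnC [gcdn _ _](eqP (_ : coprime _ _)) ?prime_coprime.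
have /coprimezP[[u v] /= e] := cop.
have : (1 : O) \in P.
  have -> : (1 : O) = u%:~R * a%:~R + v%:~R * l%:R.
    by rewrite -[l%:R]/((l : int)%:~R) -!rmorphM -rmorphD /= e.
  by rewrite rpredD // idealMr.
by rewrite idealr1.
Qed.

(* Every element of algC is, at P, integral or the inverse of an integral
   element: the tails c_i = sum_(j >= i) f_j x^(j-i) of a primitive integral
   polynomial f killing x are integral, and the f_j = c_j - x c_(j+1) are not
   all in P. *)
Lemma prufer (P : prime_idealr O) (l : nat) x : prime l -> l%:R \in P ->
  exists a b : O, x * ival b = ival a /\ ~ (a \in P /\ b \in P).
Proof.
move=> pl lP; have [q [Dq mq] rq] := minCpolyP x.
have [f [a [a0 Df hf]]] := primitive_scale (monic_neq0 mq).
have [i ni] := hf l pl.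
have rf : root (map_poly ZtoC f) x.
  have : root (map_poly ratr q) x by rewrite rq.
  rewrite Df map_polyZ /= rootZ ?fmorph_eq0 // -map_poly_comp.
  by congr (root _ x); apply: eq_map_poly => z /=; rewrite rmorph_int.
pose c m : O := int_of (Aint_drop_poly m rf).
have cS m : ival (c m) = (f`_m)%:~R + x * ival (c m.+1).
  have e : drop_poly m f = (f`_m)%:P + 'X * drop_poly m.+1 f.
    apply/polyP => -[|j]; rewrite coefD coefC coefXM coef_drop_poly /= ?addr0 ?add0r //.
    by rewrite coef_drop_poly addSnnS.
  by rewrite /= e rmorphD rmorphM /= map_polyC map_polyX hornerD hornerM hornerX hornerC.
apply: contrapT => nex.
have h m : c m - (f`_m)%:~R \in P /\ c m.+1 \in P.
  apply: contrapT => hm; apply: nex; exists (c m - (f`_m)%:~R), (c m.+1); split=> //.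
  by rewrite ivalB (cS m) rmorph_int addrAC subrr add0r.
have c0 : c 0%N \in P.
  suff -> : c 0%N = 0 by exact: rpred0.
  by apply: val_inj; rewrite /= (_ : drop_poly 0 f = f) ?(rootP rf) //;
     apply/polyP => j; rewrite coef_drop_poly addn0.
have cP m : c m \in P by case: m => // m; case: (h m).
move: ni; rewrite -(int_mem_prime _ pl lP) => /negP; apply.
have [h1 _] := h i; rewrite (_ : (f`_i)%:~R = c i - (c i - (f`_i)%:~R)). by rewrite rpredB ?cP.
by rewrite subKr.
Qed.

Lemma domain_roots (R : comNzRingType) (p : {poly R}) rs :
  (forall x y : R, x * y = 0 -> (x == 0) || (y == 0)) ->
  p != 0 -> all (root p) rs -> uniq rs -> (size rs < size p)%N.
Proof.
move=> dom; elim: rs p => [|a rs IH] p p0 /=; first by rewrite size_poly_gt0.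
case/andP => /factor_theorem[q Dp] ars /andP[nars urs].
have q0 : q != 0 by apply: contra p0 => /eqP q0; rewrite Dp q0 mul0r.
rewrite Dp size_Mmonic ?monicXsubC // size_XsubC addn2 /= ltnS IH //.
apply/allP => b brs; have := allP ars b brs; rewrite /root Dp hornerM hornerXsubC.
move=> /eqP/dom/orP[//|]; rewrite subr_eq0 => /eqP ba.
by rewrite -ba brs in nars.
Qed.

Lemma minCpoly_size_bound (k : subfield) : number_field k ->
  exists d, forall x, x \in k -> (size (minCpoly x) <= d.+1)%N.
Proof.
move=> /nf_dependent[d hd]; exists d => x xk.
have [i|q [q0 sq e]] := hd (fun i => x ^+ i); first exact: rpredX.
have [p [Dp mp] rp] := minCpolyP x.
rewrite Dp size_map_poly; apply: leq_trans (sq); apply: dvdp_leq => //.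
rewrite -rp; apply/rootP; rewrite (horner_coef_wide (n := d.+1)) ?size_map_poly //.
by rewrite -[RHS]e; apply: eq_bigr => i _; rewrite coef_map.
Qed.

(** * Residue fields and Frobenius elements *)

Section Frobenius.
Variables (P : prime_idealr O) (l : nat).
Hypotheses (pl : prime l) (lP : l%:R \in P).
Local Notation Om := {ideal_quot P}.
Local Notation pi := (\pi_(Om))%qT.

Lemma Om_dom (x y : Om) : x * y = 0 -> (x == 0) || (y == 0).
Proof. exact: Quotient.rquot_IdomainAxiom. Qed.

Lemma Om_char : l \in [pchar Om].
Proof.
rewrite inE pl /=; apply/eqP; rewrite -(rmorph_nat pi) -(rmorph0 pi).
by apply/pi_eq; rewrite subr0.
Qed.

Fixpoint frob (n : nat) : {rmorphism Om -> Om} :=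
  if n is n'.+1 then (frob n' \o pFrobenius_aut Om_char)%FUN else idfun.

Lemma frobE n x : frob n x = x ^+ (l ^ n).
Proof.
elim: n x => [|n IH] x; first by rewrite expn0 expr1.
by rewrite /= IH pFrobenius_autE -exprM -expnS.
Qed.

Lemma frob_inj n : injective (frob n).
Proof.
elim: n => [|n IH] x y //= /IH e; apply/eqP; rewrite -subr_eq0.
have : (x - y) ^+ l = 0.
  by rewrite -(pFrobenius_autE Om_char) rmorphB /= e subrr.
move: (x - y) => z; elim: (l) => [|m IHm]; first by move/eqP; rewrite expr0 oner_eq0.
by rewrite exprS => /Om_dom/orP[//|/eqP/IHm].
Qed.

(** The iterates of Frobenius send x to roots of the reduction of its minimal polynomial, which has
    at most d of them. Two of the first d + 1 iterates coincide, so x has a period at most d, which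
    divides d!. *)
Lemma residue_exponent (k : subfield) : number_field k ->
  exists2 f, (0 < f)%N & forall z : O, ival z \in k -> z ^+ (l ^ f) - z \in P.
Proof.
move=> /minCpoly_size_bound[d hd]; exists d`!; first exact: fact_gt0.
move=> z zk; apply/pi_eq; rewrite rmorphXn /= -frobE; set x := pi z.
have /Num.Theory.floorpP[pz Dpz] : ival z \in Aint by exact: ival_int.
have mpz : pz \is monic.
  have := minCpoly_monic (ival z); rewrite Dpz monicE lead_coef_map_inj ?rmorph0 //; last exact: intr_inj.
  by rewrite -[1]/(1%:~R) eqr_int.
have spz : (size pz <= d.+1)%N.
  by have := hd _ zk; rewrite Dpz size_map_inj_poly ?rmorph0 //; exact: intr_inj.
pose p : {poly Om} := map_poly intr pz.
have mp : p \is monic by exact: monic_map.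
have px : root p x.
  apply/rootP; rewrite /p /x.
  have -> : map_poly intr pz = map_poly pi (map_poly (intr : int -> O) pz).
    by rewrite -map_poly_comp; apply: eq_map_poly => a /=; rewrite rmorph_int.
  rewrite horner_map -(rmorph0 pi); congr pi; apply: ival_inj.
  rewrite -horner_map rmorph0 -map_poly_comp -(rootP (root_minCpoly (ival z))) Dpz.
  by congr _.[_]; apply: eq_map_poly => a /=; rewrite rmorph_int.
have pfx i : root p (frob i x).
  have -> : p = map_poly (frob i) p.
    by rewrite /p -map_poly_comp; apply: eq_map_poly => a /=; rewrite rmorph_int.
  exact: rmorph_root.
have [i [j [ij jd e]]] : exists i j, [/\ (i < j)%N, (j <= d)%N & frob i x = frob j x].
  apply: contrapT => nex; pose rs := [seq frob i x | i <- iota 0 d.+1].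
  have urs : uniq rs.
    rewrite map_inj_in_uniq ?iota_uniq // => i j; rewrite !mem_iota !add0n /= => id jd e.
    case: (ltngtP i j) => // lt; exfalso; apply: nex.
      by exists i, j.
    by exists j, i.
  have := @domain_roots _ p rs Om_dom (monic_neq0 mp) _ urs.
  rewrite size_map size_iota => h; have := leq_trans (h _) (leq_trans (size_poly _ _) spz).
  rewrite ltnn => h'; suff : false by []; apply: h'.
  by apply/allP => _ /mapP[i _ ->].
have frobD m n y : frob (m + n) y = frob m (frob n y).
  by rewrite !frobE -exprM mulnC -expnD.
have fix1 : frob (j - i) x = x.
  by apply: (@frob_inj i); rewrite -frobD subnKC ?(ltnW ij) // -e.
have /dvdnP[c ->] : (j - i %| d`!)%N.
  by rewrite dvdn_fact // subn_gt0 ij (leq_trans (leq_subr _ _)).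
by elim: c => [|c IH]; rewrite ?mul0n // mulSn frobD IH.
Qed.

Lemma frobenius_exists (k : subfield) : number_field k ->
  exists t N, [/\ (1 < N)%N, fixes k t & forall z : O, oact t z - z ^+ N \in P].
Proof.
move=> /residue_exponent[f f0 hf].
have [z zk|t tk ht] := @hom_mod_prime P k (frob f \o pi)%FUN.
  by rewrite /= frobE -rmorphXn; apply/pi_eq; exact: hf.
exists t, (l ^ f)%N; split=> // [|z]; first by rewrite -(exp1n f) ltn_exp2r ?prime_gt1.
by apply/pi_eq; rewrite -ht /= frobE rmorphXn.
Qed.
End Frobenius.

Lemma aut_order (s : aut) x : exists2 n, (0 < n)%N & (s ^+ n)%g x = x.
Proof.
have [l hl] := aut_conjugates x.
apply: contrapT => nex; pose rs := [seq (s ^+ i)%g x | i <- iota 0 (size l).+1].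
have lt_neq i j : (i < j)%N -> (s ^+ i)%g x <> (s ^+ j)%g x.
  move=> ij e; apply: nex; exists (j - i)%N; first by rewrite subn_gt0.
  by apply: (@aut_inj (s ^+ i)%g); rewrite -autM -expgnDr subnKC ?(ltnW ij).
have urs : uniq rs.
  rewrite map_inj_in_uniq ?iota_uniq // => i j _ _ e.
  by case: (ltngtP i j) => // /lt_neq; rewrite e.
have := uniq_leq_size urs (_ : {subset rs <= l}).
rewrite size_map size_iota ltnn => h; suff : false by []; apply: h.
by move=> _ /mapP[i _ ->]; exact: hl.
Qed.

(** * Inertia at primes not above p *)

Section Tame.
Variables (P : prime_idealr O) (l : nat).
Hypotheses (pl : prime l) (lP : l%:R \in P).

(** A power of s fixes x, so a product of conjugates of the ratio is 1; its numerator and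
    denominator are in P exactly when a and b are, and [prufer] excludes that both are. *)
Lemma unit_ratio s x : (forall z, (oact s z \in P) = (z \in P)) ->
  exists a b : O, [/\ a \notin P, b \notin P & s x * ival b = x * ival a].
Proof.
move=> sP; have [->|x0] := eqVneq x 0.
  by exists 1, 1; rewrite idealr1 rmorph0 !mul0r.
have [a [b [e nab]]] := prufer (s x / x) pl lP.
have {}e : s x * ival b = x * ival a by rewrite -e [RHS]mulrA [x * _]mulrC divfK.
have iter n : exists A B : O, [/\ (s ^+ n.+1)%g x * ival B = x * ival A,
    (A \in P) = (a \in P) & (B \in P) = (b \in P)].
  elim: n => [|n [A [B [h hA hB]]]]; first by exists a, b.
  exists (oact s A * a), (oact s B * b); rewrite !prime_idealrM !sP hA hB !orbb; split=> //.
  rewrite !ivalM !mulrA expgS autM [_ * ival (oact s B)](_ : _ = s x * ival (oact s A)).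
    by rewrite mulrAC e mulrAC.
  by rewrite -!rmorphM -h.
have [[//|n] _ hn] := aut_order s x.
have [A [B [h hA hB]]] := iter n.
have AB : A = B by apply: ival_inj; apply: (mulfI x0); rewrite -h hn.
by exists a, b; split=> //; apply/negP => h1; apply: nab; move: h1; rewrite -?hA -?hB AB.
Qed.

(* y is integral at P and congruent to n modulo P. *)
Definition residue_eq (y : algC) (n : O) : Prop := exists A B : O,
  [/\ B \notin P, A - n * B \in P & y * ival B = ival A].

Lemma residue_eqD y z n m : residue_eq y n -> residue_eq z m -> residue_eq (y + z) (n + m).
Proof.
move=> [A [B [hB h e]]] [A' [B' [hB' h' e']]].
exists (A * B' + A' * B), (B * B'); split.
- by rewrite prime_idealrM negb_or hB hB'.
- have -> : A * B' + A' * B - (n + m) * (B * B') = B' * (A - n * B) + B * (A' - m * B').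
    by ring.
  by rewrite rpredD // idealMr.
by rewrite rmorphD !rmorphM /= -e -e'; ring.
Qed.

(* Let t be a Frobenius element at P, with exponent N, and M = N - 1. The ratio
   u = s x / x is a unit at P and t(u) = u * s(w) / w with w = t x / x, so u^N = u
   and u^M = 1 modulo P. If s' = s^M moved x, then (s'^n x - x) / (s' x - x) would
   be n modulo P for all n; but it vanishes when n is a suitable power of p, which
   is not in P. *)
Lemma tame_inertia (p : nat) (k K : subfield) s : number_field k -> p%:R \notin P ->
  inertial P s ->
  (forall t x, fixes k t -> x \in K -> s (t x) = t (s x)) ->
  (forall x, x \in K -> s x \in K) ->
  (forall x, x \in K -> exists r, (s ^+ (p ^ r))%g x = x) ->
  exists2 M, (0 < M)%N & forall x, x \in K -> (s ^+ M)%g x = x.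
Proof.
move=> k_nf pP sI comm sK tors.
have [t [N [N1 tk tP]]] := frobenius_exists pl lP k_nf.
have memX z n : (0 < n)%N -> (z ^+ n \in P) = (z \in P).
  case: n => // n _; elim: n => [|n IH]; first by rewrite expr1.
  by rewrite exprS prime_idealrM IH orbb.
have tmem z : (oact t z \in P) = (z \in P).
  by rewrite -(memX z N) ?(ltnW N1) // -[oact t z](subrK (z ^+ N)) rpredDl.
have smem z : (oact s z \in P) = (z \in P) by exact: inertial_mem.
pose M := N.-1.
have NM : N = M.+1 by rewrite prednK // ltnW.
exists M; first by rewrite -ltnS -NM.
have eqP_mul (z1 z2 z3 z4 : O) : z1 - z2 \in P -> z3 - z4 \in P -> z1 * z3 - z2 * z4 \in P.
  move=> h1 h2; have -> : z1 * z3 - z2 * z4 = z3 * (z1 - z2) + z2 * (z3 - z4).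
    by rewrite !mulrBr mulrC [z3 * z2]mulrC addrA subrK.
  by rewrite rpredD // idealMr.
have refl (z : O) : z - z \in P by rewrite subrr rpred0.
have eqP_X (z1 z2 : O) n : z1 - z2 \in P -> z1 ^+ n - z2 ^+ n \in P.
  by move=> h; elim: n => [|n IH]; rewrite ?expr0 // !exprS; exact: eqP_mul.
(* The ratio u need not be integral, so it is kept as a / b with b outside P, and u^M = 1 reads a^M
   = b^M modulo P. *)
have key x : x \in K -> x != 0 -> exists a b : O,
    [/\ b \notin P, a ^+ M - b ^+ M \in P & s x * ival b = x * ival a].
  move=> xK x0.
  have [a [b [aP bP e1]]] := unit_ratio x smem.
  have [c [d [cP dP e2]]] := unit_ratio x tmem.
  exists a, b; split=> //.
  have w0 : s (t x) != 0 by rewrite !fmorph_eq0.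
  have f1 : s (t x) * (ival (oact s d) * ival b) = x * (ival a * ival (oact s c)).
    by rewrite mulrA -rmorphM e2 rmorphM mulrAC e1 -mulrA.
  have f2 : s (t x) * (ival (oact t b) * ival d) = x * (ival c * ival (oact t a)).
    by rewrite comm // mulrA -rmorphM e1 rmorphM mulrAC e2 -mulrA.
  have f3 : a * oact s c * (oact t b * d) = c * oact t a * (oact s d * b).
    apply: ival_inj; apply: (mulfI x0).
    transitivity (s (t x) * (ival (oact s d) * ival b) * (ival (oact t b) * ival d)).
      by rewrite f1 !ivalM; ring.
    transitivity (s (t x) * (ival (oact t b) * ival d) * (ival (oact s d) * ival b)); first by ring.
    by rewrite f2 !ivalM; ring.
  have g1 : a * oact s c * (oact t b * d) - a * c * (b ^+ N * d) \in P.
    by rewrite !eqP_mul // tP.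
  have g2 : c * oact t a * (oact s d * b) - c * a ^+ N * (d * b) \in P.
    by rewrite !eqP_mul // tP.
  have : (c * d * (a * b)) * (a ^+ M - b ^+ M) \in P.
    have -> : (c * d * (a * b)) * (a ^+ M - b ^+ M) =
        (a * oact s c * (oact t b * d) - a * c * (b ^+ N * d))
        - (c * oact t a * (oact s d * b) - c * a ^+ N * (d * b)).
      by rewrite f3 NM !exprS; ring.
    by rewrite rpredB.
  by rewrite !prime_idealrM (negPf aP) (negPf bP) (negPf cP) (negPf dP).
pose s' := (s ^+ M)%g.
have s'K x n : x \in K -> (s ^+ n)%g x \in K.
  by move=> xK; elim: n => // n IH; rewrite expgS autM sK.
have key' x : x \in K -> x != 0 -> residue_eq (s' x / x) 1.
  move=> xK x0; have [a [b [bP h e]]] := key x xK x0.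
  have it n : exists A B : O, [/\ A - a ^+ n \in P, B - b ^+ n \in P
      & (s ^+ n)%g x * ival B = x * ival A].
    elim: n => [|n [A [B [hA hB e']]]].
      by exists 1, 1; rewrite !expr0 rmorph1 !mulr1.
    have sA : oact s A - a ^+ n \in P by rewrite -(subrKA A) rpredD.
    have sB : oact s B - b ^+ n \in P by rewrite -(subrKA B) rpredD.
    exists (a * oact s A), (b * oact s B); rewrite !exprS !eqP_mul //; split=> //.
    rewrite !ivalM expgS autM mulrA mulrAC -rmorphM e' rmorphM.
    by rewrite mulrAC e -mulrA.
  have [A [B [hA hB e']]] := it M.
  exists A, B; split.
  - apply: contra bP => BP; rewrite -(memX b M) -1?ltnS -?NM //.
    by rewrite -[_ ^+ _](subKr B) rpredB.
  - rewrite mul1r -(subrKA (a ^+ M)) rpredD // -(subrKA (b ^+ M)) rpredD //.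
    by rewrite -opprB rpredN.
  - by rewrite mulrAC e' mulrAC divff ?mul1r.
move=> x xK; apply/eqP; rewrite -subr_eq0; set y := s' x - x; apply/negPn/negP => y0.
have x0 : x != 0 by apply: contra y0 => /eqP x0; rewrite /y x0 rmorph0 subrr.
have yK : y \in K by rewrite rpredB // s'K.
have s'X n z : (s' ^+ n)%g z = (s ^+ (M * n))%g z by rewrite expgnA.
have key2 n : residue_eq ((s' ^+ n)%g y / y) 1.
  elim: n => [|n [A [B [hB h e]]]].
    exists 1, 1; rewrite idealr1 mul1r subrr rpred0; split=> //.
    by rewrite aut1 divff // mul1r.
  have z0 : (s' ^+ n)%g y != 0 by rewrite fmorph_eq0.
  have zK : (s' ^+ n)%g y \in K by rewrite s'X s'K.
  have [A' [B' [hB' h' e']]] := key' _ zK z0.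
  exists (A' * A), (B' * B); split.
  - by rewrite prime_idealrM negb_or hB hB'.
  - by rewrite mul1r; apply: eqP_mul; [move: h' | move: h]; rewrite mul1r.
  - rewrite !ivalM -e -e' expgS autM [RHS]mulrACA; congr (_ * _).
    by rewrite mulrA divfK.
have [r hr] := tors x xK.
(* The sum of the n ratios s'^i(y) / y, each 1 modulo P, telescopes. *)
have sum n : residue_eq (((s' ^+ n)%g x - x) / y) n%:R.
  elim: n => [|n IH].
    exists 0, 1; rewrite idealr1 mul0r subrr rpred0; split=> //.
    by rewrite aut1 subrr !mul0r rmorph0.
  have -> : ((s' ^+ n.+1)%g x - x) / y = (s' ^+ n)%g y / y + ((s' ^+ n)%g x - x) / y.
    by rewrite -mulrDl expgSr autM [in RHS]/y rmorphB addrA subrK.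
  by rewrite -nat1r; exact: residue_eqD.
have [A [B [hB h e]]] := sum (p ^ r)%N.
have A0 : A = 0.
  apply: ival_inj; rewrite -e (_ : (s' ^+ (p ^ r))%g x = x) ?subrr ?mul0r ?rmorph0 //.
  by rewrite s'X mulnC expgnA aut_fixX.
move: h; rewrite A0 sub0r rpredN prime_idealrM (negPf hB) orbF.
case: (r) => [|r']; first by rewrite expn0 idealr1.
by rewrite natrX memX // (negPf pP).
Qed.
End Tame.

Definition agree_on (k : subfield) (P P' : prime_idealr O) : Prop :=
  forall z : O, ival z \in k -> (z \in P) = (z \in P').

(** If z is outside P, some power of z minus 1 lies in P, the residue field of k being finite; that
    difference also lies in P', which keeps z out of P'. *)
Lemma agree_on_sub (k : subfield) p (P P' : prime_idealr O) : number_field k -> prime p ->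
  p%:R \in P -> (forall z : O, ival z \in k -> z \in P -> z \in P') -> agree_on k P P'.
Proof.
move=> k_nf p_pr pP sub z zk; apply/idP/idP => [|zP']; first exact: sub.
have [f f0 hf] := residue_exponent p_pr pP k_nf.
have q1 : (1 < p ^ f)%N by rewrite -(exp1n f) ltn_exp2r ?prime_gt1.
have := hf z zk; rewrite -(prednK (ltnW q1)) exprS -{3}[z]mulr1 -mulrBr prime_idealrM.
case/orP => // h.
have := sub _ _ h; rewrite rmorphB rmorphXn rmorph1 /= => h'.
have {}h' := h' (rpredB (rpredX _ zk) (rpred1 _)).
have q2 : (0 < (p ^ f).-1)%N by rewrite -ltnS (prednK (ltnW q1)).
suff : (1 : O) \in P' by rewrite idealr1.
rewrite (_ : 1 = z ^+ (p ^ f).-1 - (z ^+ (p ^ f).-1 - 1)); last by rewrite subKr.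
by rewrite rpredB //; case: (_.-1) q2 => // n _; rewrite exprSr idealMr.
Qed.

(* Given d + 1 primes that are distinct on k there are elements e_j of k that are
   outside the j-th prime and inside the others; a primitive integral relation
   between the e_j would have all its coefficients divisible by p. *)
Lemma finitely_many_primes (k : subfield) p : number_field k -> prime p ->
  exists r (Ps : 'I_r -> prime_idealr O), (forall i, p%:R \in Ps i) /\
    forall P : prime_idealr O, p%:R \in P -> exists i, agree_on k P (Ps i).
Proof.
move=> k_nf p_pr; have [d hd] := nf_dependent k_nf.
apply: contrapT => nex.
have ext r : exists Ps : 'I_r -> prime_idealr O, (forall i, p%:R \in Ps i) /\
    forall i j, i != j -> ~ agree_on k (Ps i) (Ps j).
  elim: r => [|r [Ps [hp hne]]]; first by exists (fun i : 'I_0 => False_rect _ (notF (ltn_ord i))); split; case.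
  have [P [pP nP]] : exists P : prime_idealr O, p%:R \in P /\ forall i, ~ agree_on k P (Ps i).
    apply: contrapT => h; apply: nex; exists r, Ps; split=> // P pP.
    apply: contrapT => h'; apply: h; exists P; split=> // i hi; apply: h'; by exists i.
  exists (fun i => if unlift ord0 i is Some j then Ps j else P); split=> [i|i j].
    by case: unliftP.
  case: unliftP => [i' ->|->]; case: unliftP => [j' ->|->] //.
  - by rewrite (inj_eq lift_inj); exact: hne.
  - by move=> _ h; apply: (nP i') => z zk; rewrite h.
have [Ps [hp hne]] := ext d.+1.
have sep i j : i != j -> exists z : O, [/\ ival z \in k, z \in Ps i & z \notin Ps j].
  move=> ij; apply: contrapT => h; apply: (hne _ _ ij).
  apply: (agree_on_sub k_nf p_pr (hp i)) => z zk zi; apply: contrapT => /negP zj.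
  by apply: h; exists z.
pose x i j : O := if pselect (i != j) is left h then projT1 (cid (sep i j h)) else 1.
have xP i j : i != j -> [/\ ival (x i j) \in k, x i j \in Ps i & x i j \notin Ps j].
  by move=> ij; rewrite /x; case: pselect => // h; case: cid.
pose e j : O := \prod_(i | i != j) x i j.
have ek j : ival (e j) \in k.
  rewrite rmorph_prod rpred_prod // => i ij; by case: (xP _ _ ij).
have ei i j : i != j -> e j \in Ps i.
  by move=> ij; rewrite /e (bigD1 i) //= mulrC idealMr //; case: (xP _ _ ij).
have ej j : e j \notin Ps j.
  rewrite /e; elim/big_rec: _ => [|i z ij h]; first by rewrite idealr1.
  by rewrite prime_idealrM negb_or h andbT; case: (xP _ _ ij).
have [q [q0 sq eq0]] := hd (fun i => ival (e i)) ek.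
have [f [a [a0 Df hf]]] := primitive_scale q0.
have sum0 : \sum_(i < d.+1) (f`_i)%:~R * e i = 0.
  apply: ival_inj; rewrite rmorph_sum rmorph0 /=.
  have aC : ratr a != 0 :> algC by rewrite fmorph_eq0.
  apply: (mulfI aC); rewrite mulr0 -[RHS]eq0 mulr_sumr; apply: eq_bigr => i _.
  by rewrite rmorph_int mulrA Df coefZ coef_map rmorphM /= ratr_int.
have [i ni] := hf p p_pr.
have id : (i < d.+1)%N.
  rewrite ltnNge; apply: contra ni => le; have : q`_i == 0.
    by rewrite nth_default // (leq_trans sq).
  by rewrite Df coefZ coef_map mulf_eq0 (negPf a0) intr_eq0 => /eqP ->; rewrite dvdz0.
have : (f`_i)%:~R * e (Ordinal id) \in Ps (Ordinal id).
  move: sum0; rewrite (bigD1 (Ordinal id)) //= => /eqP; rewrite addr_eq0 => /eqP ->.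
  rewrite rpredN rpred_sum // => j ji; by rewrite idealMr // ei // eq_sym.
rewrite prime_idealrM (negPf (ej _)) orbF (int_mem_prime _ p_pr (hp _)).
exact/negP.
Qed.

(** * Unramified extensions *)

Section PermRep.
Variables (G : groupType) (T : choiceType) (act : G -> T -> T) (o : seq T).
Hypothesis act1 : forall x, act 1%g x = x.
Hypothesis actM : forall s t x, act (s * t)%g x = act s (act t x).

Definition stab (s : G) : Prop := forall x, x \in o -> act s x \in o.

Lemma actK s : cancel (act s) (act s^-1%g).
Proof. by move=> x; rewrite -actM mulVg act1. Qed.
Lemma actVK s : cancel (act s^-1%g) (act s).
Proof. by move=> x; rewrite -actM mulgV act1. Qed.

Lemma stabM s t : stab s -> stab t -> stab (s * t)%g.
Proof. by move=> hs ht x xo; rewrite actM; apply/hs/ht. Qed.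

Lemma stabV s : stab s -> stab s^-1%g.
Proof.
move=> hs x; rewrite -!(mem_undup o) => xo.
have us : uniq (map (act s) (undup o)) by rewrite (map_inj_uniq (can_inj (actK s))) undup_uniq.
have sub : {subset map (act s) (undup o) <= undup o}.
  by move=> _ /mapP[y yo ->]; rewrite mem_undup hs // -mem_undup.
have [] := uniq_min_size us sub _; first by rewrite size_map.
move=> _ eqm; move: xo; rewrite -eqm => /mapP[y yo ->].
by rewrite actK.
Qed.

Definition rep_fun (s : G) (x : seq_sub o) : seq_sub o := insubd x (act s^-1%g (val x)).
Definition rep (s : G) : {perm seq_sub o} :=
  if pselect (injective (rep_fun s)) is left h then perm h else 1%g.

(* rep s is the permutation induced by the inverse of s, so that rep is a
   morphism for the product of {perm _}, which composes on the right. *)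
Lemma repE s x : stab s -> val (rep s x) = act s^-1%g (val x).
Proof.
move=> /stabV hs; have e y : val (rep_fun s y) = act s^-1%g (val y).
  by rewrite /rep_fun val_insubd hs // ssvalP.
rewrite /rep; case: pselect => [h|[]]; first by rewrite permE.
move=> y z /(congr1 val); rewrite !e => /(can_inj (actVK s)); exact: val_inj.
Qed.

Lemma repM s t : stab s -> stab t -> rep (s * t)%g = (rep s * rep t)%g.
Proof.
move=> hs ht; apply/permP => x; apply: val_inj.
by rewrite permM !repE //; [rewrite invgM actM | exact: stabM].
Qed.

Lemma stab1 : stab 1%g. Proof. by move=> x; rewrite act1. Qed.

Lemma rep1 : rep 1%g = 1%g.
Proof. by apply/permP => x; apply: val_inj; rewrite repE ?invg1 ?act1 ?perm1 //; exact: stab1. Qed.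

Lemma repV s : stab s -> rep s^-1%g = (rep s)^-1%g.
Proof.
move=> hs; apply: (@mulIg _ (rep s)); rewrite mulVg -repM //; last exact: stabV.
by rewrite mulVg rep1.
Qed.

Lemma stabX s n : stab s -> stab (s ^+ n)%g.
Proof.
by move=> hs; elim: n => [|n IH]; rewrite ?expgS; [exact: stab1 | exact: stabM].
Qed.

Lemma repX s n : stab s -> rep (s ^+ n)%g = (rep s ^+ n)%g.
Proof.
move=> hs; elim: n => [|n IH]; first exact: rep1.
by rewrite !expgS repM ?IH //; exact: stabX.
Qed.

Lemma rep_eq1 s : stab s -> rep s = 1%g <-> forall x, x \in o -> act s x = x.
Proof.
move=> hs; split=> [h x xo|h].
  have := congr1 (fun u : {perm seq_sub o} => val (u (SeqSub xo))) h.
  by rewrite repE // perm1 /= => e; rewrite -{1}e actVK.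
apply/permP => x; apply: val_inj; rewrite repE // perm1.
by rewrite -{1}(h (val x)) ?ssvalP // actK.
Qed.

Lemma rep_eq s t : stab s -> stab t -> rep s = rep t <-> forall x, x \in o -> act s x = act t x.
Proof.
move=> hs ht; have h1 := stabM (stabV ht) hs; split=> [e x xo|h].
  have /rep_eq1 -/(_ h1)/(_ x xo) : rep (t^-1 * s)%g = 1%g.
    by rewrite repM ?repV ?e ?mulVg //; exact: stabV.
  by rewrite actM => {2}<-; rewrite actVK.
have : rep (t^-1 * s)%g = 1%g by apply/rep_eq1 => // x xo; rewrite actM h // actK.
rewrite repM ?repV //; last exact: stabV.
by move/(congr1 (mulg (rep t))); rewrite mulKVg mulg1.
Qed.

Section Image.
Variable H : set G.
Hypotheses (Hg : is_subgroup H) (Hstab : forall s, H s -> stab s).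

Definition rep_set : {set {perm seq_sub o}} := [set u | `[< exists2 s, H s & rep s = u >]]%SET.

Lemma rep_setP u : reflect (exists2 s, H s & rep s = u) (u \in rep_set).
Proof. by rewrite inE; exact: asboolP. Qed.

Lemma mem_rep_set s : H s -> rep s \in rep_set.
Proof. by move=> Hs; apply/rep_setP; exists s. Qed.

Lemma subgroupV s : H s -> H s^-1%g.
Proof. by case: Hg => H1 HM Hs; rewrite -[(s^-1)%g]mul1g; exact: HM. Qed.
Lemma subgroupM s t : H s -> H t -> H (s * t)%g.
Proof. by case: Hg => H1 HM Hs Ht; rewrite -[t]invgK; apply: HM => //; exact: subgroupV. Qed.

Lemma rep_group_set : group_set rep_set.
Proof.
apply/group_setP; split; first by apply/rep_setP; exists 1%g; [case: Hg | exact: rep1].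
move=> _ _ /rep_setP[s Hs <-] /rep_setP[t Ht <-].
by rewrite -repM ?mem_rep_set //; [exact: subgroupM | exact: Hstab | exact: Hstab].
Qed.
Definition rep_group := Group rep_group_set.

(** By Cauchy's theorem a prime divisor q of the order is the order of some [rep s]. As o is finite,
    one power of p makes s trivial on all of it, so q = p. *)
Lemma rep_pgroup p : prime p ->
  (forall s, H s -> forall x, x \in o -> exists n, act (s ^+ (p ^ n))%g x = x) ->
  (p.-group rep_group)%g.
Proof.
move=> p_pr tors; apply/pgroupP => q q_pr /(Cauchy q_pr)[u].
case/rep_setP => s Hs <- ord.
have mono x m n : (m <= n)%N -> act (s ^+ (p ^ m))%g x = x -> act (s ^+ (p ^ n))%g x = x.
  move=> /subnK <- h; rewrite addnC expnD expgnA.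
  elim: (p ^ (n - m))%N => [|k IH]; first exact: act1.
  by rewrite expgS actM IH.
have [n hn] : exists n, forall x, x \in o -> act (s ^+ (p ^ n))%g x = x.
  have := tors s Hs; elim: (o) => [|x l IH] h; first by exists 0%N.
  have [m hm] := h x (mem_head _ _).
  have [|n hn] := IH; first by move=> y yl; apply: h; rewrite inE yl orbT.
  exists (maxn m n) => y; rewrite inE => /orP[/eqP ->|yl].
    by apply: mono hm; exact: leq_maxl.
  by apply: mono (hn y yl); exact: leq_maxr.
have e1 : (rep s ^+ (p ^ n))%g = 1%g.
  by rewrite -repX; [apply/rep_eq1 => //; exact/stabX/Hstab | exact: Hstab].
have : (q %| p ^ n)%N by rewrite -ord order_dvdn e1.
by rewrite (Euclid_dvdX _ _ q_pr) dvdn_prime2 // => /andP[/eqP -> _]; rewrite inE.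
Qed.
End Image.
End PermRep.

Lemma orbit_closure (G : groupType) (T : choiceType) (act : G -> T -> T) (H : set G) (l : seq T) :
  (forall s t x, act (s * t)%g x = act s (act t x)) -> (forall x, act 1%g x = x) ->
  is_subgroup H -> (forall x, exists m : seq T, forall s, H s -> act s x \in m) ->
  exists o : seq T, {subset l <= o} /\ forall s, H s -> stab act o s.
Proof.
move=> actM act1 Hg orb; elim: l => [|x l [o [lo ho]]]; first by exists [::].
have [m hm] := orb x.
exists ([seq y <- m | `[< exists2 s, H s & act s x = y >]] ++ o); split.
  move=> y; rewrite inE mem_cat mem_filter => /orP[/eqP ->|/lo ->]; last by rewrite orbT.
  have H1 : H 1%g by case: Hg.
  by rewrite -{3}(act1 x) hm // andbT; apply/orP; left; apply/asboolP; exists 1%g.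
move=> s Hs y; rewrite !mem_cat !mem_filter => /orP[/andP[/asboolP[t Ht <-] _]|yo]; apply/orP.
  have Hst := subgroupM Hg Hs Ht.
  by left; rewrite -actM hm // andbT; apply/asboolP; exists (s * t)%g.
by right; exact: ho.
Qed.

(** An open subgroup N contains the pointwise stabiliser of a finite stable set o, so its index is
    that of its image in the permutations of o, where the whole image is a p-group. *)
Lemma torsion_is_pro p (F E : subfield) : prime p ->
  (forall (s : Defs.Gal F E) x, exists n, (s ^+ (p ^ n))%g x = x) -> is_pro p F E.
Proof.
move=> p_pr tors N Nopen [Ng Nn].
have [l hl] := Nopen 1%g (proj1 Ng).
pose act (s : Defs.Gal F E) x := s x.
have act1 x : act 1%g x = x by [].
have actM s t x : act (s * t)%g x = act s (act t x) by [].
have HT : is_subgroup (fun _ : Defs.Gal F E => True) by [].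
have [|o [lo ho]] := @orbit_closure _ _ act _ l actM act1 HT.
  by move=> x; have [m hm] := gal_conjugates F x; exists m => s _; exact: hm.
have st s : stab act o s by exact: ho.
pose A := rep_group act1 actM HT ho.
have NA : forall s, N s -> stab act o s by [].
pose B := rep_group act1 actM Ng NA.
have pA : (p.-group A)%g by apply: rep_pgroup => // s _ x _; exact: tors.
have sBA : B \subset A.
  by apply/fintype.subsetP => _ /rep_setP[s _ <-]; apply/rep_setP; exists s.
have NB s : (rep act o s \in B) <-> N s.
  split=> [/rep_setP[t Nt e]|Ns]; last by apply/rep_setP; exists s.
  have : N (t^-1 * s)%g.
    apply: hl => x /lo xo; rewrite gal_mulE.
    have := (rep_eq act1 actM (st t) (st s)).1 e x xo; rewrite /act => <-.
    by rewrite -gal_mulE mulVg.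
  by move=> h; rewrite -(mulKVg t s); exact: (subgroupM Ng).
have pidx : (p.-nat #|A : B|)%g by exact: pnat_dvd (dvdn_indexg _ _) pA.
have [n en] := p_natP pidx; exists n.
have cL : #|lcosets B A| = (p ^ n)%N by rewrite card_lcosets.
have mL s : (rep act o s *: B)%g \in lcosets B A.
  by apply/lcosetsP; exists (rep act o s); first exact: mem_rep_set.
rewrite -cL; exists (fun s => enum_rank_in (mL 1%g) (rep act o s *: B)%g); split.
  move=> i; have /lcosetsP[u uA e] := enum_valP i.
  have [s _ es] : exists2 s, True & rep act o s = u by apply/rep_setP.
  rewrite -es in e; exists s; apply: enum_val_inj; rewrite enum_rankK_in // e.
move=> s t; split=> [|h].
  move/(congr1 enum_val); rewrite !enum_rankK_in // => e.
  by apply/NB; rewrite repM ?repV // -mem_lcoset e lcoset_refl.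
congr enum_rank_in; apply/lcoset_eqP; rewrite mem_lcoset -repV // -repM //.
by apply/NB; rewrite -(invgK (t^-1 * s)%g) invgM invgK; exact: (subgroupV Ng).
Qed.

(** * Unramified extensions through automorphisms of [algC] *)

Definition normal_ext (F E : subfield) : Prop :=
  {subset F <= E} /\ forall s, fixes F s -> forall x, x \in E -> s x \in E.

Section Restrict.
Variables (F E : subfield) (nE : normal_ext F E) (t : aut) (tF : fixes F t).

Definition aut_res_fun (x : fsub E) : fsub E := MkFsub (nE.2 t tF _ (fvalP x)).
Fact aut_res_subproof :
  [/\ zmod_morphism aut_res_fun, monoid_morphism aut_res_fun, bijective aut_res_fun
    & forall x, fval x \in F -> aut_res_fun x = x].
Proof.
split=> [x y|||x xF].
- by apply: val_inj; rewrite /= rmorphB.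
- by split=> [|x y]; apply: val_inj; rewrite /= ?rmorph1 ?rmorphM.
- exists (fun x : fsub E => MkFsub (nE.2 t^-1%g (fixesV tF) _ (fvalP x))) => x; apply: val_inj.
    exact: autK.
  exact: autVK.
- by apply: val_inj; rewrite /= tF.
Qed.
Definition aut_res : Gal F E := MkGal aut_res_subproof.
Lemma aut_resE x : fval (aut_res x) = t (fval x). Proof. by []. Qed.
End Restrict.

Lemma gal_extend (F E : subfield) (s : Gal F E) : {subset F <= E} ->
  exists t : aut, fixes F t /\ forall x, t (fval x) = fval (s x).
Proof.
move=> sFE; apply: (@aut_extend F E ((@fval E) \o s)%FUN sFE) => x xF /=.
by rewrite gal_fix.
Qed.

Lemma normal_ext_full (F : subfield) : normal_ext F full.
Proof. by split=> [x _|s _ x _]. Qed.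

Lemma is_galois_normal (F E : subfield) : is_galois F E -> normal_ext F E.
Proof.
move=> gE; have [sFE _] := gE; split=> // t tF x xE.
have sEf : {subset E <= full} by move=> y _.
have [y /(congr1 (@fval _)) e] := galois_stable sEf (aut_res (normal_ext_full F) tF) (MkFsub xE) gE.
by rewrite (_ : t x = fval y) ?fvalP.
Qed.

Lemma normal_is_galois (F E : subfield) : normal_ext F E -> is_galois F E.
Proof.
move=> nE; split=> [|x hx]; first by case: nE.
apply: fixed_mem => t tF.
exact: (congr1 (@fval _) (hx (aut_res nE tF))).
Qed.

Definition aut_abelian (F E : subfield) : Prop :=
  forall s t, fixes F s -> fixes F t -> forall x, x \in E -> s (t x) = t (s x).

Definition aut_torsion (p : nat) (F E : subfield) : Prop :=
  forall s, fixes F s -> forall x, x \in E -> exists n, (s ^+ (p ^ n))%g x = x.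

Definition ramified_at (P : prime_idealr O) (s : aut) : Prop :=
  nonzero_ideal P /\ inertial P s.

Definition complex_conj (s : aut) : Prop :=
  exists i : aut, forall x, i (s x) = Num.conj (i x).

Definition ramified (s : aut) : Prop :=
  (exists P, ramified_at P s) \/ complex_conj s.

Definition aut_unramified (F E : subfield) : Prop :=
  forall s, fixes F s -> ramified s -> fixes E s.

(* This is unram_abelian_pro p F E, expressed by automorphisms of algC. *)
Definition unr (p : nat) (F E : subfield) : Prop :=
  [/\ normal_ext F E, aut_abelian F E, aut_torsion p F E & aut_unramified F E].

Lemma aut_resX (F E : subfield) (nE : normal_ext F E) s (sF : fixes F s) n x :
  fval ((aut_res nE sF ^+ n)%g x) = (s ^+ n)%g (fval x).
Proof. by elim: n x => // n IH x; rewrite !expgS gal_mulE autM aut_resE IH. Qed.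

Lemma gal_extX (F E : subfield) (s : Gal F E) (t : aut) n x :
  (forall x, t (fval x) = fval (s x)) -> fval ((s ^+ n)%g x) = (t ^+ n)%g (fval x).
Proof. by move=> h; elim: n x => // n IH x; rewrite !expgS gal_mulE autM -h IH. Qed.

Lemma unram_unr p (F E : subfield) : unram_abelian_pro p F E -> unr p F E.
Proof.
case=> gE abE proE finE infE; have nE := is_galois_normal gE.
have sFE : {subset F <= E} by case: nE.
split=> //.
- move=> s t sF tF x xE.
  have := congr1 (fun u : Gal F E => fval (u (MkFsub xE))) (abE (aut_res nE sF) (aut_res nE tF)).
  by [].
- move=> s sF x xE; have [n hn] := gal_pro_torsion abE proE (aut_res nE sF) (MkFsub xE).
  by exists n; have := congr1 (@fval _) hn; rewrite aut_resX.
move=> s sF [[P [[z zP z0] sP]]|[i hi]] x xE.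
  have [l l_pr lP] := residue_char zP z0.
  have [Q hQ] := prime_restrict E P.
  suff : aut_res nE sF = 1%g by move/(congr1 (fun u : Gal F E => fval (u (MkFsub xE)))).
  apply: (finE Q).
    exists l%:R; first by rewrite hQ rmorph_nat.
    apply/eqP => /(congr1 (@ival E)); rewrite rmorph_nat rmorph0 => /eqP.
    by rewrite Num.Theory.pnatr_eq0; case: l l_pr {lP}.
  move=> y; have yE : s (ival y) - ival y \in E.
    by rewrite rpredB ?nE.2 //; exact: (ival_sub y).
  have h : ival (oact s (up y) - up y) \in E by [].
  exists (down h); first by rewrite hQ downK; exact: sP.
  by [].
suff : aut_res nE sF = 1%g by move/(congr1 (fun u : Gal F E => fval (u (MkFsub xE)))).
by apply: (infE ((i : {rmorphism algC -> algC}) \o (@fval E))%FUN) => y /=; exact: hi.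
Qed.

(** Ramification in Gal(E/F) has to be realised in [algC]: an inertial element lifts to an inertial
    automorphism at a prime lying over, and an embedding of E extends to an automorphism j. *)
Lemma unr_unram p (F E : subfield) : prime p -> unr p F E -> unram_abelian_pro p F E.
Proof.
move=> p_pr [nE abE torE ramE]; have sFE : {subset F <= E} by case: nE.
split.
- exact: normal_is_galois.
- move=> s t; apply: gal_eq => x; apply: val_inj => /=.
  have [s' [sF hs]] := gal_extend s sFE; have [t' [tF ht]] := gal_extend t sFE.
  by rewrite -!hs -!ht -!hs; apply: abE => //; exact: fvalP.
- apply: torsion_is_pro => // s x; have [t [tF ht]] := gal_extend s sFE.
  have [n hn] := torE t tF _ (fvalP x); exists n; apply: val_inj.
  by rewrite /= (gal_extX _ _ ht).
- move=> Q [z zQ z0] s sQ; have [t [tF ht]] := gal_extend s sFE.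
  have [P hP] := lying_over Q.
  have [y yE|t' t'P t'E] := @inertial_lift P E t.
    have [w wQ ew] := sQ (down yE).
    rewrite (_ : _ - _ = up w) ?hP //; apply: ival_inj.
    by rewrite /= ew -ht.
  apply: gal_eq => x; apply: val_inj; rewrite /= -ht -t'E ?fvalP //.
  apply: ramE (fvalP x).
    by move=> y yF; rewrite t'E ?tF //; exact: sFE.
  left; exists P; split=> //; exists (up z); first by rewrite hP.
  by apply: contra z0 => /eqP h; apply/eqP/ival_inj/(congr1 (@ival _) h).
- move=> i s hi.
  have [x|x xQ|j [_ hj]] := @aut_extend rat_subfield E i.
  + by move=> /CratP[a ->]; exact: rpred_rat.
  + have /CratP[a ea] := xQ.
    have -> : x = ratr a by apply: (fmorph_inj (@fval E)); apply: (etrans ea); rewrite fmorph_rat.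
    by rewrite !fmorph_rat.
  (* Complex conjugation transported by j; it restricts to s on E. *)
  pose t := (j^-1 * aut_of Num.conj * j)%g.
  have tE x : t (fval x) = fval (s x).
    by rewrite /t autM autM hj (_ : aut_of Num.conj (i x) = j (fval (s x))) ?autK // hj hi.
  apply: gal_eq => x; apply: val_inj; rewrite /= -tE.
  apply: ramE (fvalP x).
    by move=> y yF; rewrite (tE (MkFsub (sFE _ yF))) gal_fix.
  by right; exists j => y; rewrite /t !autM autVK.
Qed.

(** A property passes from the unramified extensions to their compositum [max_unram] once the
    elements that have it form a subfield. The subfields below encode equality of two automorphisms,
    stability and p-power torsion. *)
Fact eq_sub_closed (f g : aut) : GRing.divring_closed [pred x | f x == g x].
Proof.
split=> [|x y|x y]; rewrite !inE; first by rewrite !rmorph1.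
  by move=> /eqP hx /eqP hy; rewrite !rmorphB /= hx hy.
by move=> /eqP hx /eqP hy; rewrite !fmorph_div /= hx hy.
Qed.
Definition eq_sub f g := MkSubfield (eq_sub_closed f g).
Lemma eq_subP f g x : (x \in eq_sub f g) <-> f x = g x.
Proof. by split=> /eqP. Qed.

Fact preim_sub_closed (s : aut) (E : subfield) : GRing.divring_closed [pred x | s x \in E].
Proof.
split=> [|x y|x y]; rewrite !inE ?rmorph1 ?rpred1 //.
  by rewrite rmorphB; exact: rpredB.
by rewrite fmorph_div; exact: rpred_div.
Qed.
Definition preim_sub s E := MkSubfield (preim_sub_closed s E).
Lemma preim_subE s E x : (x \in preim_sub s E) = (s x \in E).
Proof. by []. Qed.

Lemma aut_fix_leq p (s : aut) x m n : (m <= n)%N ->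
  (s ^+ (p ^ m))%g x = x -> (s ^+ (p ^ n))%g x = x.
Proof. by move=> /subnK <- h; rewrite addnC expnD expgnA aut_fixX. Qed.

Fact tors_sub_closed p (s : aut) :
  GRing.divring_closed [pred x | `[< exists n, (s ^+ (p ^ n))%g x = x >]].
Proof.
split=> [|x y /asboolP[m hm] /asboolP[n hn]|x y /asboolP[m hm] /asboolP[n hn]]; apply/asboolP.
- by exists 0%N; exact: rmorph1.
- exists (maxn m n).
  by rewrite rmorphB /= (aut_fix_leq (leq_maxl m n)) // (aut_fix_leq (leq_maxr m n)).
- exists (maxn m n).
  by rewrite fmorph_div /= (aut_fix_leq (leq_maxl m n)) // (aut_fix_leq (leq_maxr m n)).
Qed.
Definition tors_sub p s := MkSubfield (tors_sub_closed p s).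
Lemma tors_subP p s x : (x \in tors_sub p s) <-> exists n, (s ^+ (p ^ n))%g x = x.
Proof. by split=> /asboolP. Qed.

Section Max.
Variables (p : nat) (p_pr : prime p).
Local Notation L := (max_unram p).

Lemma unr_max (F E : subfield) : unr p F E -> {subset E <= L F}.
Proof. by move=> h; apply: max_unram_sub; exact: unr_unram. Qed.

Lemma max_unr_le (F : subfield) (K : subfield) : (forall E : subfield, unr p F E -> {subset E <= K}) -> {subset L F <= K}.
Proof.
move=> h x /asboolP; apply=> y [E /unram_unr hE yE]; exact: (h E hE).
Qed.

Lemma unr_refl (F : subfield) : unr p F F.
Proof.
split.
- by split=> // s sF x xF; rewrite sF.
- by move=> s t sF tF x xF; rewrite !(sF, tF).
- by move=> s sF x xF; exists 0%N; rewrite expn0 expg1 sF.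
- by [].
Qed.

Lemma max_unr_base (F : subfield) : {subset F <= L F}.
Proof. exact: unr_max (unr_refl F). Qed.

Lemma max_unr (F : subfield) : unr p F (L F).
Proof.
split.
- split; first exact: max_unr_base.
  move=> s sF x xL; rewrite -preim_subE; move: x xL.
  apply: max_unr_le => E hE x xE; rewrite preim_subE; apply: (unr_max hE).
  by have [[_ h] _ _ _] := hE; exact: h.
- move=> s t sF tF x xL; apply/(eq_subP (s * t)%g (t * s)%g); move: x xL.
  apply: max_unr_le => E [_ abE _ _] x xE.
  by apply/eq_subP; rewrite !autM; exact: abE.
- move=> s sF x xL; apply/tors_subP; move: x xL.
  by apply: max_unr_le => E [_ _ tE _] x xE; apply/tors_subP; exact: tE.
- move=> s sF sram x xL; rewrite -[RHS](aut1 x); apply/eq_subP; move: x xL.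
  by apply: max_unr_le => E [_ _ _ uE] x xE; apply/eq_subP; rewrite aut1 (uE s).
Qed.

Lemma prime_preim (P : prime_idealr O) (s : aut) :
  exists P' : prime_idealr O, forall z, (z \in P') = (oact s z \in P).
Proof.
pose Q : pred O := fun x => oact s x \in P.
have mQ x : (x \in (Q : {pred O})) = (oact s x \in P) by [].
have Q1 : idealr_closed (Q : {pred O}).
  split=> [||a u v]; rewrite !mQ ?rmorph0 ?rpred0 ?rmorph1 ?idealr1 // => hu hv.
  by rewrite rmorphD rmorphM rpredD // idealMr.
have Q2 : prime_idealr_closed (Q : {pred O}).
  by move=> u v; rewrite !mQ rmorphM prime_idealrM.
pose m1 := isIdealr.Build O Q Q1.
pose m2 := isPrimeIdealrClosed.Build O Q Q2.
by exists (HB.pack_for (prime_idealr O) Q m1 m2 : prime_idealr O).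
Qed.

Lemma oactB s (x y : O) : oact s (x - y) = oact s x - oact s y.
Proof. exact: rmorphB. Qed.

Lemma inertial_conj (P P' : prime_idealr O) (s t : aut) :
  (forall z, z \in P -> oact t z \in P') -> inertial P s -> inertial P' (t * s * t^-1)%g.
Proof.
move=> h hs z; have -> : oact (t * s * t^-1)%g z - z = oact t (oact s (oact t^-1%g z) - oact t^-1%g z).
  by rewrite oactB oactVK -!oactM.
exact: h.
Qed.

Lemma ramified_conj s t : ramified s -> ramified (t * s * t^-1)%g.
Proof.
move=> [[P [[z zP z0] sP]]|[i hi]]; [left | right].
  have [P' hP'] := prime_preim P t^-1%g; exists P'; split.
    exists (oact t z); first by rewrite hP' oactK.
    by apply: contra z0 => /eqP h; rewrite -(oactK t z) h rmorph0.
  by apply: inertial_conj sP => y yP; rewrite hP' oactK.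
by exists (i * t^-1)%g => x; rewrite !autM autK hi.
Qed.

(** An automorphism s over k stabilises K, and conjugation preserves ramified elements, so s carries
    an unramified extension E of K to another one, written [preim_sub s^-1 E]. *)
Lemma max_unr_normal (k K : subfield) : normal_ext k K -> normal_ext k (L K).
Proof.
move=> nK; have [skK stK] := nK; split=> [x /skK|s sk x xL]; first exact: max_unr_base.
rewrite -preim_subE; move: x xL; apply: max_unr_le => E [nE abE tE uE].
suff h : unr p K (preim_sub s^-1%g E).
  by move=> x xE; rewrite preim_subE; apply: (unr_max h); rewrite preim_subE autK.
have [sKE stE] := nE.
have sVK x : x \in K -> s^-1%g x \in K by apply: stK; exact: fixesV.
have cK t : fixes K t -> fixes K (s^-1 * t * s)%g.
  by move=> tK x xK; rewrite !autM tK ?autK // stK.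
have cE (t : aut) x : s^-1%g (t x) = (s^-1 * t * s)%g (s^-1%g x) by rewrite !autM autVK.
split.
- split=> [x xK|t tK x]; rewrite !preim_subE; first by apply/sKE/sVK.
  by rewrite cE; apply: stE; exact: cK.
- move=> t u tK uK x; rewrite preim_subE => xE; apply: (@aut_inj s^-1%g).
  by rewrite !cE abE // ; [exact: cK | exact: cK].
- move=> t tK x; rewrite preim_subE => xE; have [n hn] := tE _ (cK t tK) _ xE.
  exists n; apply: (@aut_inj s^-1%g); rewrite -[RHS]hn.
  elim: (p ^ n)%N => [|m IH]; first by [].
  by rewrite !expgS autM cE IH -autM.
- move=> t tK tr x; rewrite preim_subE => xE; apply: (@aut_inj s^-1%g).
  rewrite cE uE //; first exact: cK.
  by have := ramified_conj s^-1%g tr; rewrite invgK.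
Qed.

(** Base change: the compositum [C] of E and K is again unramified abelian pro-p over K. *)
Lemma max_unr_mono (F K : subfield) : {subset F <= K} -> {subset L F <= L K}.
Proof.
move=> sFK; apply: max_unr_le => E [[sFE stE] abE tE uE].
pose C := gen_subfield (fun x => x \in E \/ x \in K).
have Cmin (K' : subfield) : {subset E <= K'} -> {subset K <= K'} -> {subset C <= K'}.
  by move=> h1 h2 x /asboolP; apply=> y [/h1|/h2].
have EC : {subset E <= C} by move=> x xE; apply/asboolP => K' h; apply: h; left.
have KC : {subset K <= C} by move=> x xE; apply/asboolP => K' h; apply: h; right.
have FF s : fixes K s -> fixes F s by move=> sK x /sFK; exact: sK.
suff hC : unr p K C by move=> x /EC; exact: unr_max.
split.
- split=> // s sK x xC; rewrite -preim_subE; move: x xC; apply: Cmin => x xE; rewrite preim_subE.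
    by apply/EC/stE => //; exact: FF.
  by rewrite sK //; exact: KC.
- move=> s t sK tK x xC; apply/(eq_subP (s * t)%g (t * s)%g); move: x xC.
  apply: Cmin => x xE; apply/eq_subP; rewrite !autM; last by rewrite tK // sK // tK.
  by apply: abE => //; exact: FF.
- move=> s sK x xC; apply/tors_subP; move: x xC; apply: Cmin => x xE; apply/tors_subP.
    by apply: tE => //; exact: FF.
  by exists 0%N; rewrite sK.
- move=> s sK sr x xC; rewrite -[RHS](aut1 x); apply/eq_subP; move: x xC.
  apply: Cmin => x xE; apply/eq_subP; rewrite aut1; last exact: sK.
  by apply: uE => //; exact: FF.
Qed.
End Max.

(** * Z_p-extensions *)

Section ZpArith.
Variables (p : nat) (p_pr : prime p).
Implicit Types a b : Zp p.

Lemma zp_intE (k : int) n : zp_seq (k%:~R : Zp p) n = (k %% (p ^ n)%N)%Z.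
Proof.
have hn (m : nat) : zp_seq (m%:R : Zp p) n = (m %% (p ^ n)%N)%Z.
  elim: m => [|m IH] //; rewrite -addn1 natrD /= IH modzDm.
  by rewrite PoszD.
case: k => m; first by rewrite -pmulrn hn.
by rewrite NegzE mulrNz /= -pmulrn hn modzNm.
Qed.

Lemma zp_natE (k : nat) n : zp_seq (k%:R : Zp p) n = (k %% (p ^ n)%N)%Z.
Proof. by rewrite pmulrn zp_intE. Qed.

Lemma zp_seq_natM (k : nat) a n : zp_seq (k%:R * a) n = ((k%:Z * zp_seq a n) %% (p ^ n)%N)%Z.
Proof. by rewrite /= zp_natE modzMml. Qed.

Lemma zp_seq0 n : zp_seq (0 : Zp p) n = 0.
Proof. by rewrite /= mod0z. Qed.

Lemma zp_seq_leq a m n : (m <= n)%N -> zp_seq a n = 0 -> zp_seq a m = 0.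
Proof.
move=> le h; rewrite -(zp_seq0 m); apply: (zp_seq_le le); by rewrite h zp_seq0.
Qed.

Lemma zp_seq_pM n a : zp_seq ((p ^ n)%:R * a) n = 0.
Proof. by rewrite zp_seq_natM mulrC modzMl. Qed.

Lemma zp_divp n a : zp_seq a n = 0 -> exists b, a = (p ^ n)%:R * b.
Proof.
(* The quotient modulo p^m is read off from a modulo p^(m+n). *)
move=> a0; pose f m := (zp_seq a (m + n) %/ (p ^ n)%N)%Z.
have pn0 m : ((p ^ m)%N : int) != 0.
  by rewrite eqz_nat -lt0n expn_gt0 prime_gt0.
have dv m : zp_seq a (m + n) = f m * (p ^ n)%N.
  rewrite /f divzK //; apply/dvdz_mod0P.
  by have := zp_seq_mod a (leq_addl m n); rewrite a0 mod0z.
have hf m : (f m.+1 = f m %[mod (p ^ m)%N])%Z.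
  apply/eqP; rewrite eqz_mod_dvd; apply/dvdzP.
  have /eqP := zp_seq_mod a (leqnSn (m + n)); rewrite eqz_mod_dvd => /dvdzP[c].
  rewrite -addSn !dv expnD PoszM mulrA -mulrBl => /(mulIf (pn0 n)) ->.
  by exists c.
exists (zp_of hf); apply: zp_eq => m; rewrite zp_seq_natM /= modzMmr mulrC -dv.
by rewrite (zp_seq_mod a (leq_addr n m)) zp_mod.
Qed.

Lemma zp_seqD a b n : zp_seq (a + b) n = ((zp_seq a n + zp_seq b n) %% (p ^ n)%N)%Z.
Proof. by []. Qed.
Lemma zp_seqN a n : zp_seq (- a) n = ((- zp_seq a n) %% (p ^ n)%N)%Z.
Proof. by []. Qed.
Lemma zp_seqB a b n : zp_seq (a - b) n = ((zp_seq a n - zp_seq b n) %% (p ^ n)%N)%Z.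
Proof. by rewrite zp_seqD zp_seqN modzDmr. Qed.
Lemma zp_seqM a b n : zp_seq (a * b) n = ((zp_seq a n * zp_seq b n) %% (p ^ n)%N)%Z.
Proof. by []. Qed.

Lemma zp_seqB0 a b n : zp_seq (a - b) n = 0 <-> zp_seq a n = zp_seq b n.
Proof.
split=> [h|h]; last by rewrite zp_seqB h subrr mod0z.
by rewrite -(subrK b a) zp_seqD h add0r zp_mod.
Qed.

Lemma zp_digit n a : exists i b, (i < p ^ n)%N /\ a = i%:R + (p ^ n)%:R * b.
Proof.
have pn0 : (p ^ n)%N%:Z != 0 by rewrite eqz_nat -lt0n expn_gt0 prime_gt0.
have [i e] : exists i : nat, zp_seq a n = i.
  by exists `|zp_seq a n|%N; rewrite gez0_abs // -zp_mod modz_ge0.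
have hi : (i %% (p ^ n)%N)%Z = i by rewrite -e zp_mod.
have [b hb] : exists b, a - i%:R = (p ^ n)%:R * b.
  by apply: zp_divp; apply/zp_seqB0; rewrite zp_natE e hi.
exists i, b; split; last by rewrite -hb addrC subrK.
by rewrite -ltz_nat -hi ltz_pmod // ltz_nat expn_gt0 prime_gt0.
Qed.

Lemma zp_neq0 a : a != 0 -> exists n, zp_seq a n != 0.
Proof.
move=> a0; apply: contrapT => h; move/eqP: a0; apply; apply: zp_eq => n.
by rewrite zp_seq0; apply/eqP; apply: contrapT => /negP hn; apply: h; exists n.
Qed.

Lemma zp_unit a : zp_seq a 1 != 0 -> exists b, a * b = 1.
Proof.
move=> a1.
have cop m : coprimez (zp_seq a m) (p ^ m)%N.
  case: m => [|m]; first by rewrite /coprimez /gcdz expn0 gcdn1.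
  rewrite /coprimez /gcdz /= eqz_nat; change (coprime `|zp_seq a m.+1| (p ^ m.+1)).
  rewrite coprimeXr // coprime_sym prime_coprime //; apply: contra a1 => dv.
  have /dvdzP[c e] : (p %| zp_seq a m.+1)%Z by [].
  by have := zp_seq_mod a (ltn0Sn m); rewrite zp_mod e expn1 modzMl => <-.
have inv m : exists u : int, (u * zp_seq a m = 1 %[mod (p ^ m)%N])%Z.
  have /coprimezP[[u v] /= e] := cop m; exists u.
  by rewrite -e [in RHS]addrC modzMDl.
pose u m := projT1 (cid (inv m)).
have hu m : (u m * zp_seq a m = 1 %[mod (p ^ m)%N])%Z by rewrite /u; case: cid.
have hf m : (u m.+1 = u m %[mod (p ^ m)%N])%Z.
  have h1 : (u m.+1 * zp_seq a m = 1 %[mod (p ^ m)%N])%Z.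
    by rewrite -modzMmr -zp_succ modzMmr -modz_expS hu modz_expS.
  rewrite -[in LHS](mulr1 (u m.+1)) -modzMmr -(hu m) modzMmr mulrCA -modzMmr h1.
  by rewrite modzMmr mulr1.
exists (zp_of hf); apply: zp_eq => m; rewrite mulrC zp_seqM /= modzMml hu.
by [].
Qed.

Lemma zp_decomp a : a != 0 -> exists n u, zp_seq u 1 != 0 /\ a = (p ^ n)%:R * u.
Proof.
move=> a0; have [n hn] := zp_neq0 a0.
elim: n a {a0} hn => [|n IH] a hn.
  by move: hn; rewrite -(zp_mod a 0) expn0 modz1.
have [h0|h0] := eqVneq (zp_seq a 1) 0; last first.
  by exists 0%N, a; rewrite expn0 mul1r.
have [b eb] := zp_divp h0; rewrite expn1 in eb.
have bn : zp_seq b n != 0.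
  apply: contra hn => /eqP/zp_divp[c ec].
  by rewrite eb ec mulrA -natrM -expnS zp_seq_pM.
have [m [u [hu eu]]] := IH b bn; exists m.+1, u; split=> //.
by rewrite eb eu mulrA -natrM -expnS.
Qed.

Lemma zp_pmulI n a : (p ^ n)%:R * a = 0 -> a = 0.
Proof.
move=> h; apply: zp_eq => m; rewrite zp_seq0.
have := congr1 (fun x : Zp p => zp_seq x (n + m)) h; rewrite zp_seq0 zp_seq_natM.
move/dvdz_mod0P; rewrite expnD PoszM dvdz_mul2l; last by rewrite eqz_nat -lt0n expn_gt0 prime_gt0.
move/dvdz_mod0P; rewrite (zp_seq_mod a (leq_addl n m)) zp_mod; exact.
Qed.

Lemma zp_domain a b : a * b = 0 -> a = 0 \/ b = 0.
Proof.
move=> h; have [->|a0] := eqVneq a 0; [by left | right].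
have [n [u [hu eu]]] := zp_decomp a0; have [v uv] := zp_unit hu.
have e : u * b = 0 by apply: (@zp_pmulI n); rewrite mulrA -eu.
by rewrite -[b]mul1r -uv [u * v]mulrC -mulrA e mulr0.
Qed.

Lemma zp_coprime_unit M : coprime M p -> exists b : Zp p, M%:R * b = 1.
Proof.
move=> cop; apply: zp_unit; rewrite zp_natE expn1; apply/negP => /eqP/dvdz_mod0P dv.
have : (p %| M)%N by [].
by apply/negP; rewrite -prime_coprime // coprime_sym.
Qed.

Lemma zp_pneq0 n : (p ^ n)%:R != 0 :> Zp p.
Proof.
apply/eqP => h; have : (1 : Zp p) = 0 by apply: (@zp_pmulI n); rewrite mulr1.
move/(congr1 (fun x : Zp p => zp_seq x 1)); rewrite zp_seq0 -[1]/(1%:R) zp_natE expn1.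
by rewrite modz_small //= ltz_nat prime_gt1.
Qed.

Lemma zp_natr_eq0 (M : nat) : M%:R = 0 :> Zp p -> M = 0%N.
Proof.
move=> h; have lt : (M < p ^ M)%N by rewrite ltn_expl ?prime_gt1.
have : zp_seq (M%:R : Zp p) M = 0 by rewrite h zp_seq0.
by rewrite zp_natE modz_nat (modn_small lt) => -[].
Qed.
End ZpArith.

Section ZpExt.
Variables (p : nat) (p_pr : prime p) (k K : subfield).

(* e is an isomorphism of topological groups Gal(K/k) = Z_p, as a function of the
   automorphisms of algC over k. *)
Record zext_hom (e : aut -> Zp p) : Prop := ZextHom {
  zhN : normal_ext k K;
  zhM : forall s t, fixes k s -> fixes k t -> e (s * t)%g = e s + e t;
  zh0 : forall s, fixes k s -> e s = 0 <-> fixes K s;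
  zh_surj : forall a, exists2 s, fixes k s & e s = a;
  zh_cont : forall n, exists2 l : seq algC, {subset l <= K} &
    forall s t, fixes k s -> fixes k t -> {in l, s =1 t} -> zp_seq (e s) n = zp_seq (e t) n;
  zh_cont' : forall x, x \in K -> exists n, forall s, fixes k s -> zp_seq (e s) n = 0 -> s x = x }.

Lemma zext_hom_exists : is_Zp_ext p k K -> exists e, zext_hom e.
Proof.
move=> [gK [f [g [fM fK gfK fc gc]]]]; have nK := is_galois_normal gK.
have [skK stK] := nK.
pose e (s : aut) := if pselect (fixes k s) is left h then f (aut_res nK h) else 0.
have eE s (h : fixes k s) : e s = f (aut_res nK h).
  by rewrite /e; case: pselect => // h'; rewrite (Prop_irrelevance h' h).
have res_eq s t (hs : fixes k s) (ht : fixes k t) :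
    aut_res nK hs = aut_res nK ht <-> forall x, x \in K -> s x = t x.
  split=> [h x xK|h].
    by have := congr1 (fun u : Gal k K => fval (u (MkFsub xK))) h.
  by apply: gal_eq => x; apply: val_inj => /=; apply: h; exact: fvalP.
have f1 : f 1%g = 0.
  by have := fM 1%g 1%g; rewrite mulg1 -[LHS]addr0 => /addrI.
exists e; split=> //.
- move=> s t hs ht; rewrite (eE _ (fixesM hs ht)) (eE _ hs) (eE _ ht) -fM.
  by congr f; apply: gal_eq => x; exact: val_inj.
- move=> s hs; rewrite (eE _ hs); split=> [h x xK|h].
    have e1 : aut_res nK hs = 1%g by apply: (can_inj fK); rewrite f1.
    by have := congr1 (fun u : Gal k K => fval (u (MkFsub xK))) e1.
  by rewrite -[RHS]f1; congr f; apply: gal_eq => x; apply: val_inj; rewrite /= h ?fvalP.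
- move=> a; have [t [tk ht]] := gal_extend (g a) skK; exists t => //.
  rewrite (eE _ tk) -[RHS]gfK; congr f; apply: gal_eq => x; apply: val_inj.
  exact: ht.
- move=> n.
  have /continuousP/(_ (fun b => zp_seq b n = 0)) fo := fc.
  have op : open ((fun b => zp_seq b n = 0) : set (Zp p)).
    by move=> b b0; exists n => c ->.
  have n1 : zp_seq (f 1%g) n = 0 by rewrite f1 zp_seq0.
  have [l hl] := fo op 1%g n1.
  exists (map (@fval K) l) => [_ /mapP[x _ ->]|s t hs ht st]; first exact: fvalP.
  have hst := fixesM (fixesV ht) hs.
  have h0 : zp_seq (e (t^-1 * s)%g) n = 0.
    rewrite (eE _ hst); apply: hl => x xl; apply: val_inj.
    have xs : s (fval x) = t (fval x) by apply: st; exact: map_f.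
    by rewrite [LHS]aut_resE autM xs autK.
  apply/zp_seqB0; rewrite -h0; congr (zp_seq _ n); apply/eqP; rewrite subr_eq addrC.
  rewrite (eE _ hs) (eE _ ht) (eE _ hst) -fM; apply/eqP; congr f.
  by apply: gal_eq => x; apply: val_inj; rewrite [RHS]aut_resE /= -/(aut_inv t) autVK.
- move=> x xK.
  have /continuousP/(_ (fun s : Gal k K => s (MkFsub xK) = MkFsub xK)) go := gc.
  have op : open ((fun s : Gal k K => s (MkFsub xK) = MkFsub xK) : set (Gal k K)).
    by move=> s hs; exists [:: MkFsub xK] => t ->; rewrite ?inE.
  have g0 : g 0 (MkFsub xK) = MkFsub xK by rewrite (_ : g 0 = 1%g) // -[RHS]fK f1.
  have [n hn] := go op 0 g0.
  exists n => s hs h; have := hn (e s); rewrite zp_seq0 => /(_ h).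
  by rewrite (eE _ hs) /preimage /mkset fK => /(congr1 (@fval K)).
Qed.

Lemma layer_closed n : GRing.divring_closed
  [pred x | (x \in K) && `[< forall s, fixes k s -> (s ^+ (p ^ n))%g x = x >]].
Proof.
split=> [|x y /andP[xK /asboolP hx] /andP[yK /asboolP hy]
         |x y /andP[xK /asboolP hx] /andP[yK /asboolP hy]]; apply/andP.
- by split; [exact: rpred1 | apply/asboolP => s _; exact: rmorph1].
- by split; [exact: rpredB | apply/asboolP => s hs; rewrite rmorphB /= hx // hy].
- by split; [exact: rpred_div | apply/asboolP => s hs; rewrite fmorph_div /= hx // hy].
Qed.
(* The subextension of degree p^n over k. *)
Definition layer n := MkSubfield (layer_closed n).

Lemma layerP n x : x \in layer n <->
  x \in K /\ forall s, fixes k s -> (s ^+ (p ^ n))%g x = x.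
Proof.
split=> [/andP[h /asboolP h'] //|[h h']].
by apply/andP; split=> //; exact/asboolP.
Qed.

Section Hom.
Variables (e : aut -> Zp p) (he : zext_hom e).

Lemma ze1 : e 1%g = 0.
Proof. by apply/(zh0 he); [exact: fixes1 | exact: fixes1]. Qed.

Lemma zeV s : fixes k s -> e s^-1%g = - e s.
Proof.
move=> hs; apply/eqP; rewrite -addr_eq0 -(zhM he) ?mulVg ?ze1 //; exact: fixesV.
Qed.

Lemma zeX s n : fixes k s -> e (s ^+ n)%g = n%:R * e s.
Proof.
move=> hs; elim: n => [|n IH]; first by rewrite mul0r ze1.
by rewrite expgS (zhM he) ?IH // -?nat1r ?mulrDl ?mul1r //; exact: fixesX.
Qed.

Lemma ze_eq s t : fixes k s -> fixes k t -> e s = e t <-> forall x, x \in K -> s x = t x.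
Proof.
move=> hs ht; have hts := fixesM (fixesV ht) hs.
have ets : e (t^-1 * s)%g = e s - e t.
  by rewrite (zhM he) ?zeV 1?addrC //; exact: fixesV.
split=> [est x xK|h].
  have /(zh0 he hts)/(_ x xK) : e (t^-1 * s)%g = 0 by rewrite ets est subrr.
  by rewrite autM => {2}<-; rewrite autVK.
apply/eqP; rewrite -subr_eq0 -ets; apply/eqP/(zh0 he) => // x xK.
by rewrite autM h // autK.
Qed.

Lemma ze_abelian s t x : fixes k s -> fixes k t -> x \in K -> s (t x) = t (s x).
Proof.
move=> hs ht; apply: (ze_eq (fixesM hs ht) (fixesM ht hs)).1.
by rewrite !(zhM he) // addrC.
Qed.

Lemma zext_sub : {subset k <= K}. Proof. by case: (zhN he). Qed.

Lemma zext_stable s x : fixes k s -> x \in K -> s x \in K.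
Proof. by move=> hs xK; apply: (proj2 (zhN he)). Qed.

Lemma fixes_sup (F E : subfield) s : {subset F <= E} -> fixes E s -> fixes F s.
Proof. by move=> sFE sE x /sFE; exact: sE. Qed.

Lemma zext_torsion s x : fixes k s -> x \in K -> exists r, (s ^+ (p ^ r))%g x = x.
Proof.
move=> hs xK; have [n hn] := zh_cont' he xK; exists n.
by apply: hn; [exact: fixesX | rewrite zeX // zp_seq_pM].
Qed.

Lemma layer_sub n : {subset k <= layer n}.
Proof.
move=> x xk; apply/layerP; split; first exact: zext_sub.
by move=> s hs; apply: aut_fixX; exact: hs.
Qed.

Lemma layer_le n : {subset layer n <= K}.
Proof. by move=> x /layerP[]. Qed.

Lemma layer_mono m n : (m <= n)%N -> {subset layer m <= layer n}.
Proof.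
move=> le x /layerP[xK hx]; apply/layerP; split=> // s hs.
exact: aut_fix_leq le (hx s hs).
Qed.

(** If e s = p^n b, then s is on K the p^n-th power of an automorphism with value b. Conversely the
    automorphisms with value 0 modulo p^n have their fixed field inside the layer, so [aut_density]
    approximates s by them and continuity of e concludes. *)
Lemma layer_fix n s : fixes k s -> fixes (layer n) s <-> zp_seq (e s) n = 0.
Proof.
move=> hs; split=> [sn|h x /layerP[xK hx]]; last first.
  have [b eb] := zp_divp p_pr h; have [t ht et] := zh_surj he b.
  rewrite -{2}(hx t ht); apply: (ze_eq hs (fixesX _ ht)).1 => //.
  by rewrite zeX // et.
have Hg : is_subgroup (fun t => fixes k t /\ zp_seq (e t) n = 0).
  split; first by rewrite ze1 zp_seq0; split=> //; exact: fixes1.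
  move=> t u [ht et] [hu eu]; split; first exact/fixesM/fixesV.
  by rewrite (zhM he) ?zeV // ?zp_seqB ?et ?eu ?mod0z //; exact: fixesV.
have [l lK hl] := zh_cont he n.
have [|h [hk h0] hh] := @aut_density _ s l Hg; last by rewrite (hl s h).
move=> x hx; apply: sn; apply/layerP; split.
  apply: fixed_mem => t tK; apply: hx; have tk := fixes_sup zext_sub tK.
  by split=> //; rewrite (zh0 he tk).2 // zp_seq0.
by move=> t ht; apply: hx; split; [exact: fixesX | rewrite zeX // zp_seq_pM].
Qed.

Lemma fixes_layer n s : fixes (layer n) s -> fixes k s.
Proof. exact/fixes_sup/layer_sub. Qed.

(** Tame inertia has finite order M on K, so M * e s = 0, and Z_p is torsion-free. *)
Lemma zext_unramified_away (P : prime_idealr O) s : number_field k ->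
  nonzero_ideal P -> p%:R \notin P -> inertial P s -> fixes k s -> fixes K s.
Proof.
move=> k_nf [z zP z0] pP sP sk; have [l l_pr lP] := residue_char zP z0.
have [|x xK|x xK|M M0 hM] := tame_inertia l_pr lP k_nf pP sP (K := K).
- by move=> t x tk xK; exact: ze_abelian.
- exact: zext_stable.
- exact: zext_torsion.
have : M%:R * e s = 0 by rewrite -zeX //; apply/(zh0 he) => //; exact: fixesX.
case/(zp_domain p_pr) => [M0'|]; last by move/(zh0 he sk).
by rewrite (zp_natr_eq0 p_pr M0') in M0.
Qed.

Lemma zext_unramified_inf s : complex_conj s -> fixes k s -> fixes K s.
Proof.
move=> [i hi] sk.
have s2 : (s ^+ 2)%g = 1%g.
  by apply: aut_eq => x; apply: (@aut_inj i); rewrite autX /= !hi Num.Theory.conjCK.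
have : 2%:R * e s = 0 by rewrite -zeX // s2 ze1.
case/(zp_domain p_pr) => [h|]; last by move/(zh0 he sk).
by have := zp_natr_eq0 p_pr h.
Qed.

(* Gal(K/k) is procyclic and inertia groups are closed, so an inertia group
   containing an element of valuation j contains p^j Z_p. *)
Lemma inertial_power (P : prime_idealr O) s j u c : inertial P s -> fixes k s ->
  e s = (p ^ j)%:R * u -> zp_seq u 1 != 0 ->
  exists t, [/\ inertial P t, fixes k t & e t = (p ^ j)%:R * c].
Proof.
move=> sP sk es u1; have [v uv] := zp_unit p_pr u1.
(* With u v = 1, the power s^(i N) has value p^j u v c modulo p^N; a cluster point of these powers
   is inertial with value p^j c. *)
pose i N := projT1 (cid (zp_digit p_pr N (v * c))).
have hi N : exists b, v * c = (i N)%:R + (p ^ N)%:R * b.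
  by rewrite /i; case: cid => a /= [b [_ h]]; exists b.
have [t ht] := aut_cluster (fun N => (s ^+ i N)%g).
have tk : fixes k t.
  by move=> x xk; have [n _ <-] := ht [:: x] 0%N; rewrite ?mem_head //; apply: aut_fixX; exact: sk.
exists t; split=> // [z|].
  have [n _ e1] := ht [:: ival z] 0%N.
  rewrite (_ : oact t z = oact (s ^+ i n)%g z); first exact: inertialX.
  by apply: ival_inj; rewrite /= e1 ?mem_head.
apply: zp_eq => N; have [l lK hl] := zh_cont he N.
have [n le e1] := ht l N.
have -> : zp_seq (e t) N = zp_seq (e (s ^+ i n)%g) N.
  apply: hl => //; first exact: fixesX.
  by move=> x xl; rewrite e1.
have [b hb] := hi n; rewrite zeX // es.
have -> : (p ^ j)%:R * c = (i n)%:R * ((p ^ j)%:R * u) + (p ^ n)%:R * (b * ((p ^ j)%:R * u)).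
  by rewrite [(p ^ n)%:R * (b * _)]mulrA -mulrDl -hb [v * c]mulrC mulrACA [v * u]mulrC uv mulr1 mulrC.
have pn : zp_seq ((p ^ n)%:R * (b * ((p ^ j)%:R * u))) N = 0 by exact: zp_seq_leq le (zp_seq_pM _ _).
by rewrite [RHS]zp_seqD pn addr0 zp_mod.
Qed.
End Hom.
End ZpExt.

(** * Degrees and layers *)

Section Degree.
Variables (p : nat) (p_pr : prime p) (k K : subfield) (e : aut -> Zp p).
Hypothesis he : zext_hom k K e.
Variables (E : subfield).
Hypotheses (skE : {subset k <= E}) (sEK : {subset E <= K}).

(** If E missed part of the layer, some s over E would have value of valuation j < n, and E would be
    fixed by all of p^j Z_p. With g of value 1, the p^n vectors formed by the g^-r (v i) for r < p^j
    are dependent over E; applying g^r and summing over r gives traces in k, hence a relation over k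
    between the [v i]. *)
Lemma layer_degree n : degree_ge k E (p ^ n) -> {subset layer p k K n <= E}.
Proof.
move=> [v [vE vfree]] x xn; apply: contrapT => /negP xE.
have [s sE sx] : exists2 s, fixes E s & s x <> x.
  apply: contrapT => h; move/negP: xE; apply; apply: fixed_mem => s sE.
  by apply: contrapT => sx; apply: h; exists s.
have sk : fixes k s by exact: fixes_sup skE sE.
have es : zp_seq (e s) n != 0.
  by apply/eqP => /(layer_fix p_pr he n sk)/(_ x xn).
have [j [u [u1 eu]]] : exists j u, zp_seq u 1 != 0 /\ e s = (p ^ j)%:R * u.
  by apply: zp_decomp => //; apply: contra es => /eqP ->; rewrite zp_seq0.
have jn : (j < n)%N.
  rewrite ltnNge; apply: contra es => le; rewrite eu; apply/eqP.
  exact: zp_seq_leq le (zp_seq_pM _ _).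
have [w uw] := zp_unit p_pr u1.
have fixE t : fixes k t -> zp_seq (e t) j = 0 -> fixes E t.
  move=> tk tj y yE; have [N hN] := zh_cont' he (sEK yE).
  have [b eb] := zp_divp p_pr tj; have [i [c [_ ec]]] := zp_digit p_pr N (w * b).
  have /hN : fixes k (s ^- i * t)%g by exact/fixesM/tk/fixesV/fixesX.
  rewrite (zhM he (fixesV (fixesX i sk)) tk) (zeV he (fixesX i sk)) (zeX he _ sk).
  have -> : - (i%:R * e s) + e t = (p ^ N)%:R * (c * ((p ^ j)%:R * u)).
    have -> : e t = (w * b) * ((p ^ j)%:R * u).
      by rewrite [w * b]mulrC mulrACA [w * u]mulrC uw mulr1 mulrC eb.
    by rewrite eu ec mulrDl addKr -mulrA.
  move=> /(_ (zp_seq_pM _ _)); rewrite autM => h.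
  have := congr1 (s ^+ i)%g h; rewrite autVK => ->.
  by apply: aut_fixX; exact: sE.
have stE t y : fixes k t -> y \in E -> t y \in E.
  move=> tk yE; apply: fixed_mem => h hE; rewrite (ze_abelian he) ?hE //; last exact: sEK.
  exact: fixes_sup skE hE.
have [g gk eg] := zh_surj he 1.
pose M := (p ^ j)%N.
have gM y : y \in E -> (g ^+ M)%g y = y.
  move=> yE; apply: (fixE (g ^+ M)%g _ _ y yE); first exact: fixesX.
  by rewrite (zeX he) // eg zp_seq_pM.
have gE i y : y \in E -> (g ^+ i)%g y \in E by apply: stE; exact: fixesX.
have gVE i y : y \in E -> (g ^- i)%g y \in E by apply: stE; exact/fixesV/fixesX.
pose T y := \sum_(r < M) (g ^+ r)%g y.
have TE y : y \in E -> T y \in E by move=> yE; rewrite rpred_sum // => r _; exact: gE.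
have gT y : y \in E -> g (T y) = T y.
  move=> yE; rewrite /T rmorph_sum /=.
  have M0 : (0 < M)%N by rewrite expn_gt0 prime_gt0.
  rewrite -(prednK M0) big_ord_recr [RHS]big_ord_recl /= addrC; congr (_ + _).
    by rewrite -autM -expgS (prednK M0) gM // expg0.
  by apply: eq_bigr => r _; rewrite -autM -expgS.
have Tk y : y \in E -> T y \in k.
  move=> yE; apply: fixed_mem => t tk; have [N hN] := zh_cont' he (sEK (TE y yE)).
  have [i [c [_ ec]]] := zp_digit p_pr N (e t).
  have /hN : fixes k (g ^- i * t)%g by exact/fixesM/tk/fixesV/fixesX.
  rewrite (zhM he (fixesV (fixesX i gk)) tk) (zeV he (fixesX i gk)) (zeX he _ gk).
  rewrite eg mulr1 ec addKr => /(_ (zp_seq_pM _ _)); rewrite autM => h.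
  have := congr1 (g ^+ i)%g h; rewrite autVK => ->.
  by apply: aut_fixX; exact: gT.
pose A : 'M[fsub E]_(p ^ n, M) := \matrix_(i, r) MkFsub (gVE r _ (vE i)).
have : kermx A != 0.
  rewrite kermx_eq0 /row_free neq_ltn (leq_ltn_trans (rank_leq_col A)) //.
  by rewrite ltn_exp2l ?prime_gt1.
case/rowV0Pn => c /sub_kermxP cA /rV0Pn[i0 ci0].
(* The normalisation makes the trace of [d i0] equal to p^j, which is nonzero. *)
pose d i := fval (c 0 i / c 0 i0).
have dE i : d i \in E by exact: fvalP.
have sumA (r : 'I_M) : \sum_i d i * (g ^- r)%g (v i) = 0.
  have := congr1 (fun B : 'rV_M => fval (B 0 r)) cA; rewrite !mxE rmorph_sum rmorph0 /= => h.
  have := congr1 (fun z => z / fval (c 0 i0)) h; rewrite mul0r mulr_suml => h'.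
  rewrite -[RHS]h'; apply: eq_bigr => i _; rewrite mxE /d fmorph_div /=.
  by rewrite mulrAC.
have sumg (r : 'I_M) : \sum_i (g ^+ r)%g (d i) * v i = 0.
  have autB (h : aut) x1 x2 : h (x1 * x2) = h x1 * h x2 by exact: rmorphM.
  have autS (h : aut) (z : 'I_(p ^ n) -> algC) : h (\sum_i z i) = \sum_i h (z i) by exact: rmorph_sum.
  have := congr1 (g ^+ r)%g (sumA r); rewrite autS (_ : (g ^+ r)%g 0 = 0); last exact: rmorph0.
  by move=> h; rewrite -[RHS]h; apply: eq_bigr => i _; rewrite autB autVK.
have sumT : \sum_i T (d i) * v i = 0.
  under eq_bigr do rewrite mulr_suml.
  by rewrite exchange_big /= big1 // => r _; exact: sumg.
have := vfree (fun i => T (d i)) (fun i => Tk _ (dE i)) sumT i0.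
rewrite /T (_ : d i0 = 1); last by rewrite /d divff // rmorph1.
under eq_bigr do rewrite rmorph1.
rewrite sumr_const card_ord => /eqP; rewrite Num.Theory.pnatr_eq0.
by rewrite expn_eq0 => /andP[/eqP p0 _]; move: p_pr; rewrite p0.
Qed.
End Degree.

(** * Descent from K to its layers *)

Section Descent.
Local Open Scope group_scope.

(* Descent along the p-th powers of a set T generating N modulo Z: the
   commutator subgroup [W, G] of W = V :&: N is proper modulo Z, and modulo a
   maximal subgroup U of W above [W, G] all t in T have the same p-th power. *)
Lemma pgroup_descent (gT : finGroupType) (p : nat) (G V Z N N1 : {group gT})
    (T : {set gT}) (t0 : gT) :
  prime p -> p.-group G -> V <| G -> Z <| G -> Z \subset V -> N <| G -> Z \subset N ->
  t0 \in N -> T \subset N -> {in T, forall t, t * t0^-1 \in V} ->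
  (forall i, t0 ^+ i \in V -> t0 ^+ i \in Z) ->
  (N1 \subset <<[set t ^+ p | t in T] :|: Z>>) ->
  V :&: N \subset N1 ->
  V :&: N \subset Z.
Proof.
move=> p_pr pG nVG nZG sZV nNG sZN t0N sTN TV t0V sN1 sVN.
pose W := (V :&: N)%G.
have nWG : W <| G by exact: normalI.
have sZW : Z \subset W by rewrite finset.subsetI sZV.
apply: contraT => nWZ.
have sWG := normal_sub nWG.
have nZW : W \subset 'N(Z) by exact: fintype.subset_trans sWG (normal_norm nZG).
have pW : p.-group W := pgroupS sWG pG.
pose C := ([~: W, G] <*> Z)%G.
have sRW : [~: W, G] \subset W by rewrite commg_subl normal_norm.
have sCW : C \subset W by rewrite join_subG sRW.
(* Otherwise the nontrivial normal subgroup W / Z of the nilpotent group G / Z would equal its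
   commutator with G / Z. *)
have neqC : C :!=: W.
  apply/eqP => eCW; have nilG : nilpotent (G / Z) by apply: (@pgroup_nil _ p); exact: quotient_pgroup.
  have ntW : W / Z != 1.
    by rewrite -subG1 quotient_sub1.
  have nGZ : G / Z \subset 'N_(G / Z)(W / Z).
    by rewrite finset.subsetI subxx quotient_norms ?normal_norm.
  have := nil_comm_properl nilG (quotientS Z sWG) ntW nGZ.
  rewrite -quotientR ?(normal_norm nZG) //.
  have := quotientYidr (fintype.subset_trans sRW nZW); rewrite -[_ <*> _]/(gval C) eCW => <-.
  by rewrite fintype.properxx.
have [eC|[U maxU sCU]] := maximal_exists sCW; first by case/eqP: neqC.
have sUW : U \subset W := proper_sub (maxgroupp maxU).
have sRU : [~: W, G] \subset U by apply: fintype.subset_trans sCU; exact: joing_subl.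
have sZU : Z \subset U by apply: fintype.subset_trans sCU; exact: joing_subr.
have nUG : G \subset 'N(U).
  rewrite -commg_subl; apply: fintype.subset_trans sRU; exact: commSg.
have iUW := p_maximal_index pW maxU.
have sNG := normal_sub nNG.
have NU x : x \in G -> x \in 'N(U) by exact: fintype.subsetP.
have Wp w : w \in W -> w ^+ p \in U.
  move=> wW; have wG := fintype.subsetP sWG w wW; apply: coset_idr; first by rewrite groupX ?NU.
  rewrite morphX ?NU //; apply/eqP; rewrite -order_dvdn -iUW -card_quotient; last first.
    exact: fintype.subset_trans sWG nUG.
  by rewrite order_dvdG ?mem_quotient.
have t0G := fintype.subsetP sNG t0 t0N.
(* Modulo U, the element w = t t0^-1 commutes with t0 and has trivial p-th power, so t^p = t0^p. *)
have Tp t : t \in T -> t ^+ p \in U <*> <[t0]>.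
  move=> tT; have tN := fintype.subsetP sTN t tT; pose w := t * t0^-1.
  have wW : w \in W by rewrite inE TV //= groupM ?groupV.
  have wG := fintype.subsetP sWG w wW.
  have tE : t = w * t0 by rewrite mulgKV.
  have cwt : commute (coset U w) (coset U t0).
    apply/commgP; rewrite -morphR ?NU //; apply/eqP/coset_id.
    by apply: (fintype.subsetP sRU); exact: mem_commg.
  have e : coset U (t ^+ p) = coset U (t0 ^+ p).
    have [nw nt0] := (NU w wG, NU t0 t0G).
    have nwt : w * t0 \in 'N(U) by rewrite groupM.
    have ew : coset U w ^+ p = 1.
      by rewrite -(coset_id (Wp w wW)); apply/esym; exact: morphX.
    have et : coset U (t0 ^+ p) = coset U t0 ^+ p by exact: morphX.
    have e1 : coset U ((w * t0) ^+ p) = coset U (w * t0) ^+ p by exact: morphX.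
    have e2 : coset U (w * t0) = coset U w * coset U t0 by exact: morphM.
    by rewrite et tE e1 e2 expgMn // ew mul1g.
  have : t ^+ p * (t0 ^+ p)^-1 \in U.
    apply: coset_idr; first by rewrite NU // groupM ?groupV ?groupX // (fintype.subsetP sNG).
    by rewrite morphM ?morphV ?NU ?groupV ?groupX ?(fintype.subsetP sNG) //= e mulgV.
  move=> h; rewrite -(mulgKV (t0 ^+ p) (t ^+ p)) groupM //.
    exact: (fintype.subsetP (joing_subl _ _)).
  by apply: (fintype.subsetP (joing_subr _ _)); exact: mem_cycle.
have sN1U : N1 \subset U <*> <[t0]>.
  apply: fintype.subset_trans sN1 _; rewrite gen_subG finset.subUset; apply/andP; split.
    by apply/fintype.subsetP => _ /imsetP[t tT ->]; exact: Tp.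
  by apply: fintype.subset_trans sZU _; exact: joing_subl.
(* In w = u t0^i both w and u lie in V, hence t0^i does; the hypothesis on t0 puts it in Z, so in
   U. *)
have : W \subset U.
  apply/fintype.subsetP => w wW; have := fintype.subsetP sN1U w (fintype.subsetP sVN w wW).
  rewrite norm_joinEr ?cycle_subG ?NU // => /mulsgP[u _ uU /cycleP[i ->] ew].
  rewrite ew groupM // (fintype.subsetP sZU) // t0V //.
  have uV : u \in V by have := fintype.subsetP sUW u uU; rewrite inE => /andP[].
  have wV : w \in V by move: wW; rewrite inE => /andP[].
  by rewrite -(groupMl _ uV) -ew.
by move=> sWU; have := maxgroupp maxU; rewrite fintype.properE sWU andbF.
Qed.

End Descent.

Lemma prime_above (p : nat) : prime p -> exists P : prime_idealr O, p%:R \in P.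
Proof.
move=> p_pr.
have zex (x : ring_int rat_subfield) : exists m : int, ival x = m%:~R.
  apply/Num.Theory.intrP; apply: Cint_rat_Aint; last exact: up_proof.
  exact: (ival_sub x).
pose z x := projT1 (cid (zex x)).
have zE x : ival x = (z x)%:~R by rewrite /z; case: cid.
have zI : injective (intr : int -> algC) by exact: intr_inj.
pose Q : pred (ring_int rat_subfield) := fun x => (p %| z x)%Z.
have mQ x : (x \in (Q : {pred _})) = (p %| z x)%Z by [].
have Q1 : idealr_closed (Q : {pred ring_int rat_subfield}).
  split=> [||a u v]; rewrite !mQ.
  - have -> : z 0 = 0 by apply: zI; rewrite -zE rmorph0.
    exact: dvdz0.
  - have -> : z 1 = 1 by apply: zI; rewrite -zE rmorph1.
    by rewrite dvdz1 /=; apply: contraTN p_pr => /eqP ->.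
  - have -> : z (a * u + v) = z a * z u + z v.
      by apply: zI; rewrite rmorphD rmorphM /= -!zE.
    by move=> hu hv; exact: rpredD (dvdz_mull _ hu) hv.
have Q2 : prime_idealr_closed (Q : {pred ring_int rat_subfield}).
  move=> u v; rewrite !mQ; have -> : z (u * v) = z u * z v.
    by apply: zI; rewrite rmorphM /= -!zE.
  by rewrite !dvdzE abszM /= Euclid_dvdM.
pose m1 := isIdealr.Build (ring_int rat_subfield) Q Q1.
pose m2 := isPrimeIdealrClosed.Build (ring_int rat_subfield) Q Q2.
pose QQ : prime_idealr (ring_int rat_subfield) := HB.pack_for (prime_idealr (ring_int rat_subfield)) Q m1 m2.
have [P hP] := lying_over QQ; exists P.
have -> : p%:R = up (p%:R : ring_int rat_subfield) by rewrite rmorph_nat.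
rewrite hP; change (p %| z p%:R)%Z.
have -> : z p%:R = p by apply: zI; rewrite -zE rmorph_nat.
exact: dvdzz.
Qed.

Lemma prime_nonzero (p : nat) (P : prime_idealr O) : prime p -> p%:R \in P -> nonzero_ideal P.
Proof.
move=> p_pr pP; exists p%:R => //; apply/eqP => /(congr1 (@ival _)).
rewrite rmorph_nat rmorph0 => /eqP; rewrite Num.Theory.pnatr_eq0 => /eqP p0.
by rewrite p0 in p_pr.
Qed.

Definition aut_act (s : aut) (x : algC) : algC := s x.
Lemma aut_act1 x : aut_act 1%g x = x. Proof. by []. Qed.
Lemma aut_actM s t x : aut_act (s * t)%g x = aut_act s (aut_act t x). Proof. by []. Qed.

Lemma fixes_subgroup (F : subfield) : is_subgroup (fixes F).
Proof. by split=> [|s t hs ht]; [exact: fixes1 | exact/fixesM/fixesV]. Qed.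

Lemma stable_closure (k L : subfield) (S : seq algC) : normal_ext k L -> {subset S <= L} ->
  exists o : seq algC, [/\ {subset S <= o}, {subset o <= L}
    & forall s, fixes k s -> stab aut_act o s].
Proof.
move=> [_ stL] SL.
have [|o [So ho]] := orbit_closure S aut_actM aut_act1 (fixes_subgroup k).
  by move=> x; have [m hm] := aut_conjugates x; exists m => s _; exact: hm.
exists [seq x <- o | x \in L]; split=> [x xS|x|s hs x].
- by rewrite mem_filter SL ?So.
- by rewrite mem_filter => /andP[].
- rewrite !mem_filter => /andP[xL xo]; rewrite ho // andbT; exact: stL.
Qed.

Lemma rep_set_norm (o : seq algC) (A B : set aut) :
  (forall s, A s -> stab aut_act o s) -> (forall s, B s -> stab aut_act o s) ->
  (forall s t, B s -> A t -> A (s^-1 * t * s)%g) ->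
  rep_set aut_act o B \subset ('N(rep_set aut_act o A))%g.
Proof.
move=> hA hB h; apply/fintype.subsetP => _ /rep_setP[s Bs <-]; rewrite inE.
apply/fintype.subsetP => _ /imsetP[_ /rep_setP[t At <-] ->].
have sV : stab aut_act o s^-1%g by apply: (stabV aut_act1 aut_actM); exact: hB.
rewrite conjgE -(repV aut_act1 aut_actM (hB s Bs)) -(repM aut_act1 aut_actM (hA t At) (hB s Bs)).
rewrite -(repM aut_act1 aut_actM) //; last exact: (stabM aut_actM (hA t At) (hB s Bs)).
by rewrite mulgA; apply: mem_rep_set; exact: h.
Qed.

Lemma stab_powers (o : seq algC) (s t : aut) n x : {in o, s =1 t} -> stab aut_act o t ->
  x \in o -> (s ^+ n)%g x = (t ^+ n)%g x /\ (t ^+ n)%g x \in o.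
Proof.
move=> st ot xo; elim: n => [|n [e xn]] //; rewrite !expgS !autM e st //.
by split=> //; exact: ot.
Qed.

Fact fixed_sub_closed (H : set aut) :
  GRing.divring_closed [pred x | `[< forall s, H s -> s x = x >]].
Proof.
split=> [|x y /asboolP hx /asboolP hy|x y /asboolP hx /asboolP hy]; apply/asboolP => s Hs.
- exact: rmorph1.
- by rewrite rmorphB /= hx // hy.
- by rewrite fmorph_div /= hx // hy.
Qed.
Definition fixed_sub H := MkSubfield (fixed_sub_closed H).
Lemma fixed_subP H x : x \in fixed_sub H <-> forall s, H s -> s x = x.
Proof. by split=> /asboolP. Qed.

(* When the inertia subgroup of Gal(K/k) = Z_p at P contains p^n Z_p for every P
   above p, the extension K is totally ramified at p over its n-th layer. *)
Definition totally_ramified (p : nat) (k : subfield) (e : aut -> Zp p) n : Prop :=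
  forall (P : prime_idealr O) c, p%:R \in P ->
    exists t, [/\ inertial P t, fixes k t & e t = (p ^ n)%:R * c].

Section Core.
Variables (p : nat) (p_pr : prime p) (k K : subfield) (k_nf : number_field k).
Variables (e : aut -> Zp p) (he : zext_hom k K e).
Local Notation Lm := (max_unram p).
Local Notation L := (max_unram p K).
Local Notation Kn := (layer p k K).

Lemma sub_max_unram : {subset K <= L}. Proof. exact: max_unr_base. Qed.
Lemma max_unram_normal : normal_ext k L. Proof. exact/max_unr_normal/(zhN he). Qed.

Variable n : nat.
Hypothesis totram : totally_ramified k e n.

(** The quotient t^-1 s is inertial and fixes K, while L/K is unramified. So inertia at P injects
    into Z_p. *)
Lemma inertial_uniq (P : prime_idealr O) s t : p%:R \in P -> inertial P s -> inertial P t ->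
  fixes k s -> fixes k t -> e s = e t -> forall x, x \in L -> s x = t x.
Proof.
move=> pP sP tP sk tk est x xL.
have tsK : fixes K (t^-1 * s)%g.
  apply/(zh0 he); first exact/fixesM/sk/fixesV.
  by rewrite (zhM he (fixesV tk) sk) (zeV he tk) est addNr.
have [_ _ _ uL] := max_unr p_pr K.
have := uL _ tsK (or_introl (ex_intro _ P (conj (prime_nonzero p_pr pP) (inertialM (inertialV tP) sP)))).
by move/(_ x xL); rewrite autM => {2}<-; rewrite autVK.
Qed.

Lemma totram_exists s : fixes (Kn n) s -> forall P : prime_idealr O, p%:R \in P ->
  exists t, [/\ inertial P t, fixes k t & e t = e s].
Proof.
move=> sn P pP; have sk := fixes_layer he sn.
have /(layer_fix p_pr he n sk)/(zp_divp p_pr)[c ->] := sn.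
exact: totram.
Qed.

(* On the orbit of x a power of s agrees with an element of Gal(L/K), which is pro-p:
   some inertial automorphism with the same image in Gal(K/k) is trivial there. *)
Lemma unram_torsion s x : fixes (Kn n) s -> x \in L -> exists r, (s ^+ (p ^ r))%g x = x.
Proof.
move=> sn xL; have sk := fixes_layer he sn.
have [P pP] := prime_above p_pr.
have [|o [So oL ho]] := stable_closure (S := [:: x]) max_unram_normal.
  by move=> y; rewrite inE => /eqP ->.
(* M-th powers are trivial on o. For u of value p^n b c, with b inverse to the prime-to-p part of M,
   the automorphisms u^M and s^(p^r0) have the same value in Z_p. *)
pose M := #|{perm seq_sub o}|.
have M0 : (0 < M)%N by apply/card_gt0P; exists 1%g.
have /(layer_fix p_pr he n sk)/(zp_divp p_pr)[c ec] := sn.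
have copM : coprime M`_p^' p.
  by rewrite coprime_sym prime_coprime // -p'natE // part_pnat.
have [b hb] := zp_coprime_unit p_pr copM.
have [u [uP uk eu]] := totram (b * c) pP.
pose r0 := logn p M.
have r0E : (M`_p)%N = (p ^ r0)%N by rewrite p_part.
pose v := (s ^+ (p ^ r0) * u ^- (M`_p^' * p ^ r0))%g.
have uo y : y \in o -> (u ^+ (M`_p^' * p ^ r0))%g y = y.
  rewrite -r0E mulnC partnC //; apply: (rep_eq1 aut_act1 aut_actM _).1; first exact/ho/fixesX.
  rewrite (repX aut_act1 aut_actM); last exact: ho.
  by rewrite /M -cardsT expg_cardG // inE.
have vK : fixes K v.
  apply/(zh0 he); first exact/fixesM/fixesV/fixesX/uk/fixesX.
  rewrite (zhM he (fixesX _ sk) (fixesV (fixesX _ uk))) (zeV he (fixesX _ uk)) !(zeX he) //.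
  rewrite ec eu natrM.
  have assoc (a1 a2 a3 a4 a5 : Zp p) : a1 * a2 * (a3 * (a4 * a5)) = a2 * (a3 * (a1 * a4 * a5)).
    by rewrite [a1 * a2]mulrC -!mulrA; congr (_ * _); rewrite mulrCA.
  by rewrite assoc hb mul1r subrr.
have sv : {in o, (s ^+ (p ^ r0))%g =1 v}.
  move=> y yo; rewrite /v autM; congr ((s ^+ _)%g _).
  by apply/esym/aut_fixV; exact: uo.
have [_ _ tL _] := max_unr p_pr K.
have [r hr] := tL v vK x xL; exists (r0 + r)%N.
have xo : x \in o by apply: So; rewrite mem_head.
have vk : fixes k v by exact: fixes_sup (zext_sub he) vK.
by have [h _] := stab_powers (p ^ r) sv (ho v vk) xo; rewrite expnD expgnA h hr.
Qed.
End Core.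

(** The preimage of p^m X(F) in the automorphisms over F. *)
Definition pth_power (p : nat) (F : subfield) (m : nat) : set aut := fun s =>
  fixes F s /\ exists2 v, fixes F v & forall x, x \in max_unram p F -> s x = (v ^+ (p ^ m))%g x.

Lemma pth_power_subgroup p F m : prime p -> is_subgroup (pth_power p F m).
Proof.
move=> p_pr; have [[_ stL] abL _ _] := max_unr p_pr F.
split; first by split; [exact: fixes1 | exists 1%g; [exact: fixes1 | move=> x _; rewrite expg1n]].
move=> s t [sF [v vF hv]] [tF [w wF hw]]; split; first exact/fixesM/fixesV.
exists (v * w^-1)%g; first exact/fixesM/fixesV.
have powM q x : x \in max_unram p F -> ((v * w^-1) ^+ q)%g x = (v ^+ q)%g ((w^-1 ^+ q)%g x).
  elim: q x => [|q IH] x xL //; rewrite !expgS !autM IH //; congr (v _).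
  apply: abL; [exact: fixesV | exact: (fixesX q vF) |].
  by apply: stL => //; apply: fixesX; exact: fixesV.
move=> x xL; rewrite powM // expVgn autM.
have txL : t^-1%g x \in max_unram p F by apply: stL => //; exact: fixesV.
rewrite hv //; congr ((v ^+ _)%g _).
by apply: (@aut_inj (w ^+ (p ^ m))%g); rewrite autVK -hw // autVK.
Qed.

(** * Finite quotients of Gal(L/K_n) *)

Section Core2.
Variables (p : nat) (p_pr : prime p) (k K : subfield) (k_nf : number_field k).
Variables (e : aut -> Zp p) (he : zext_hom k K e).
Local Notation Lm := (max_unram p).
Local Notation L := (max_unram p K).
Local Notation Kn := (layer p k K).
Variables n m : nat.
Hypothesis totram : totally_ramified k e n.

Definition inertial_over (j : nat) (s : aut) : Prop :=
  fixes (Kn j) s /\ exists2 P : prime_idealr O, p%:R \in P & inertial P s.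

Let nL : normal_ext k L := max_unram_normal p_pr he.
Let uL := max_unr p_pr K.
Let KkF s : fixes K s -> fixes k s := @fixes_sup _ _ s (zext_sub he).
Let skL : {subset k <= L}. Proof. by case: nL. Qed.

Lemma fixesK_layer j s : fixes K s -> fixes (Kn j) s.
Proof. exact/fixes_sup/layer_le. Qed.

Lemma L_abelian s t x : fixes K s -> fixes K t -> x \in L -> s (t x) = t (s x).
Proof. by case: uL => _ h _ _ hs ht; exact: h. Qed.

Lemma L_unram s : fixes K s -> ramified s -> fixes L s.
Proof. by case: uL => _ _ _ h; exact: h. Qed.

Variable o : seq algC.
Hypotheses (oL : {subset o <= L}) (ho : forall s, fixes k s -> stab aut_act o s).
Local Notation rho := (rep aut_act o).

Let ho_layer j s : fixes (Kn j) s -> stab aut_act o s.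
Proof. by move=> h; exact/ho/(fixes_layer he h). Qed.
Let ho_K s : fixes K s -> stab aut_act o s.
Proof. by move=> h; exact/ho/KkF. Qed.
Let ho_pth s : pth_power p K m s -> stab aut_act o s.
Proof. by case=> h _; exact: ho_K. Qed.

Definition layer_group j := rep_group aut_act1 aut_actM (fixes_subgroup (Kn j)) (@ho_layer j).
Definition top_group := rep_group aut_act1 aut_actM (fixes_subgroup K) ho_K.
Definition power_group := rep_group aut_act1 aut_actM (pth_power_subgroup K m p_pr) ho_pth.
Definition inertia_set j := rep_set aut_act o (inertial_over j).

Lemma layer_group_pgroup j : (n <= j)%N -> (p.-group (layer_group j))%g.
Proof.
move=> nj; apply: rep_pgroup => // s sj x xo.
apply: (unram_torsion p_pr he totram) (oL xo).
exact: fixes_sup (layer_mono nj) sj.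
Qed.

(* The fixed field D of {s | rho s in M} is unramified over the j-th layer, with
   Galois group a quotient of X(K)/p^m; so D lies in L(K_j) and is fixed by the
   p^m-th powers. *)
Lemma fixing_power_mem j (M : {group {perm seq_sub o}}) s t : (n <= j)%N ->
  inertia_set j \subset M -> power_group \subset M -> layer_group j \subset ('N(M))%g ->
  fixes (Kn j) s -> fixes (Kn j) t ->
  (forall x, x \in Lm (Kn j) -> s x = (t ^+ (p ^ m))%g x) -> rho s \in M.
Proof.
move=> nj IM ZM nM sj tj hst.
pose H : set aut := fun a => fixes (Kn j) a /\ rho a \in M.
have Hg : is_subgroup H.
  split; first by split; [exact: fixes1 | rewrite (rep1 o aut_act1 aut_actM); apply: group1].
  move=> a b [aj aM] [bj bM]; split; first exact/fixesM/fixesV.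
  rewrite repM ?repV ?groupM ?groupV //; try exact: ho_layer bj; try exact: ho_layer aj.
  by apply: (stabV aut_act1 aut_actM); exact: ho_layer bj.
pose D := fixed_sub H.
have DL : {subset D <= L}.
  move=> x /fixed_subP hx; apply: fixed_mem => a aL; apply: hx; split.
    by apply: fixesK_layer; exact: fixes_sup (sub_max_unram p_pr (K := K)) aL.
  rewrite (rep_eq1 aut_act1 aut_actM _).2 ?group1 //.
    by apply: ho; exact: fixes_sup skL aL.
  by move=> y yo; apply: aL; exact: oL.
have DD x a : x \in D -> fixes (Kn j) a -> a x \in D.
  move=> /fixed_subP hx aj; apply/fixed_subP => b [bj bM].
  have ab : H (a^-1 * b * a)%g.
    split; first by apply: fixesM => //; apply: fixesM => //; exact: fixesV.
    have sa := ho_layer aj; have sb := ho_layer bj.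
    have sa' : stab aut_act o a^-1%g by exact: (stabV aut_act1 aut_actM).
    rewrite repM //; last exact: stabM.
    rewrite (repM aut_act1 aut_actM sa' sb) (repV aut_act1 aut_actM sa).
    rewrite -mulgA -conjgE memJ_norm //; apply: (fintype.subsetP nM).
    exact: mem_rep_set.
  by have := congr1 a (hx _ ab); rewrite !autM autVK.
have [P0 p0P] := prime_above p_pr.
(* Dividing by an inertial element of the same value, which belongs to H, changes nothing on D and
   leads to an element over K. So D/K_j inherits commutativity and exponent p^m from X(K)/p^m. *)
have toK a : fixes (Kn j) a -> exists2 v, fixes K v & forall x, x \in D -> a x = v x.
  move=> aj; have ak := fixes_layer he aj.
  have an : fixes (Kn n) a by exact: fixes_sup (layer_mono nj) aj.
  have [u [uP uk eu]] := totram_exists p_pr he totram an p0P.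
  have uj : fixes (Kn j) u.
    by apply/(layer_fix p_pr he) => //; rewrite eu; apply/(layer_fix p_pr he).
  have uH : H u.
    split=> //; apply: (fintype.subsetP IM); apply: mem_rep_set; split=> //.
    by exists P0.
  exists (a * u^-1)%g.
    apply/(zh0 he); first exact/fixesM/fixesV.
    by rewrite (zhM he ak (fixesV uk)) (zeV he uk) eu subrr.
  move=> x /fixed_subP hx; rewrite autM; congr (a _).
  by apply/esym/aut_fixV; exact: hx.
have expD a x : fixes (Kn j) a -> x \in D -> (a ^+ (p ^ m))%g x = x.
  move=> aj xD; have [v vK av] := toK a aj.
  have vk := KkF vK; have vj : fixes (Kn j) v by exact: fixesK_layer.
  have -> : (a ^+ (p ^ m))%g x = (v ^+ (p ^ m))%g x.
    elim: (p ^ m)%N => [|q IH] //; rewrite !expgS !autM IH av //.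
    by apply: DD => //; exact: fixesX.
  move: xD => /fixed_subP; apply; split; first exact: fixesX.
  apply: (fintype.subsetP ZM); apply: mem_rep_set; split; first exact: fixesX.
  by exists v.
have uD : unr p (Kn j) D.
  split.
  - split=> [x xj|a aj x xD]; last exact: DD.
    by apply/fixed_subP => a [aj _]; exact: aj.
  - move=> a b aj bj x xD; have [v vK av] := toK a aj; have [w wK bw] := toK b bj.
    rewrite av; last exact: DD.
    rewrite bw // [in RHS]bw; last exact: DD.
    by rewrite av // L_abelian //; exact: DL.
  - by move=> a aj x xD; exists m; exact: expD.
  (* At an archimedean place or a prime not above p, a fixes K and L/K is unramified; at a prime
     above p, a belongs to H. *)
  - move=> a aj ra x xD.
    have aK_ok : fixes K a -> a x = x.
      by move=> aK; apply: (L_unram aK ra); exact: DL.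
    have ak := fixes_layer he aj.
    case: (ra) => [[P [P0' aP]]|ac]; last first.
      by apply: aK_ok => y yK; apply: (zext_unramified_inf p_pr he ac ak) yK.
    have [pP|pP] := boolP (p%:R \in P); last first.
      by apply: aK_ok; exact: (zext_unramified_away p_pr he k_nf P0' pP aP ak).
    move: xD => /fixed_subP; apply; split=> //.
    apply: (fintype.subsetP IM); apply: mem_rep_set; split=> //.
    by exists P.
have DLj := unr_max p_pr uD.
have [|h [hj hM] sh] := @aut_density H s o Hg.
  by move=> x /fixed_subP xD; rewrite hst ?expD //; exact: DLj.
rewrite (_ : rho s = rho h) //.
by apply/(rep_eq aut_act1 aut_actM (ho_layer sj) (ho_layer hj)) => x xo; exact: sh.
Qed.
End Core2.

(* With L the maximal unramified abelian pro-p extension, this says that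
   X(K_(n+1)) / p^m -> X(K_n) / p^m is injective. *)
Definition stable_at (p : nat) (k K : subfield) n m := forall s, fixes (layer p k K n.+1) s ->
  pth_power p (layer p k K n) m s -> pth_power p (layer p k K n.+1) m s.

(** * Fukuda's descent *)

Section Fukuda.
Variables (p : nat) (p_pr : prime p) (k K : subfield) (k_nf : number_field k).
Variables (e : aut -> Zp p) (he : zext_hom k K e).
Local Notation Lm := (max_unram p).
Local Notation L := (max_unram p K).
Local Notation Kn := (layer p k K).
Variables n m : nat.
Hypothesis totram : totally_ramified k e n.
Hypothesis stable : stable_at p k K n m.

Let nL : normal_ext k L := max_unram_normal p_pr he.
Let KkF s : fixes K s -> fixes k s := @fixes_sup _ _ s (zext_sub he).
Let lk j s : fixes (Kn j) s -> fixes k s :=  @fixes_layer p k K e he j s.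

Lemma layer_conj j s t : fixes (Kn j) s -> fixes (Kn j) t -> fixes (Kn j) (s^-1 * t * s)%g.
Proof. by move=> hs ht; apply: fixesM => //; apply: fixesM => //; exact: fixesV. Qed.

Lemma normal_conj (F E : subfield) s t : normal_ext F E -> fixes F s -> fixes E t ->
  fixes E (s^-1 * t * s)%g.
Proof. by move=> [_ stE] hs ht x xE; rewrite !autM ht ?autK //; exact: stE. Qed.

Lemma inertial_over_conj j s t : fixes (Kn j) s -> inertial_over p k K j t ->
  inertial_over p k K j (s^-1 * t * s)%g.
Proof.
move=> hs [ht [P pP tP]]; split; first exact: layer_conj.
have [P' hP'] := prime_preim P s; exists P'; first by rewrite hP' rmorph_nat.
rewrite -{2}[s]invgK; apply: inertial_conj tP => z zP.
by rewrite hP' oactVK.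
Qed.

Lemma pth_power_conj s t : fixes k s -> pth_power p K m t ->
  pth_power p K m (s^-1 * t * s)%g.
Proof.
move=> hs [ht [v hv tv]]; split; first exact: (normal_conj (zhN he)).
exists (s^-1 * v * s)%g; first exact: (normal_conj (zhN he)).
move=> x xL; have -> : ((s^-1 * v * s) ^+ (p ^ m))%g = (s^-1 * v ^+ (p ^ m) * s)%g.
  by have := conjXg v s (p ^ m); rewrite !conjgE !mulgA => ->.
by rewrite !autM tv //; apply: (proj2 nL).
Qed.

Lemma rep_detect (l o : seq algC) M : (forall s, fixes k s -> stab aut_act o s) ->
  {subset l <= o} ->
  (forall s t, fixes k s -> fixes k t -> {in l, s =1 t} -> zp_seq (e s) M = zp_seq (e t) M) ->
  forall s t, fixes k s -> fixes k t -> rep aut_act o s = rep aut_act o t ->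
    zp_seq (e s) M = zp_seq (e t) M.
Proof.
move=> ho lo det s t hs ht /(rep_eq aut_act1 aut_actM (ho s hs) (ho t ht)) est.
by apply: det => // x /lo; exact: est.
Qed.

Section Finite.
Variable o : seq algC.
Hypotheses (oL : {subset o <= L}) (ho : forall s, fixes k s -> stab aut_act o s).
Hypothesis det : forall s t, fixes k s -> fixes k t -> rep aut_act o s = rep aut_act o t ->
  zp_seq (e s) n.+1 = zp_seq (e t) n.+1.
Variables (P0 : prime_idealr O) (t0 : aut).
Hypotheses (p0P : p%:R \in P0) (t0P : inertial P0 t0) (t0k : fixes k t0) (et0 : e t0 = (p ^ n)%:R).
Hypothesis t0V : forall i v, fixes K v -> rep aut_act o (t0 ^+ i)%g = rep aut_act o v ->
  rep aut_act o (t0 ^+ i)%g = 1%g.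

Local Notation rho := (rep aut_act o).
Local Notation G := (layer_group he ho n).
Local Notation V := (top_group he ho).
Local Notation Z := (power_group p_pr he m ho).
Local Notation I j := (inertia_set p k K o j).
Local Notation N j := (<<I j :|: Z>>)%G.

Let rM s t : fixes k s -> fixes k t -> rho (s * t)%g = (rho s * rho t)%g.
Proof. by move=> hs ht; rewrite (repM aut_act1 aut_actM) //; exact: ho. Qed.
Let rV s : fixes k s -> rho s^-1%g = (rho s)^-1%g.
Proof. by move=> hs; rewrite (repV aut_act1 aut_actM) //; exact: ho. Qed.
Let rX s i : fixes k s -> rho (s ^+ i)%g = (rho s ^+ i)%g.
Proof. by move=> hs; rewrite (repX aut_act1 aut_actM) //; exact: ho. Qed.

Lemma inertia_gen_norm j : layer_group he ho j \subset ('N(N j))%g.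
Proof.
apply: norms_gen; apply: normsU; apply: rep_set_norm => s.
- by case=> /lk h _; exact: ho.
- by move/lk; exact: ho.
- move=> t; exact: inertial_over_conj.
- by case=> /KkF h _; exact: ho.
- by move/lk; exact: ho.
- by move=> t /lk; exact: pth_power_conj.
Qed.

Lemma inertia_gen_sub : N n \subset G.
Proof.
rewrite gen_subG finset.subUset; apply/andP; split; apply/fintype.subsetP => _ /rep_setP[s hs <-].
  by case: hs => hs _; exact: mem_rep_set.
by case: hs => hs _; apply: mem_rep_set; apply: fixesK_layer.
Qed.

Lemma inertia_set_sub j : I j \subset N j.
Proof. exact: fintype.subset_trans (finset.subsetUl _ _) (subset_gen _). Qed.
Lemma power_group_sub j : Z \subset N j.
Proof. exact: fintype.subset_trans (finset.subsetUr _ _) (subset_gen _). Qed.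

(** Prescribing the exact value p^n makes any two elements of [T] differ by an element of V, as
    [pgroup_descent] requires. *)
Let T : {set {perm seq_sub o}} :=
  rep_set aut_act o (fun s => [/\ fixes k s, e s = (p ^ n)%:R
    & exists2 P : prime_idealr O, p%:R \in P & inertial P s]).

Lemma T_sub : T \subset I n.
Proof.
apply/fintype.subsetP => _ /rep_setP[s [sk es hP] <-]; apply: mem_rep_set; split=> //.
by apply/(layer_fix p_pr he) => //; rewrite es -[_%:R]mulr1 zp_seq_pM.
Qed.

(* The inertia over the layer n.+1 is generated, up to elements acting trivially
   on o, by the p-th powers of the generators of the inertia over the layer n. *)
Lemma inertia_gen_next : (N n.+1 \subset <<[set t ^+ p | t in T]%SET :|: Z>>)%g.
Proof.
rewrite gen_subG finset.subUset; apply/andP; split; last exact: fintype.subset_trans (finset.subsetUr _ _) (subset_gen _).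
apply/fintype.subsetP => _ /rep_setP[s [sn [P pP sP]] <-].
have sk := lk sn.
have /(layer_fix p_pr he _ sk)/(zp_divp p_pr)[c ec] := sn.
(* Since G has order p^M, splitting c as i + p^M b leaves only the part t^(p i) visible on o;
   inertial elements with equal values agree on L. *)
have pG : (p.-group G)%g by exact: (@layer_group_pgroup p p_pr k K e he n totram o oL ho n (leqnn n)).
have [M hM] := p_natP pG.
have [i [b [_ ecb]]] := zp_digit p_pr M c.
have [t [tP tk et]] := totram 1 pP.
have [u [uP uk eu]] := totram (p%:R * b) pP.
rewrite mulr1 in et.
have tuP : inertial P (t ^+ (p * i) * u ^+ (p ^ M))%g by apply: inertialM; exact: inertialX.
have tuk : fixes k (t ^+ (p * i) * u ^+ (p ^ M))%g by apply: fixesM; exact: fixesX.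
have est : e s = e (t ^+ (p * i) * u ^+ (p ^ M))%g.
  rewrite (zhM he) ?(zeX he) //; [|exact: fixesX|exact: fixesX].
  rewrite ec ecb et eu expnS !natrM mulrDr; congr (_ + _).
    by rewrite mulrAC.
  by rewrite -mulrA [LHS]mulrCA [RHS]mulrCA; congr (_ * _); rewrite mulrCA.
have -> : rho s = (rho t ^+ (p * i))%g.
  have -> : rho s = rho (t ^+ (p * i) * u ^+ (p ^ M))%g.
    apply/(rep_eq aut_act1 aut_actM (ho sk) (ho tuk)) => x /oL xL.
    exact: (inertial_uniq p_pr he pP sP tuP).
  rewrite rM ?rX //; [|exact: fixesX|exact: fixesX].
  rewrite -hM [X in (_ * X)%g](_ : _ = 1%g) ?mulg1 //.
  apply: expg_cardG; apply: mem_rep_set; apply/(layer_fix p_pr he) => //.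
  by rewrite eu zp_seq_pM.
rewrite expgM groupX // mem_gen // inE; apply/orP; left.
by apply: imset_f; apply: mem_rep_set; split=> //; exists P.
Qed.

(** Inertia is trivial on the maximal unramified extension of K_n, so elements of [N n] come from
    p^m-th powers there. One that also lies in V fixes K_(n+1), as o detects e modulo p^(n+1);
    stability makes it a p^m-th power over K_(n+1), and [fixing_power_mem] applies one level up. *)
Lemma top_inertia_sub : (V :&: N n \subset N n.+1)%g.
Proof.
pose A := pth_power p (Kn n) m.
have Ag : is_subgroup A := pth_power_subgroup (Kn n) m p_pr.
have hA s : A s -> stab aut_act o s by case=> /lk h _; exact: ho.
pose AG := rep_group aut_act1 aut_actM Ag hA.
have sNA : N n \subset AG.
  rewrite gen_subG finset.subUset; apply/andP; split; apply/fintype.subsetP => _ /rep_setP[s hs <-].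
    case: hs => hs [P pP sP]; apply: mem_rep_set; split=> //; exists 1%g; first exact: fixes1.
    move=> x xL; rewrite expg1n; have [_ _ _ un] := max_unr p_pr (Kn n).
    by apply: un xL => //; left; exists P; split=> //; exact: (prime_nonzero p_pr).
  case: hs => hs [v hv sv]; apply: mem_rep_set; split; first exact: fixesK_layer.
  exists v; first exact: fixesK_layer.
  by move=> x /(max_unr_mono p_pr (@layer_le p k K n)); exact: sv.
apply/fintype.subsetP => w; rewrite inE => /andP[/rep_setP[v vK <-]].
move=> /(fintype.subsetP sNA)/rep_setP[a [an [b bn ab]] eav].
have an1 : fixes (Kn n.+1) a.
  apply/(layer_fix p_pr he); first exact: lk an.
  rewrite (det (lk an) (KkF vK) eav) (zh0 he (KkF vK)).2 // zp_seq0 //.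
have [_ [t tn at_]] := stable an1 (conj an (ex_intro2 _ _ b bn ab)).
rewrite -eav; apply: (fixing_power_mem k_nf totram oL _ _ _ _ an1 tn at_) => //.
- exact: inertia_set_sub.
- exact: power_group_sub.
- exact: inertia_gen_norm.
Qed.

Lemma fukuda_perm s : fixes K s -> pth_power p (Kn n) m s -> rho s \in Z.
Proof.
move=> sK [sn [t tn st]].
have pG : (p.-group G)%g by exact: (@layer_group_pgroup p p_pr k K e he n totram o oL ho n (leqnn n)).
have VG : (V <| G)%g.
  apply/andP; split.
    by apply/fintype.subsetP => _ /rep_setP[v hv <-]; apply: mem_rep_set; exact: fixesK_layer.
  apply: rep_set_norm => v; first by move/KkF; exact: ho.
    by move/lk; exact: ho.
  by move=> u /lk; exact: (normal_conj (zhN he)).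
have ZV : Z \subset V.
  by apply/fintype.subsetP => _ /rep_setP[v [hv _] <-]; apply: mem_rep_set.
have ZG : (Z <| G)%g.
  apply/andP; split; first exact: fintype.subset_trans ZV (normal_sub VG).
  apply: rep_set_norm => v; first by case=> /KkF h _; exact: ho.
    by move/lk; exact: ho.
  by move=> u /lk; exact: pth_power_conj.
have NG : (N n <| G)%g by apply/andP; split; [exact: inertia_gen_sub | exact: inertia_gen_norm].
have t0T : rho t0 \in T by apply: mem_rep_set; split=> //; exists P0.
have sub := @pgroup_descent _ p G V Z (N n) (N n.+1) T (rho t0) p_pr pG VG ZG ZV NG (power_group_sub n).
apply: (fintype.subsetP (sub _ _ _ _ inertia_gen_next top_inertia_sub)).
- exact: (fintype.subsetP (fintype.subset_trans T_sub (inertia_set_sub n))).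
- exact: fintype.subset_trans T_sub (inertia_set_sub n).
- move=> _ /rep_setP[v [vk ev _] <-]; rewrite -rV // -rM //; last exact: fixesV.
  apply: mem_rep_set; apply/(zh0 he); first exact/fixesM/fixesV.
  by rewrite (zhM he vk (fixesV t0k)) (zeV he t0k) et0 ev subrr.
- move=> i; rewrite -rX // => /rep_setP[v vK ev].
  by rewrite (t0V vK (esym ev)) group1.
- rewrite inE; apply/andP; split; first exact: mem_rep_set.
  apply: (fixing_power_mem k_nf totram oL _ _ _ _ _ tn st) => //.
  + exact: inertia_set_sub.
  + exact: power_group_sub.
  + exact: inertia_gen_norm.
Qed.
End Finite.
End Fukuda.

Section FukudaMain.
Variables (p : nat) (p_pr : prime p) (k K : subfield) (k_nf : number_field k).
Variables (e : aut -> Zp p) (he : zext_hom k K e).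
Local Notation Lm := (max_unram p).
Local Notation L := (max_unram p K).
Local Notation Kn := (layer p k K).
Variables n m : nat.
Hypothesis totram : totally_ramified k e n.
Hypothesis stable : stable_at p k K n m.

Let nL : normal_ext k L := max_unram_normal p_pr he.
Let KkF s : fixes K s -> fixes k s := @fixes_sup _ _ s (zext_sub he).

Lemma fukuda_finite s (S : seq algC) : fixes K s -> pth_power p (Kn n) m s -> {subset S <= L} ->
  exists2 v, fixes K v & {in S, s =1 (v ^+ (p ^ m))%g}.
Proof.
move=> sK st SL.
have [o0 [So0 oL0 ho0]] := stable_closure nL SL.
have [P0 p0P] := prime_above p_pr.
have [t0 [t0P t0k]] := totram 1 p0P; rewrite mulr1 => et0.
have [r0 hr0] : exists r0, forall x, x \in o0 -> (t0 ^+ (p ^ r0))%g x = x.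
  have t0n : fixes (Kn n) t0.
    by apply/(layer_fix p_pr he) => //; rewrite et0 -[_%:R]mulr1 zp_seq_pM.
  elim: (o0) oL0 => [|x l IH] oL; first by exists 0%N.
  have [|r1 h1] := IH; first by move=> y yl; apply: oL; rewrite inE yl orbT.
  have [r2 h2] := unram_torsion p_pr he totram t0n (oL x (mem_head _ _)).
  exists (maxn r1 r2) => y; rewrite inE => /orP[/eqP ->|yl].
    by apply: aut_fix_leq h2; exact: leq_maxr.
  by apply: aut_fix_leq (h1 y yl); exact: leq_maxl.
(* The precision r0 beyond n + 1 serves [t0V]: if t0^i acts on o like an element over K, then p^r0
   divides i, so t0^i is trivial on o0 and, as an element acting on o1 like one over K, on o1. *)
have [l lK hl] := zh_cont he (n.+1 + r0).
have [o1 [lo1 oK1 ho1]] := stable_closure (zhN he) lK.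
have K1 v x : fixes K v -> x \in o1 -> v x = x by move=> vK /oK1; exact: vK.
pose o := o0 ++ o1.
have oL : {subset o <= L}.
  by move=> x; rewrite mem_cat => /orP[/oL0|/oK1/(sub_max_unram p_pr)].
have ho u : fixes k u -> stab aut_act o u.
  by move=> uk x; rewrite !mem_cat => /orP[/(ho0 u uk) ->|/(ho1 u uk) ->]; rewrite ?orbT.
have lo : {subset l <= o} by move=> x /lo1 h; rewrite mem_cat h orbT.
have det := rep_detect ho lo hl.
have det1 u v : fixes k u -> fixes k v -> rep aut_act o u = rep aut_act o v ->
    zp_seq (e u) n.+1 = zp_seq (e v) n.+1.
  by move=> uk vk /(det u v uk vk); apply: zp_seq_le; exact: leq_addr.
have t0V i v : fixes K v -> rep aut_act o (t0 ^+ i)%g = rep aut_act o v ->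
    rep aut_act o (t0 ^+ i)%g = 1%g.
  move=> vK ev; have tik := fixesX i t0k; apply/(rep_eq1 aut_act1 aut_actM (ho _ tik)) => x.
  rewrite mem_cat => /orP[xo|xo]; last first.
    have /(rep_eq aut_act1 aut_actM (ho _ tik) (ho _ (KkF vK))) h := ev.
    by rewrite h ?mem_cat ?xo ?orbT //; exact: K1.
  have := det _ _ tik (KkF vK) ev.
  rewrite (zeX he _ t0k) et0 (zh0 he (KkF vK)).2 // zp_seq0 => h.
  have : (p ^ r0 %| i)%N.
    move: h; rewrite zp_seq_natM zp_natE => /dvdz_mod0P.
    rewrite modz_nat modn_small; last by rewrite ltn_exp2l ?prime_gt1 // addSn ltnS leq_addr.
    rewrite -PoszM => h.
    have {h} : (p ^ (n.+1 + r0) %| i * p ^ n)%N by [].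
    rewrite addSn -addnS addnC expnD dvdn_pmul2r ?expn_gt0 ?prime_gt0 //.
    by apply: dvdn_trans; exact: dvdn_exp2l.
  case/dvdnP => q ->; rewrite mulnC expgM.
  by apply: aut_fixX; exact: hr0.
have /rep_setP[w [wK [v vK wv]] ew] := fukuda_perm p_pr k_nf he totram stable oL ho det1 p0P t0P t0k et0 t0V sK st.
exists v => // x xS; have xo : x \in o by rewrite mem_cat So0.
have h : w x = s x := (rep_eq aut_act1 aut_actM (ho _ (KkF wK)) (ho _ (KkF sK))).1 ew x xo.
by rewrite -h; apply: wv; exact: oL.
Qed.

(* X(K) / p^m -> X(K_n) / p^m is injective. *)
Lemma fukuda s : fixes K s -> pth_power p (Kn n) m s -> pth_power p K m s.
Proof.
move=> sK st; split=> //.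
pose P (S : seq algC) v := fixes K v /\ forall x, x \in S -> x \in L -> s x = (v ^+ (p ^ m))%g x.
have [||v hv] := @aut_compact P.
- by move=> S T v ST [vK h]; split=> // x /ST; exact: h.
- move=> S; have [|v vK h] := @fukuda_finite s [seq x <- S | x \in L] sK st.
    by move=> x; rewrite mem_filter => /andP[].
  by exists v; split=> // x xS xL; apply: h; rewrite mem_filter xL.
exists v => [x xK|x xL].
  by have [u [uK _] uv] := hv [:: x]; rewrite -uv ?mem_head //; exact: uK.
(* Agreement at x alone says nothing about p^m-th powers; agreement on a stable set does. *)
have [|o [So oL ho]] := stable_closure (S := [:: x]) nL.
  by move=> y; rewrite inE => /eqP ->.
have xo : x \in o by apply: So; rewrite mem_head.
have [u [uK h] uv] := hv o; rewrite h //.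
have vu : {in o, v =1 u} by move=> y yo; rewrite uv.
by have [-> _] := stab_powers (p ^ m) vu (ho _ (KkF uK)) xo.
Qed.
End FukudaMain.

(** [ramifies] tests a single prime of K over Q. To reach a given P, the inertial element is lifted
    to a prime P' of [algC] and conjugated by an automorphism over k that carries P' into P. *)
Lemma E_ramP (p : nat) (k : subfield) (K : Zp_ext p k) : normal_ext k K ->
  E_ram K <-> forall P : prime_idealr O, p%:R \in P ->
    exists s, [/\ inertial P s, fixes k s & ~ fixes K s].
Proof.
move=> nK; have [skK stK] := nK; split=> [ram P pP|h Q pQ].
  have [Q hQ] := prime_restrict k P.
  have pQ : above p Q by rewrite /above hQ rmorph_nat.
  have [PK [PQ [s sP s1]]] := ram Q pQ.
  have [P' hP'] := lying_over PK.
  have [t [tk tE]] := gal_extend s skK.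
  have [z zK|s' s'P es'] := inertial_lift (P := P') (E := K) (t := t).
    have [w wP ew] := sP (down zK).
    rewrite (_ : oact t z - z = up w) ?hP' //; apply: val_inj => /=.
    by rewrite ew -tE.
  have s'k : fixes k s' by move=> x xk; rewrite es' ?tk //; exact: skK.
  have [|u uk uP] := @prime_conj k P' P.
    move=> z zk zP'; rewrite -(downK zk) -hQ.
    rewrite (PQ (down zk) (down (skK _ zk))) // -hP'.
    by rewrite (_ : up _ = z) //; exact: downK.
  exists (u * s' * u^-1)%g; split; first exact: inertial_conj s'P.
    by apply: fixesM; [exact: fixesM | exact: fixesV].
  move=> h; apply: s1; apply: gal_eq => x; apply: val_inj => /=.
  rewrite -tE -es' ?fvalP //; apply: (@aut_inj u).
  have := h (u (fval x)); rewrite !autM autK; apply.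
  by apply: stK => //; exact: fvalP.
have [P hP] := lying_over Q.
have [|s [sP sk sK]] := h P; first by rewrite -(rmorph_nat (@up k)) hP.
have [PK hPK] := prime_restrict K P.
exists PK; split.
  by move=> x y exy; rewrite -hP hPK (_ : up x = up y) //; exact: val_inj.
exists (aut_res nK sk).
  move=> x; have sxK : ival (oact s (up x) - up x) \in K.
    by rewrite rmorphB rpredB //=; [apply: stK => //; exact: ival_sub | exact: ival_sub].
  by exists (down sxK); [rewrite hPK downK; exact: sP | by []].
move=> s1; apply: sK => x xK.
by have := congr1 (fun t : Gal k K => fval (t (MkFsub xK))) s1.
Qed.

(** * Ramification levels and stabilisation *)

Section Totram.
Variables (p : nat) (p_pr : prime p) (k K : subfield) (k_nf : number_field k).
Variables (e : aut -> Zp p) (he : zext_hom k K e).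

Lemma ze_conj s t : fixes k s -> fixes k t -> e (s * t * s^-1)%g = e t.
Proof.
move=> hs ht; rewrite (zhM he (fixesM hs ht) (fixesV hs)) (zhM he hs ht) (zeV he hs).
by rewrite addrAC subrr add0r.
Qed.

(** A value that is nonzero modulo p^(a+1) has valuation j <= a, so by [inertial_power] the inertia
    reaches all of p^j Z_p, which contains p^n Z_p. *)
Lemma totram_ge a : (forall P : prime_idealr O, p%:R \in P ->
    exists t, [/\ inertial P t, fixes k t & zp_seq (e t) a.+1 != 0]) ->
  forall n, (a <= n)%N -> totally_ramified k e n.
Proof.
move=> h n an P c pP; have [t [tP tk et]] := h P pP.
have et0 : e t != 0 by apply: contra et => /eqP ->; rewrite zp_seq0.
have [j [u [u1 eu]]] := zp_decomp p_pr et0.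
have ja : (j <= a)%N.
  rewrite leqNgt; apply: contra et => aj; rewrite eu; apply/eqP.
  by apply: (zp_seq_leq aj); exact: zp_seq_pM.
have [s [sP sk es]] := inertial_power p_pr he ((p ^ (n - j))%:R * c) tP tk eu u1.
by exists s; split=> //; rewrite es mulrA -natrM -expnD subnKC // (leq_trans ja).
Qed.

(** A uniform level exists because the primes above p form finitely many classes up to conjugation
    over k, and conjugation preserves e. *)
Lemma ram_level : (forall P : prime_idealr O, p%:R \in P ->
    exists t, [/\ inertial P t, fixes k t & ~ fixes K t]) ->
  exists a, forall P : prime_idealr O, p%:R \in P ->
    exists t, [/\ inertial P t, fixes k t & zp_seq (e t) a.+1 != 0].
Proof.
move=> h; have [r [Ps [pPs hPs]]] := finitely_many_primes k_nf p_pr.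
have lev i : exists n t, [/\ inertial (Ps i) t, fixes k t & zp_seq (e t) n != 0].
  have [t [tP tk tK]] := h _ (pPs i).
  have : e t != 0 by apply/eqP => /(zh0 he tk).
  by case/(zp_neq0 ) => n hn; exists n, t.
pose f i := projT1 (cid (lev i)); exists (\max_i f i) => P pP.
have [i agr] := hPs P pP.
have [t [tP tk et]] := projT2 (cid (lev i)).
have [|u uk uP] := @prime_conj k (Ps i) P; first by move=> z zk; rewrite -agr.
exists (u * t * u^-1)%g; split; first exact: inertial_conj tP.
  by apply: fixesM; [exact: fixesM | exact: fixesV].
rewrite ze_conj //; apply: contra et => /eqP e0; apply/eqP.
by apply: zp_seq_leq e0; rewrite leqW // leq_bigmax.
Qed.
End Totram.

Lemma subfield_eq (E F : subfield) : {subset E <= F} -> {subset F <= E} -> E = F.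
Proof.
move=> EF FE; have : sf_fun E = sf_fun F.
  by apply/funext => x; apply/idP/idP; [exact: EF | exact: FE].
case: E F {EF FE} => [f hf] [g hg] /= fg.
by subst g; congr MkSubfield; exact: Prop_irrelevance.
Qed.

(** [layer_degree], used inside K and inside K', puts the layers of both fields in the intersection;
    the power condition defining a layer is the same for both. *)
Lemma layer_near (p : nat) (p_pr : prime p) (k K K' : subfield) e e' N :
  zext_hom (p := p) k K e -> zext_hom (p := p) k K' e' ->
  degree_ge k (inter_subfield K' K) (p ^ N) ->
  forall j, (j <= N)%N -> layer p k K j = layer p k K' j.
Proof.
move=> he he' deg j jN.
have sub : {subset k <= inter_subfield K' K}.
  by move=> x xk; rewrite inE (zext_sub he) ?(zext_sub he').
have [subK subK'] : {subset inter_subfield K' K <= K} /\ {subset inter_subfield K' K <= K'}.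
  by split=> x /andP[].
apply: subfield_eq => x xj; have /layerP[_ hx] := xj; apply/layerP; split=> //.
- exact: subK' (layer_degree p_pr he sub subK deg (layer_mono jN xj)).
- exact: subK (layer_degree p_pr he' sub subK' deg (layer_mono jN xj)).
Qed.

Section Stabilisation.
Variables (p : nat) (p_pr : prime p) (k K : subfield) (k_nf : number_field k).
Variables (e : aut -> Zp p) (he : zext_hom k K e).
Local Notation Lm := (max_unram p).
Local Notation Kn := (layer p k K).
Variables m : nat.

Lemma pth_power_mono n1 n2 s : (n1 <= n2)%N -> pth_power p (Kn n2) m s -> pth_power p (Kn n1) m s.
Proof.
move=> le; have sub := layer_mono (p := p) (k := k) (K := K) le.
move=> [s2 [t t2 h]]; split; first exact: fixes_sup sub s2.
by exists t; [exact: fixes_sup sub t2 | move=> x /(max_unr_mono p_pr sub); exact: h].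
Qed.

Lemma pth_power_layer n s : pth_power p K m s -> pth_power p (Kn n) m s.
Proof.
have sub := @layer_le p k K n.
move=> [s2 [t t2 h]]; split; first exact: fixes_sup sub s2.
by exists t; [exact: fixes_sup sub t2 | move=> x /(max_unr_mono p_pr sub); exact: h].
Qed.

(** X(K) maps onto X(K_n): dividing s by an inertial element of the same value gives an automorphism
    over K, and that element is trivial on the unramified extension of K_n. *)
Lemma totram_res n s : totally_ramified k e n -> fixes (Kn n) s ->
  exists2 t, fixes K t & forall x, x \in Lm (Kn n) -> t x = s x.
Proof.
move=> tot sn; have [P pP] := prime_above p_pr.
have [u [uP uk eu]] := totram_exists p_pr he tot sn pP.
have sk := fixes_layer he sn.
have un : fixes (Kn n) u by apply/(layer_fix p_pr he) => //; rewrite eu; apply/(layer_fix p_pr he).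
exists (s * u^-1)%g.
  apply/(zh0 he); first exact/fixesM/fixesV.
  by rewrite (zhM he sk (fixesV uk)) (zeV he uk) eu subrr.
move=> x xL; rewrite autM; congr (s _); apply: aut_fixV.
have [_ _ _ unr] := max_unr p_pr (Kn n).
by apply: unr xL => //; left; exists P; split=> //; exact: (prime_nonzero p_pr).
Qed.

(** Failure at every level a + n gives s_n over K that is a p^m-th power at level a + n but not at
    the next. For i < j, s_j is one at level a + i + 1 and s_i is not, so all the s_n are distinct
    in X(K)/p^m. *)
Lemma stable_exists a B : (forall n, (a <= n)%N -> totally_ramified k e n) ->
  (forall s : nat -> aut, (forall i, fixes K (s i)) ->
    exists i j, (i < j <= B)%N /\ pth_power p K m (s i * (s j)^-1)%g) ->
  exists2 n, (a <= n)%N & stable_at p k K n m.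
Proof.
move=> tot fin; apply: contrapT => nex.
have bad n : exists s, [/\ fixes K s, pth_power p (Kn (a + n)) m s & ~ pth_power p (Kn (a + n).+1) m s].
  apply: contrapT => nbad; apply: nex; exists (a + n)%N; first exact: leq_addr.
  move=> s s1 sn; have [t tK ts] := totram_res (tot (a + n).+1 (leqW (leq_addr _ _))) s1.
  have [t1 [v v1 tv]] : pth_power p (Kn (a + n).+1) m t.
    apply: contrapT => nt; apply: nbad; exists t; split=> //.
    have [_ [v vn sv]] := sn; split; first by apply: fixes_sup tK; exact: layer_le.
    exists v => // x xL; rewrite ts ?sv //.
    by apply: (max_unr_mono p_pr (layer_mono (leqnSn _))).
  by split=> //; exists v => // x xL; rewrite -ts // tv.
pose s n := projT1 (cid (bad n)).
have hs n := projT2 (cid (bad n)).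
have [|i [j [/andP[ij _] h]]] := fin s; first by move=> i; case: (hs i).
have [_ _] := hs i; apply; have [_ sj _] := hs j.
have [_ mul] := pth_power_subgroup (Kn (a + i).+1) m p_pr.
have sj' : pth_power p (Kn (a + i).+1) m (s j).
  by apply: pth_power_mono sj; rewrite -addnS leq_add2l.
have -> : projT1 (cid (bad i)) = (s i * (s j)^-1 * (s j)^-1^-1)%g by rewrite invgK mulgKV.
apply: mul; first exact: pth_power_layer h.
exact: (subgroupV (pth_power_subgroup _ m p_pr) sj').
Qed.
End Stabilisation.

(** * Modules over Z_p *)

Section ZpModule.
Variables (p : nat) (p_pr : prime p).
Local Notation R := (Zp p).

Lemma zp_one_neq0 : (1 : R) != 0.
Proof. by have := zp_pneq0 p_pr 0; rewrite expn0. Qed.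

(** Gaussian elimination without division: each row is multiplied by the pivot [a] before
    subtraction, and Z_p being a domain keeps the solution nonzero. *)
Lemma left_kernel g (A : 'I_g.+1 -> 'I_g -> R) :
  exists2 c : 'I_g.+1 -> R, (exists j, c j != 0) & forall i, \sum_j c j * A j i = 0.
Proof.
elim: g A => [|g IH] A.
  by exists (fun=> 1); [exists ord0; exact: zp_one_neq0 | case].
have [[i0 a0]|z] := pselect (exists i0, A i0 ord0 != 0); last first.
  have [c [j cj] hc] := IH (fun j i => A (lift ord0 j) (lift ord0 i)).
  exists (fun j => if unlift ord0 j is Some j' then c j' else 0).
    by exists (lift ord0 j); rewrite liftK.
  move=> i; have [i'|] := unliftP ord0 i; last first.
    move=> ->; rewrite big1 // => j' _.
    by rewrite (_ : A j' ord0 = 0) ?mulr0 //; apply/eqP/negPn/negP => h; apply: z; exists j'.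
  move=> ->; rewrite big_ord_recl unlift_none mul0r add0r -[RHS](hc i').
  by apply: eq_bigr => j' _; rewrite liftK.
set a := A i0 ord0 in a0.
have [c [j cj] hc] := IH (fun j i => a * A (lift i0 j) (lift ord0 i) - A (lift i0 j) ord0 * A i0 (lift ord0 i)).
exists (fun j => if unlift i0 j is Some j' then c j' * a else - \sum_j' c j' * A (lift i0 j') ord0).
  exists (lift i0 j); rewrite liftK; apply/eqP => /(zp_domain p_pr)[h|h].
    by rewrite h eqxx in cj.
  by rewrite h eqxx in a0.
have D1 (F : 'I_g.+2 -> R) : \sum_j F j = F i0 + \sum_j F (lift i0 j) by exact: bigD1_ord.
move=> i; rewrite D1 unlift_none.
have [i'|] := unliftP ord0 i => ->.
  rewrite mulNr mulr_suml addrC; apply/eqP; rewrite subr_eq0 -subr_eq0 -sumrB; apply/eqP.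
  rewrite -[RHS](hc i'); apply: eq_bigr => j' _; rewrite liftK mulrBr !mulrA.
  by [].
rewrite mulNr mulr_suml addrC; apply/eqP; rewrite subr_eq0; apply/eqP.
by apply: eq_bigr => j' _; rewrite liftK -!mulrA; congr (_ * _); rewrite mulrC.
Qed.

Variable M : lmodType R.

Lemma indep_le_gen g n (v : 'I_g -> M) (w : 'I_n -> M) :
  (forall x, exists a, x = \sum_i a i *: v i) -> lin_indep w -> (n <= g)%N.
Proof.
move=> gen ind; rewrite leqNgt; apply/negP => lt.
pose u (j : 'I_g.+1) := w (widen_ord lt j).
pose A j := projT1 (cid (gen (u j))).
have hA j : u j = \sum_i A j i *: v i by exact: projT2 (cid (gen (u j))).
have [c [j cj] hc] := left_kernel A.
pose c' (i : 'I_n) := if insub (val i) is Some j then c j else 0 : R.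
have cE k : c' (widen_ord lt k) = c k by rewrite /c' /= valK.
move/eqP: cj; apply; rewrite -cE; apply: ind.
rewrite (bigID (fun i : 'I_n => (i < g.+1)%N)) /= [X in _ + X]big1 ?addr0; last first.
  by move=> i ig; rewrite /c' insubF ?scale0r //; exact/negbTE.
rewrite (big_ord_narrow lt) /=.
transitivity (\sum_j (\sum_i (c j * A j i) *: v i)).
  apply: eq_bigr => k _; rewrite cE -/(u k) hA scaler_sumr.
  by apply: eq_bigr => i _; rewrite scalerA.
rewrite exchange_big big1 // => i _.
by rewrite -scaler_suml hc scale0r.
Qed.

Lemma rank_exists : fin_gen M -> exists r, has_rank M r.
Proof.
move=> [g [v gen]].
have ex : exists n, `[< exists w : 'I_n -> M, lin_indep w >].
  by exists 0%N; apply/asboolP; exists (fun=> 0) => a _ [].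
have le n : `[< exists w : 'I_n -> M, lin_indep w >] -> (n <= g)%N.
  by move=> /asboolP[w]; exact: indep_le_gen.
case: (ex_maxnP ex le) => r /asboolP[w hw] hr; exists r; split; first by exists w.
by move=> n u hu; apply: hr; apply/asboolP; exists u.
Qed.

(** By maximality x is related to the independent family, with a nonzero coefficient on x; that
    coefficient is a power of p times a unit. *)
Lemma rank_span r (w : 'I_r -> M) x : has_rank M r -> lin_indep w ->
  exists j a, (p ^ j)%:R *: x = \sum_i a i *: w i.
Proof.
move=> [_ mx] ind.
pose u (i : 'I_r.+1) := if unlift ord0 i is Some i' then w i' else x.
have : ~ lin_indep u by move/mx; rewrite ltnn.
move=> nind; have [a [ea [i0 ai0]]] : exists a : 'I_r.+1 -> R, \sum_i a i *: u i = 0 /\ exists i, a i <> 0.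
  apply: contrapT => h; apply: nind => a ea i; apply: contrapT => ai.
  by apply: h; exists a; split=> //; exists i.
have es : a ord0 *: x + \sum_i a (lift ord0 i) *: w i = 0.
  rewrite -[RHS]ea big_ord_recl /u unlift_none; congr (_ + _).
  by apply: eq_bigr => i _; rewrite liftK.
have b0 : a ord0 != 0.
  apply/eqP => h; apply: ai0; have [i|->] := unliftP ord0 i0 => [->|//].
  by apply: (ind (fun i => a (lift ord0 i))); rewrite h scale0r add0r in es.
have [j [b [hb eb]]] := zp_decomp p_pr b0; have [c bc] := zp_unit p_pr hb.
exists j, (fun i => - (c * a (lift ord0 i))).
transitivity (c *: (a ord0 *: x)).
  by rewrite eb scalerA mulrCA [c * b]mulrC bc mulr1.
move/eqP: es; rewrite addr_eq0 => /eqP ->.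
rewrite scalerN scaler_sumr -sumrN; apply: eq_bigr => i _.
by rewrite scaleNr scalerA.
Qed.

Lemma rank_span_uniform r (w : 'I_r -> M) : fin_gen M -> has_rank M r -> lin_indep w ->
  exists c, forall x, exists a, (p ^ c)%:R *: x = \sum_i a i *: w i.
Proof.
move=> [g [v gen]] rk ind.
pose f i := projT1 (cid (rank_span (v i) rk ind)).
have hf i : exists a, (p ^ f i)%:R *: v i = \sum_i a i *: w i.
  exact: projT2 (cid (rank_span (v i) rk ind)).
exists (\max_i f i) => x; have [b ->] := gen x.
have hc i : exists a, (p ^ (\max_i f i))%:R *: v i = \sum_i a i *: w i.
  have [a ea] := hf i; exists (fun k => (p ^ (\max_i f i - f i))%:R * a k).
  rewrite -{1}(subnK (leq_bigmax i)) expnD natrM -scalerA ea scaler_sumr.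
  by apply: eq_bigr => k _; rewrite scalerA.
pose a i := projT1 (cid (hc i)).
have ha i : (p ^ (\max_i f i))%:R *: v i = \sum_k a i k *: w k by exact: projT2 (cid (hc i)).
exists (fun k => \sum_i b i * a i k).
rewrite scaler_sumr; transitivity (\sum_i \sum_k (b i * a i k) *: w k).
  apply: eq_bigr => i _; rewrite scalerA mulrC -scalerA ha scaler_sumr.
  by apply: eq_bigr => k _; rewrite scalerA.
rewrite exchange_big; apply: eq_bigr => k _; by rewrite -scaler_suml.
Qed.

(* M / p^m M has at most B elements. *)
Definition covered m B := exists x : 'I_B -> M, forall s, exists a u, s = x a + (p ^ m)%:R *: u.

Lemma covered_fin m (T : finType) (x : T -> M) :
  (forall s, exists a u, s = x a + (p ^ m)%:R *: u) -> covered m #|T|.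
Proof.
move=> h; exists (x \o enum_val) => s; have [a [u ->]] := h s.
by exists (enum_rank a), u; rewrite /= enum_rankK.
Qed.

Lemma covered_rank r : fin_gen M -> has_rank M r -> exists c, forall m, covered m (p ^ (m * r + c)).
Proof.
move=> fg rk; have [[w ind] _] := rk.
have [c hc] := rank_span_uniform fg rk ind; have [g [v gen]] := fg.
(* Coordinates on the g generators are reduced modulo p^c. The remainder lies in p^c M, hence in the
   span of w, where r coordinates are reduced modulo p^m. *)
exists (c * g)%N => m.
pose T : finType := ({ffun 'I_r -> 'I_(p ^ m)} * {ffun 'I_g -> 'I_(p ^ c)})%type.
have cT : #|T| = (p ^ (m * r + c * g))%N.
  by rewrite card_prod !card_ffun !card_ord -!expnM -expnD.
pose x (t : T) := \sum_i (t.1 i : nat)%:R *: w i + \sum_i (t.2 i : nat)%:R *: v i.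
rewrite -cT; apply: (@covered_fin m T x) => s.
have dig N n (a : 'I_n -> R) : exists (f : {ffun 'I_n -> 'I_(p ^ N)}) (b : 'I_n -> R),
    forall i, a i = (f i : nat)%:R + (p ^ N)%:R * b i.
  have ex i : exists d : 'I_(p ^ N) * R, a i = (d.1 : nat)%:R + (p ^ N)%:R * d.2.
    by have [d [b [lt ea]]] := zp_digit p_pr N (a i); exists (Ordinal lt, b).
  exists [ffun i => (projT1 (cid (ex i))).1], (fun i => (projT1 (cid (ex i))).2) => i.
  by rewrite ffunE; exact: projT2 (cid (ex i)).
have [a es] := gen s; have [f [b hb]] := dig c g a.
have [a' ea'] := hc (\sum_i b i *: v i); have [f' [b' hb']] := dig m r a'.
exists (f', f), (\sum_i b' i *: w i); rewrite /x /= es.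
rewrite (eq_bigr (fun i => (f i : nat)%:R *: v i + (p ^ c)%:R *: (b i *: v i))); last first.
  by move=> i _; rewrite hb scalerDl scalerA.
rewrite big_split -scaler_sumr ea' /=.
have -> : \sum_i a' i *: w i = \sum_i (f' i : nat)%:R *: w i + (p ^ m)%:R *: \sum_i b' i *: w i.
  rewrite scaler_sumr -big_split; apply: eq_bigr => i _.
  by rewrite hb' scalerDl scalerA.
by rewrite addrA [X in X + _]addrC.
Qed.

Lemma covered_pow m B N : covered m B -> covered (m * N) (B ^ N).
Proof.
move=> [x hx]; elim: N => [|N [y hy]].
  by rewrite muln0 expn0; exists (fun=> 0) => s; exists ord0, s; rewrite add0r expn0 scale1r.
pose T : finType := ('I_B * 'I_(B ^ N))%type.
have cT : #|T| = (B ^ N.+1)%N by rewrite card_prod !card_ord expnS.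
rewrite -cT; apply: (@covered_fin _ T (fun t => x t.1 + (p ^ m)%:R *: y t.2)) => s.
have [a [u ->]] := hx s; have [b [u' ->]] := hy u; exists (a, b), u'.
by rewrite /= scalerDr scalerA -natrM -expnD -mulnS addrA.
Qed.

(** As p^c M lies in the span of w, combinations of w with coefficients in [0, p^N) stay distinct
    modulo p^(c+N) M. *)
Lemma covered_lower r N B c (w : 'I_r -> M) : lin_indep w ->
  (forall x, exists a, (p ^ c)%:R *: x = \sum_i a i *: w i) ->
  covered (c + N) B -> (p ^ (N * r) <= B)%N.
Proof.
move=> ind hc [x hx].
pose T : finType := {ffun 'I_r -> 'I_(p ^ N)}.
pose s (f : T) := \sum_i (f i : nat)%:R *: w i.
pose cl f := projT1 (cid (hx (s f))).
have hcl f : exists u, s f = x (cl f) + (p ^ (c + N))%:R *: u by exact: projT2 (cid (hx (s f))).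
have inj : injective cl.
  move=> f f' ef; have [u eu] := hcl f; have [u' eu'] := hcl f'.
  have [a ea] := hc (u - u').
  have d0 : \sum_i ((f i : nat)%:R - (f' i : nat)%:R - (p ^ N)%:R * a i) *: w i = 0.
    transitivity (s f - s f' - (p ^ N)%:R *: (\sum_i a i *: w i)).
      rewrite /s scaler_sumr -!sumrB; apply: eq_bigr => i _.
      by rewrite !scalerBl scalerA.
    rewrite -ea scalerA -natrM -expnD eu eu' ef addnC scalerBr.
    by rewrite opprD addrACA subrr add0r subrr.
  apply/ffunP => i; apply: val_inj => /=.
  have := ind _ d0 i; move/eqP; rewrite subr_eq0 => /eqP e.
  have : zp_seq ((f i : nat)%:R : R) N = zp_seq ((f' i : nat)%:R : R) N.
    by apply/zp_seqB0; rewrite e zp_seq_pM.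
  by rewrite !zp_natE !modz_nat !modn_small ?ltn_ord // => -[].
have := max_card (mem (codom cl)); rewrite card_ord (card_codom inj) card_ffun !card_ord.
by rewrite -expnM.
Qed.

(* M / p^(m N) has at most B^N elements when M / p^m has at most B, and at least
   p^(m N r - c') elements; let N tend to infinity. *)
Lemma rank_le_covered r r0 c m : fin_gen M -> has_rank M r -> (c < m)%N ->
  covered m (p ^ (m * r0 + c)) -> (r <= r0)%N.
Proof.
move=> fg rk cm cov; have [[w ind] _] := rk.
have [c' hc] := rank_span_uniform fg rk ind.
rewrite leqNgt; apply/negP => lt.
(* If r > r0, then m r >= m r0 + c + 1, and comparing the two bounds gives N <= c' r. The summand c'
   ensures c' <= m N. *)
pose N := (c' * r + c').+1.
have := covered_pow N cov; rewrite -expnM.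
have le : (c' <= m * N)%N.
  have m0 : (0 < m)%N by apply: leq_ltn_trans cm.
  by rewrite (leq_trans _ (leq_pmull N m0)) // /N leqW // leq_addl.
rewrite -(subnKC le) => /(covered_lower ind hc); rewrite leq_exp2l ?prime_gt1 // => h.
have : (m * N * r <= (m * r0 + c) * N + c' * r)%N.
  by rewrite -(subnKC le) mulnDl addnC leq_add2r.
have h2 : ((m * r0 + c).+1 * N <= m * N * r)%N.
  by rewrite mulnAC leq_mul2r (leq_trans _ (leq_mul (leqnn m) lt)) ?orbT // mulnS -addnS addnC leq_add2r.
move/(leq_trans h2); rewrite mulSn addnC leq_add2l /N.
by rewrite leqNgt ltnS leq_addr.
Qed.

(** Successive approximation: s is a combination of the representatives plus p^n t_n, where step k
    adds p^k to one coefficient. The coefficients converge in Z_p, and separatedness removes the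
    remainder. *)
Lemma fin_gen_covered B : (forall y : M, (forall N, exists u, y = (p ^ N)%:R *: u) -> y = 0) ->
  covered 1 B -> fin_gen M.
Proof.
move=> sep [x hx]; exists B, x => s.
pose nxt u := projT1 (cid (projT2 (cid (hx u)))).
pose cl u := projT1 (cid (hx u)).
have hn u : u = x (cl u) + p%:R *: nxt u.
  by rewrite -{2}[p]expn1; exact: projT2 (cid (projT2 (cid (hx u)))).
pose t n := iter n nxt s.
pose d a n : nat := \sum_(k < n) (if cl (t k) == a then p ^ k else 0)%N.
have hd a n : ((d a n.+1)%:Z = (d a n)%:Z %[mod (p ^ n)%N])%Z.
  rewrite /d big_ord_recr /= PoszD; case: ifP => _; last by rewrite addr0.
  by rewrite -[X in (_ + X)%R]mul1r addrC modzMDl.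
pose al a := zp_of (hd a).
have hal a n : exists b, al a = (d a n)%:R + (p ^ n)%:R * b.
  have [|b eb] := @zp_divp p p_pr n (al a - (d a n)%:R).
    by apply/zp_seqB0; rewrite zp_natE.
  by exists b; rewrite -eb addrC subrK.
have hs n : s = \sum_a (d a n)%:R *: x a + (p ^ n)%:R *: t n.
  elim: n => [|n IH].
    by rewrite big1 ?add0r ?expn0 ?scale1r // => a _; rewrite /d big_ord0 scale0r.
  rewrite {1}IH {1}(hn (t n)) scalerDr addrA scalerA -natrM -expnSr; congr (_ + _).
  rewrite /d; under [RHS]eq_bigr do rewrite big_ord_recr /= natrD scalerDl.
  rewrite big_split /=; congr (_ + _).
  rewrite (bigD1 (cl (t n))) //= eqxx big1 ?addr0 // => a an.
  by rewrite eq_sym (negbTE an) scale0r.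
exists al; apply/eqP; rewrite -subr_eq0; apply/eqP; apply: sep => n.
pose b a := projT1 (cid (hal a n)).
have hb a : al a = (d a n)%:R + (p ^ n)%:R * b a by exact: projT2 (cid (hal a n)).
exists (t n - \sum_a b a *: x a).
have -> : \sum_a al a *: x a = \sum_a (d a n)%:R *: x a + (p ^ n)%:R *: \sum_a b a *: x a.
  rewrite scaler_sumr -big_split; apply: eq_bigr => a _.
  by rewrite hb scalerDl scalerA.
by rewrite {1}(hs n) scalerBr opprD addrACA subrr add0r.
Qed.

Lemma covered_le m m' B : (m' <= m)%N -> covered m B -> covered m' B.
Proof.
move=> le [x hx]; exists x => s; have [a [u ->]] := hx s.
by exists a, ((p ^ (m - m'))%:R *: u); rewrite scalerA -natrM -expnD subnKC.
Qed.

Lemma covered_pigeonhole m B (s : nat -> M) : covered m B ->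
  exists i j u, (i < j <= B)%N /\ s i - s j = (p ^ m)%:R *: u.
Proof.
move=> [x hx]; pose cl i := projT1 (cid (hx (s i))).
have hcl i : exists u, s i = x (cl i) + (p ^ m)%:R *: u by exact: projT2 (cid (hx (s i))).
have : ~ injective (fun i : 'I_B.+1 => cl i).
  by move=> /leq_card; rewrite !card_ord ltnn.
move=> ninj; have [i [j [ij e]]] : exists i j : 'I_B.+1, (i < j)%N /\ cl i = cl j.
  apply: contrapT => h; apply: ninj => i j e; apply: val_inj => /=.
  by case: (ltngtP i j) => // lt; case: h; [exists i, j | exists j, i].
have [u eu] := hcl i; have [u' eu'] := hcl j.
exists i, j, (u - u'); split; first by rewrite ij -ltnS ltn_ord.
by rewrite eu eu' e opprD addrACA subrr add0r scalerBr.
Qed.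

Lemma covered_class m B (cl : M -> 'I_B -> Prop) : (forall s, exists a, cl s a) ->
  (forall s t a, cl s a -> cl t a -> exists u, s - t = (p ^ m)%:R *: u) -> covered m B.
Proof.
move=> tot h.
pose x a := if pselect (exists s, cl s a) is left e then projT1 (cid e) else 0.
exists x => s; have [a sa] := tot s; exists a; rewrite /x.
case: pselect => [e|[]]; last by exists s.
have [u eu] := h _ _ _ sa (projT2 (cid e)); exists u; rewrite -eu addrC subrK.
by [].
Qed.
End ZpModule.

(** * Openness *)

Section Lifts.
Variables (p : nat) (p_pr : prime p) (K : subfield).
Local Notation L := (max_unram p K).
Implicit Types (s : X p K) (t : aut).

Definition lifts t s : Prop := fixes K t /\ forall x : fsub L, t (fval x) = fval (Xgal s x).

Lemma lifts_exists s : exists t, lifts t s.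
Proof. by apply: gal_extend; case: (max_unr p_pr K) => [[]]. Qed.

Lemma lifts_of t : fixes K t -> exists s, lifts t s.
Proof. by move=> tK; have [nL _ _ _] := max_unr p_pr K; exists (aut_res nL tK). Qed.

Lemma lifts_eq t s t' s' : lifts t s -> lifts t' s' -> (forall x, x \in L -> t x = t' x) -> s = s'.
Proof.
move=> [_ h] [_ h'] tt'; apply: X_eq => x; apply: val_inj => /=.
by rewrite -h -h' tt' //; exact: fvalP.
Qed.

Lemma liftsB t s t' s' : lifts t s -> lifts t' s' -> lifts (t * t'^-1)%g (s - s').
Proof.
move=> [tK h] [tK' h']; split; first exact/fixesM/fixesV.
move=> x; rewrite X_addE -h autM; congr (t _).
apply: (@aut_inj t'); rewrite autVK h' -X_addE.
by rewrite subrr.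
Qed.

Lemma liftsMn t s n : lifts t s -> lifts (t ^+ n)%g (s *+ n).
Proof.
move=> [tK h]; split; first exact: fixesX.
elim: n => [|n IH] x //; rewrite mulrS X_addE -h -IH.
by rewrite expgS autM.
Qed.

Lemma pth_power_lifts m t s : lifts t s ->
  pth_power p K m t <-> exists u, s = (p ^ m)%:R *: u.
Proof.
move=> ts; split=> [[tK [v vK tv]]|[u su]].
  have [u vu] := lifts_of vK; exists u; rewrite scaler_nat.
  exact: lifts_eq ts (liftsMn (p ^ m) vu) tv.
have [v vu] := lifts_exists u; split; first by case: ts.
exists v => [|x xL]; first by case: vu.
have [_ h] := ts; have [_ h'] := liftsMn (p ^ m) vu.
by rewrite (h (MkFsub xL)) (h' (MkFsub xL)) su scaler_nat.
Qed.

(** The orbit of x under u has length a power p^i bounded by the number of conjugates of x. With N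
    equal to that number, i <= N, so u^(p^N) fixes x. *)
Lemma X_separated (y : X p K) : (forall N, exists u, y = (p ^ N)%:R *: u) -> y = 0.
Proof.
move=> h; apply: X_eq => x; have [l hl] := gal_conjugates K x.
have [u ->] := h (size l); rewrite scaler_nat X_mulrnE.
have [j hj] := max_unram_torsion u x.
have [a [b [ab bl e]]] : exists a b, [/\ (a < b)%N, (b <= size l)%N & (Xgal u ^+ a)%g x = (Xgal u ^+ b)%g x].
  pose f (i : 'I_(size l).+1) := (Xgal u ^+ i)%g x.
  have ninj : ~ injective f.
    move=> inj; have : uniq (map f (enum 'I_(size l).+1)) by rewrite map_inj_uniq // enum_uniq.
    have sub : {subset map f (enum 'I_(size l).+1) <= l} by move=> _ /mapP[i _ ->]; exact: hl.
    by move=> uq; have := uniq_leq_size uq sub; rewrite size_map size_enum_ord ltnn.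
  apply: contrapT => hn; apply: ninj => i i' e; apply: val_inj => /=.
  by case: (ltngtP i i') => // lt; case: hn; [exists i, i' | exists i', i]; split=> //; rewrite -ltnS ltn_ord.
have fixD q : (Xgal u ^+ q)%g x = x -> forall r, (Xgal u ^+ (q * r))%g x = x.
  by move=> hq r; rewrite expgM; exact: gal_fixX.
have e1 : (Xgal u ^+ (b - a))%g x = x.
  apply: (bij_inj (gal_bij (Xgal u ^+ a)%g)); rewrite -gal_mulE -expgD subnKC ?e //; exact: ltnW.
have : (Xgal u ^+ gcdn (b - a) (p ^ j))%g x = x.
  have ba : (0 < b - a)%N by rewrite subn_gt0.
  case: (egcdnP (p ^ j) ba) => km kn ekm _.
  have := fixD _ e1 km; rewrite mulnC ekm addnC expgD gal_mulE [(kn * _)%N]mulnC.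
  by rewrite (fixD _ hj kn).
have [i ij ei] : exists2 i, (i <= j)%N & gcdn (b - a) (p ^ j) = (p ^ i)%N.
  by apply/(dvdn_pfactor _ _ p_pr); exact: dvdn_gcdr.
rewrite ei => hi; have il : (i <= size l)%N.
  apply: (leq_trans (ltnW (ltn_expl i (prime_gt1 p_pr)))); rewrite -ei.
  apply: leq_trans (dvdn_leq _ (dvdn_gcdl _ _)) _; first by rewrite subn_gt0.
  exact: leq_trans (leq_subr _ _) bl.
by rewrite -(subnKC il) expnD; exact: fixD.
Qed.
End Lifts.

(** A relation between lifts projects to one between coinvariants, so lifts of independent elements
    are independent. *)
Lemma coinv_rank (p : nat) (p_pr : prime p) (k K : subfield) r :
  fin_gen (X p K) -> has_rank (X p K) r -> exists2 r', (r' <= r)%N & s_ext p k K r'.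
Proof.
move=> [g [v gen]] [_ mx].
have pi0 : coinv_pi k (0 : X p K) = 0.
  by apply: (@addrI _ (coinv_pi k 0)); rewrite addr0 -coinv_piD addr0.
have lin n (a : 'I_n -> Zp p) (w : 'I_n -> X p K) :
    coinv_pi k (\sum_i a i *: w i) = \sum_i a i *: coinv_pi k (w i).
  rewrite (big_morph _ (@coinv_piD p k K) pi0); apply: eq_bigr => i _.
  by rewrite -coinv_scale_pi.
have fg : fin_gen (coinvariants p k K).
  exists g, (fun i => coinv_pi k (v i)) => c; have [s ->] := coinv_pi_surj c.
  by have [a ->] := gen s; exists a; rewrite lin.
have [r' rk] := rank_exists p_pr fg; exists r' => //.
have [[w ind] _] := rk; pose s i := projT1 (cid (coinv_pi_surj (w i))).
have hs i : w i = coinv_pi k (s i) by exact: projT2 (cid (coinv_pi_surj (w i))).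
apply: (mx _ s) => a e; apply: ind; rewrite -[RHS]pi0 -e lin.
by apply: eq_bigr => i _; rewrite hs.
Qed.

(** K shows that the set of values is inhabited, so [xget] returns its minimum and not the
    default. *)
Lemma s_min_le (p : nat) (k : subfield) (K : Zp_ext p k) r :
  E_ram K -> s_ext p k K r -> (s_min p k <= r)%N.
Proof.
move=> ram sK.
suff /(xgetPex 0%N)[_ h] : exists m, (exists2 K' : Zp_ext p k, E_ram K' & s_ext p k K' m) /\
    forall (K' : Zp_ext p k) r', E_ram K' -> s_ext p k K' r' -> (m <= r')%N by exact: h ram sK.
pose Q m := `[< exists2 K' : Zp_ext p k, E_ram K' & s_ext p k K' m >].
have exQ : exists m, Q m by exists r; apply/asboolP; exists K.
case: (ex_minnP exQ) => m /asboolP hm mn; exists m; split=> // K' r' h1 h2.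
by apply: mn; apply/asboolP; exists K'.
Qed.

Lemma pth_power_agree (p : nat) (F : subfield) m (s t : aut) : prime p ->
  fixes F t -> (forall x, x \in max_unram p F -> s x = t x) ->
  pth_power p F m s -> pth_power p F m t.
Proof.
by move=> p_pr tF st [sF [v vF sv]]; split=> //; exists v => // x xL; rewrite -st // sv.
Qed.

(** By [fukuda] a class of X(K')/p^m is determined by its image in X(K_n)/p^m, and total
    ramification lifts that image to X(K). The class of the lift modulo p^m then serves as label. *)
Lemma covered_near (p : nat) (p_pr : prime p) (k K K' : subfield) (k_nf : number_field k)
    e e' n m B : zext_hom (p := p) k K e -> zext_hom (p := p) k K' e' ->
  totally_ramified k e n -> totally_ramified k e' n -> layer p k K n = layer p k K' n -> stable_at p k K' n m ->
  covered (X p K) m B -> covered (X p K') m B.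
Proof.
move=> he he' tot tot' eL st [x hx].
pose Ln := max_unram p (layer p k K n).
pose cl (s' : X p K') a := exists (t' t : aut) (s : X p K) u,
  [/\ lifts t' s', lifts t s, forall y, y \in Ln -> t y = t' y & s = x a + (p ^ m)%:R *: u].
apply: (@covered_class p (X p K') m B cl).
  move=> s'; have [t' ts'] := lifts_exists p_pr s'.
  have tn : fixes (layer p k K n) t'.
    by rewrite eL; apply: fixesK_layer; case: ts'.
  have [t tK tt'] := totram_res p_pr he tot tn.
  have [s ts] := lifts_of p_pr tK; have [a [u es]] := hx s.
  by exists a, t', t, s, u.
move=> s1' s2' a [t1' [t1 [s1 [u1 [ts1' ts1 tt1 e1]]]]] [t2' [t2 [s2 [u2 [ts2' ts2 tt2 e2]]]]].
apply/(pth_power_lifts p_pr m (liftsB ts1' ts2')).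
have tK : fixes K' (t1' * t2'^-1)%g by case: (liftsB ts1' ts2').
apply: (fukuda p_pr k_nf he' tot' st tK).
rewrite -eL; apply: (@pth_power_agree _ _ _ (t1 * t2^-1)%g) => //.
- by rewrite eL; exact: fixesK_layer.
- move=> y yL; rewrite !autM.
  have [[_ stL] _ _ _] := max_unr p_pr (layer p k K n).
  have yL' : t2'^-1%g y \in Ln.
    apply: stL => //; apply: fixesV; rewrite eL; apply: fixesK_layer; by case: ts2'.
  rewrite -tt1 //; congr (t1 _); apply: (@aut_inj t2).
  by rewrite autVK tt2 // autVK.
- apply: (pth_power_layer p_pr); apply/(pth_power_lifts p_pr m (liftsB ts1 ts2)).
  by exists (u1 - u2); rewrite e1 e2 opprD addrACA subrr add0r scalerBr.
Qed.

Local Open Scope classical_set_scope.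

Theorem theorem5p9 (p : nat) (p_pr : prime p) (k : subfield) (k_nf : number_field k) :
  open [set K : Zp_ext p k |
    [/\ E_ram K, fin_gen (X p K) & has_rank (X p K) (s_min p k)]].
Proof.
change (zext_open [set K : Zp_ext p k |
  [/\ E_ram K, fin_gen (X p K) & has_rank (X p K) (s_min p k)]]).
move=> K [ramK fgK rkK].
have [e he] := zext_hom_exists (zextP K).
have [a ha] := ram_level p_pr k_nf he ((E_ramP (zhN he)).1 ramK).
have tot := totram_ge p_pr he ha.
have [c cov] := covered_rank p_pr fgK rkK; pose m := c.+1.
have [n an stab_n] : exists2 n, (a <= n)%N & stable_at p k K n m.
  apply: (stable_exists p_pr he tot) => s sK.
  pose s' i := projT1 (cid (lifts_of p_pr (sK i))).
  have hs' i : lifts (s i) (s' i) by exact: projT2 (cid (lifts_of p_pr (sK i))).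
  have [i [j [u [ij e1]]]] := covered_pigeonhole s' (cov m).
  exists i, j; split; first exact: ij.
  by apply/(pth_power_lifts p_pr m (liftsB (hs' i) (hs' j))); exists u.
(* Stability compares the layers n and n + 1, and the ramification level is read on the layer a + 1,
   so the fields must agree up to n + 1. *)
exists n.+1 => K' near.
have [e' he'] := zext_hom_exists (zextP K').
have eL := layer_near p_pr he he' near.
have ha' (P : prime_idealr O) : p%:R \in P ->
    exists t, [/\ inertial P t, fixes k t & zp_seq (e' t) a.+1 != 0].
  move=> /ha[t [tP tk et]]; exists t; split=> //; apply: contra et => /eqP.
  by move/(layer_fix p_pr he' _ tk); rewrite -eL // => /(layer_fix p_pr he _ tk) ->.
have ramK' : E_ram K'.
  apply/(E_ramP (zhN he')) => P /ha'[t [tP tk et]]; exists t; split=> // tK.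
  by move/eqP: et; apply; rewrite (zh0 he' tk).2 // zp_seq0.
have cov' : covered (X p K') m (p ^ (m * s_min p k + c)).
  apply: (covered_near p_pr k_nf he he' (tot n an)) (cov m).
  - exact: (totram_ge p_pr he' ha' an).
  - exact: eL.
  - by move: stab_n; rewrite /stable_at !eL.
have fgK' : fin_gen (X p K').
  exact: (fin_gen_covered p_pr (@X_separated p p_pr K') (covered_le (ltn0Sn c) cov')).
have [r rk] := rank_exists p_pr fgK'.
have le1 := rank_le_covered p_pr fgK' rk (ltnSn c) cov'.
have [r' le2 sK'] := coinv_rank p_pr k fgK' rk.
split=> //; rewrite (_ : s_min p k = r) //; apply/eqP; rewrite eqn_leq le1 andbT.
exact: leq_trans (s_min_le ramK' sK') le2.
Qed.
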